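(* Let $0<\gamma<1$ and $\alpha\in\mathbb{R}$. Let $f\in H(\mathbb{D})$ be a $\mathcal{U}_{\beta^\gamma}$-frequently hypercyclic function for $T_\alpha$. Then - if $\alpha\leq0$, then $\limsup_{r\to1^-}\big((1-r)^{-\alpha}M_1(f,r)\big)=+\infty$; - if $\alpha>0$, then $\limsup_{r\to1^-}M_1(f,r)>0$. These results are optimal in the following sense: for any positive integer $l\geq1$ and $\alpha\ne0$ there exist a $\mathcal{U}_{\beta^\gamma}$-frequently hypercyclic function $f\in H(\mathbb{D})$ for $T_\alpha$ and a constant $C>0$ such that for every $0<r<1$ sufficiently large (i.e. sufficiently close to $1$) $$M_1(f,r)\leq\begin{cases}C(1-r)^{\alpha}\log_l(-\log(1-r))&\text{if }\alpha<0,\\ C&\text{if }\alpha>0.\end{cases}$$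
   Context: $\mathbb{D}$ is the open unit disc in $\mathbb{C}$ and $H(\mathbb{D})$ is the Fréchet space of analytic functions on $\mathbb{D}$ with the topology of uniform convergence on compact subsets. For $\alpha\in\mathbb{R}$ and $n\ge1$ put $w_n(\alpha)=(1+\frac1n)^{\alpha}$; the weighted Taylor shift $T_\alpha:H(\mathbb{D})\to H(\mathbb{D})$ is $T_\alpha\big(\sum_{k\ge0}a_kz^k\big)=\sum_{k\ge0}a_{k+1}w_{k+1}(\alpha)z^k$. For $0\le\gamma\le1$ and $E\subset\mathbb{N}$, the upper $\beta^\gamma$-density is $\overline d_{\beta^\gamma}(E)=\limsup_{n\to\infty}\frac{\sum_{1\le k\le n,\,k\in E}e^{k^\gamma}}{\sum_{k=1}^ne^{k^\gamma}}$. A function $f\in H(\mathbb{D})$ is $\mathcal{U}_{\beta^\gamma}$-frequently hypercyclic for $T_\alpha$ if for every non-empty open set $U\subset H(\mathbb{D})$, $\overline d_{\beta^\gamma}(\{n\in\mathbb{N}:T_\alpha^nf\in U\})>0$. For $0<r<1$, $M_1(f,r)=\frac1{2\pi}\int_0^{2\pi}|f(re^{i\theta})|\,d\theta$. For a positive integer $l$, $\log_l=\log\circ\dots\circ\log$ ($l$ times). *)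

(* Defs.v *)
From Stdlib Require Import Reals Factorial ClassicalEpsilon.
From Coquelicot Require Import Coquelicot.

Open Scope R_scope.

Definition disc (z : C) : Prop := Cmod z < 1.

Definition analytic_at (f : C -> C) (z0 : C) : Prop :=
  exists (a : nat -> C) (rho : posreal), forall z : C,
    Cmod (z - z0)%C < rho ->
    is_pseries (K := C_AbsRing) (V := C_NormedModule) a (z - z0)%C (f z).

(** Elements of H(D) are represented by functions on all of [C]; nothing below
    depends on their values outside the disc. *)
Definition HD (f : C -> C) : Prop := forall z : C, disc z -> analytic_at f z.

Definition compact_set (K : C -> Prop) : Prop :=
  forall (I : Type) (O : I -> C -> Prop),
    (forall i, open (O i)) ->
    (forall z, K z -> exists i, O i z) ->
    exists s : list I, forall z, K z -> exists i, List.In i s /\ O i z.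

(** Open subsets of H(D) for uniform convergence on compact subsets of D.
    A finite union of compact sets is compact, so a single pair [(K, eps)]
    describes the basic neighbourhoods. *)
Definition open_HD (U : (C -> C) -> Prop) : Prop :=
  (forall g, U g -> HD g) /\
  forall g, U g ->
    exists (K : C -> Prop) (eps : posreal),
      compact_set K /\ (forall z, K z -> disc z) /\
      forall h, HD h -> (forall z, K z -> Cmod (h z - g z)%C < eps) -> U h.

Definition taylor_coeff (f : C -> C) (k : nat) : C :=
  (Nat.iter k C_derive f 0 / INR (fact k))%C.

(** Coquelicot's [Series] is real-valued, hence the componentwise sum. *)
Definition Cpseries (a : nat -> C) (z : C) : C :=
  (Series (fun k => Re (a k * z ^ k)%C), Series (fun k => Im (a k * z ^ k)%C)).

Definition w (alpha : R) (n : nat) : R := Rpower (1 + / INR n) alpha.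

Definition taylor_shift (alpha : R) (f : C -> C) : C -> C :=
  Cpseries (fun k => (taylor_coeff f (S k) * w alpha (S k))%C).

Definition indicator (E : nat -> Prop) (k : nat) : R :=
  if excluded_middle_informative (E k) then 1 else 0.

Definition beta_weight (gamma : R) (k : nat) : R := exp (Rpower (INR k) gamma).

Definition upper_density (gamma : R) (E : nat -> Prop) : Rbar :=
  LimSup_seq (fun n =>
    sum_n_m (fun k => indicator E k * beta_weight gamma k) 1 n
      / sum_n_m (beta_weight gamma) 1 n).

Definition U_frequently_hypercyclic
    (gamma : R) (T : (C -> C) -> (C -> C)) (f : C -> C) : Prop :=
  HD f /\
  forall U : (C -> C) -> Prop, open_HD U -> (exists g, U g) ->
    Rbar_lt 0 (upper_density gamma (fun n => U (Nat.iter n T f))).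

Definition M1 (f : C -> C) (r : R) : R :=
  / (2 * PI) * RInt (fun t => Cmod (f (r * cos t, r * sin t))) 0 (2 * PI).

Definition LimSup (F : (R -> Prop) -> Prop) (g : R -> R) : Rbar :=
  Rbar_glb (fun y => exists P, F P /\
    y = Rbar_lub (fun x => exists r, P r /\ x = Finite (g r))).

Definition iter_log (l : nat) (x : R) : R := Nat.iter l ln x.

(* Main.v *)
Require Import Defs.
From Stdlib Require Import Reals Lra Lia ZArith ClassicalEpsilon Cantor.
From Coquelicot Require Import Coquelicot.
Open Scope R_scope.

(** Write [a_n] for the Taylor coefficients of [f] and [T] for the shift. The weights
    telescope: the [k]-th coefficient of [T^n f] is [a_(n+k) ((n+k+1)/(k+1))^alpha]
    ([taylor_coeff_iter_shift]). Cauchy's estimate reads [|a_n| r^n <= M1 f r]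
    ([HD_taylor_M1]).

    Lower bounds. The value of [T^n f] at the origin is [a_n (n+1)^alpha]. An orbit that
    visits every open set for arbitrarily large [n] makes this unbounded, and the radius
    [r = 1 - 1/(n+1)], for which [r^n >= 1/e], transfers the growth to
    [(1-r)^(-alpha) M1 f r] ([means_unbounded]). When [alpha > 0] it suffices that some
    coefficient is nonzero ([means_not_vanishing]).

    Optimality. The function is a lacunary sum of blocks
    [N^(-alpha) z^s V(z^d) Q(z)], one for each index [j]. Here [Q] is a polynomial of degree
    less than [d] whose [k]-th coefficient is [(k+1)^alpha] times that of a target polynomial
    [P], and [V] is a trapezoidal kernel with [M] rising, [M] constant and [M] falling steps,
    where [M] is the integer part of [N^(1-gamma) / d]; the constant stretch of [V(z^d)],
    shifted by [s], ends at [N].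
    Three facts make it work.
    - If [n] is one of the [M+1] plateau positions, the coefficients of [T^n f] of index
      less than [d] are nearly those of [P], since [(n+k+1)/N] is close to [1]; the others are
      bounded by a power of their index, uniformly in [d], so they are harmless on compact
      sets once [d] is large ([shifted_blocks_approx]).
    - The plateau fills, with step [d], about the last [N^(1-gamma)] integers up to [N]. There
      [exp (n^gamma)] varies by a factor at most [e], and these integers carry a positive
      proportion of the weight of all the integers up to [N] ([progression_density]).
      As every pair [(P, d)] is used for infinitely many [j], upper densities are positive.
    - The mean of [|V|] on circles is at most [3/2] whatever [M] is: [V] is, up to the factor
      [1/(M+1)], a product of two geometric sums of lengths [2M+1] and [M+1], and
      [|XY| <= (|X|^2 + |Y|^2)/2] reduces the claim to the orthogonality of the powers of [z]
      ([geometric_sum_L2], [block_mean_le]). A block thus costs at most twice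
      [N^(-alpha) r^s] times the sum of the moduli of the coefficients of [Q].
    If [alpha > 0] and [N] grows fast in [j], these costs have a bounded sum. If [alpha < 0],
    the blocks with [(1-r)^2 N > 1] have a bounded total cost because of the factor [r^s], and
    each of the others costs a constant, depending on [Q], times [(1-r)^alpha]. The sum of
    these constants is dominated by any function of [r] that tends to infinity, such as
    an iterated logarithm, provided that [N] grows fast enough ([means_bounded_negative]).

    The underlying complex analysis starts from functions that are locally sums of power
    series: term by term differentiation ([Cpseries_is_derive]), Cauchy's formula obtained
    by contracting the circle to the point ([cauchy_formula_Re]), and from it the
    Taylor expansion in every disc where the function has a continuous derivative
    ([cauchy_expansion]). Applied to translates, the latter also shows that the sum of a power
    series is analytic at each point of its disc ([HD_Cpseries]). *)

(** * Finite sums *)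

Fixpoint csum (u : nat -> C) (n : nat) : C :=
  match n with O => 0 | S m => (csum u m + u m)%C end.

Fixpoint rsum (u : nat -> R) (n : nat) : R :=
  match n with O => 0 | S m => rsum u m + u m end.

Lemma csum_ext u v n : (forall k, (k < n)%nat -> u k = v k) -> csum u n = csum v n.
Proof.
  induction n as [|n IH]; intros H; simpl; [reflexivity|].
  rewrite IH, H; auto with arith.
Qed.

Lemma rsum_ext u v n : (forall k, (k < n)%nat -> u k = v k) -> rsum u n = rsum v n.
Proof.
  induction n as [|n IH]; intros H; simpl; [reflexivity|].
  rewrite IH, H; auto with arith.
Qed.

Lemma csum_0 n : csum (fun _ => RtoC 0) n = 0.
Proof. induction n as [|n IH]; simpl; [reflexivity|]. rewrite IH. ring. Qed.

Lemma csum_all_0 (u : nat -> C) n : (forall k, (k < n)%nat -> u k = 0) -> csum u n = 0.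
Proof. intros Hu. rewrite (csum_ext u (fun _ => RtoC 0)), csum_0; auto. Qed.

Lemma csum_single (u : nat -> C) j n :
  (j < n)%nat -> (forall k, k <> j -> u k = 0) -> csum u n = u j.
Proof.
  intros Hj Hu. induction n as [|n IH]; [lia|]. simpl.
  destruct (Nat.eq_dec j n) as [->|Hn].
  - rewrite (csum_ext u (fun _ => RtoC 0)), csum_0 by (intros; apply Hu; lia). ring.
  - rewrite IH, (Hu n) by lia. ring.
Qed.

Lemma csum_plus u v n : csum (fun k => u k + v k)%C n = (csum u n + csum v n)%C.
Proof. induction n as [|n IH]; simpl; [ring|]. rewrite IH. ring. Qed.

Lemma csum_scal c u n : csum (fun k => c * u k)%C n = (c * csum u n)%C.
Proof. induction n as [|n IH]; simpl; [ring|]. rewrite IH. ring. Qed.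

Lemma csum_add u n m : csum u (n + m) = (csum u n + csum (fun k => u (n + k)%nat) m)%C.
Proof.
  induction m as [|m IH]; simpl.
  - rewrite Nat.add_0_r. ring.
  - rewrite Nat.add_succ_r. simpl. rewrite IH. ring.
Qed.

Lemma csum_swap (u : nat -> nat -> C) n m :
  csum (fun i => csum (u i) m) n = csum (fun k => csum (fun i => u i k) n) m.
Proof.
  induction n as [|n IH]; simpl.
  - symmetry. apply csum_0.
  - rewrite IH, <- csum_plus. reflexivity.
Qed.

Lemma csum_blocks u d n :
  csum u (d * n) = csum (fun i => csum (fun k => u (d * i + k)%nat) d) n.
Proof.
  induction n as [|n IH]; simpl.
  - rewrite Nat.mul_0_r. reflexivity.
  - rewrite Nat.mul_succ_r, csum_add, IH. reflexivity.
Qed.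

Lemma rsum_le u v n : (forall k, (k < n)%nat -> u k <= v k) -> rsum u n <= rsum v n.
Proof.
  induction n as [|n IH]; intros H; simpl; [lra|].
  assert (rsum u n <= rsum v n) by (apply IH; auto with arith).
  assert (u n <= v n) by auto with arith. lra.
Qed.

Lemma rsum_scal c u n : rsum (fun k => c * u k) n = c * rsum u n.
Proof. induction n as [|n IH]; simpl; [ring|]. rewrite IH. ring. Qed.

Lemma rsum_const c n : rsum (fun _ => c) n = INR n * c.
Proof.
  induction n as [|n IH]; [simpl; ring|].
  rewrite S_INR. simpl rsum. rewrite IH. ring.
Qed.

Lemma rsum_nonneg u n : (forall k, (k < n)%nat -> 0 <= u k) -> 0 <= rsum u n.
Proof.
  intros H. apply Rle_trans with (rsum (fun _ => 0) n).
  - rewrite rsum_const. lra.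
  - now apply rsum_le.
Qed.

Lemma rsum_incr u n m : (n <= m)%nat -> (forall k, 0 <= u k) -> rsum u n <= rsum u m.
Proof.
  intros H Hu. induction H as [|m _ IH]; simpl; [lra|]. specialize (Hu m). lra.
Qed.

Lemma rsum_term u n k : (k < n)%nat -> (forall i, (i < n)%nat -> 0 <= u i) -> u k <= rsum u n.
Proof.
  induction n as [|n IH]; intros Hk Hu; [lia|]. simpl.
  destruct (Nat.eq_dec k n) as [->|Hn].
  - assert (0 <= rsum u n) by (apply rsum_nonneg; auto with arith). lra.
  - assert (u k <= rsum u n) by (apply IH; auto with arith; lia).
    assert (0 <= u n) by auto with arith. lra.
Qed.

Lemma Cmod_csum u n : Cmod (csum u n) <= rsum (fun k => Cmod (u k)) n.
Proof.
  induction n as [|n IH]; simpl.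
  - rewrite Cmod_0. lra.
  - eapply Rle_trans; [apply Cmod_triangle|]. lra.
Qed.

Lemma Re_csum u n : Re (csum u n) = rsum (fun k => Re (u k)) n.
Proof. induction n as [|n IH]; simpl; [reflexivity|]. now rewrite <- IH. Qed.

Lemma Im_csum u n : Im (csum u n) = rsum (fun k => Im (u k)) n.
Proof. induction n as [|n IH]; simpl; [reflexivity|]. now rewrite <- IH. Qed.

Lemma RtoC_rsum u n : RtoC (rsum u n) = csum (fun k => RtoC (u k)) n.
Proof. induction n as [|n IH]; simpl; [reflexivity|]. now rewrite RtoC_plus, IH. Qed.

Lemma csum_sum_n u n : sum_n u n = csum u (S n).
Proof.
  induction n as [|n IH].
  - rewrite sum_O. symmetry. exact (Cplus_0_l _).
  - rewrite sum_Sn, IH. reflexivity.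
Qed.

Lemma rsum_sum_n u n : sum_n u n = rsum u (S n).
Proof.
  induction n as [|n IH].
  - rewrite sum_O. symmetry. exact (Rplus_0_l _).
  - rewrite sum_Sn, IH. reflexivity.
Qed.

Lemma rsum_geom q n : 0 <= q < 1 -> rsum (fun k => q ^ k) n <= / (1 - q).
Proof.
  intros Hq. assert (E : rsum (fun k => q ^ k) n = (1 - q ^ n) / (1 - q)).
  { induction n as [|n IH]; simpl; [|rewrite IH]; field; lra. }
  rewrite E. apply Rmult_le_reg_r with (1 - q); [lra|].
  unfold Rdiv. rewrite Rmult_assoc, !Rinv_l by lra.
  assert (0 <= q ^ n) by (apply pow_le; lra). lra.
Qed.

(** * Limits in the complex plane *)

Lemma Cmod_Re_Im (z : C) : Cmod z <= Rabs (Re z) + Rabs (Im z).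
Proof.
  replace z with (RtoC (Re z) + Ci * RtoC (Im z))%C at 1.
  - eapply Rle_trans; [apply Cmod_triangle|].
    rewrite Cmod_mult, Cmod_Ci, !Cmod_R. lra.
  - destruct z as [x y]. unfold Ci, RtoC, Cplus, Cmult; simpl. f_equal; ring.
Qed.

Lemma im_le_Cmod (z : C) : Rabs (Im z) <= Cmod z.
Proof. eapply Rle_trans; [|apply Rmax_Cmod]. apply Rmax_r. Qed.

Lemma locally_Cmod (z : C) (P : C -> Prop) :
  locally z P <-> exists d, 0 < d /\ forall y, Cmod (y - z) < d -> P y.
Proof.
  split.
  - intros [d Hd]. exists d. split; [apply cond_pos|].
    intros y Hy. apply Hd. now apply C_NormedModule_mixin_compat1.
  - intros [d [H0 Hd]].
    assert (H1 : 0 < d / 2) by lra.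
    exists (mkposreal _ H1). intros y [H2 H3]. apply Hd.
    eapply Rle_lt_trans; [apply Cmod_Re_Im|].
    assert (Rabs (Re (y - z)) < d / 2) by exact H2.
    assert (Rabs (Im (y - z)) < d / 2) by exact H3. lra.
Qed.

Lemma filterlim_C {T : Type} (F : (T -> Prop) -> Prop) {FF : Filter F} (u : T -> C) (l : C) :
  filterlim u F (locally l) <-> forall e, 0 < e -> F (fun x => Cmod (u x - l) < e).
Proof.
  split.
  - intros H e He. apply (H (fun y => Cmod (y - l) < e)).
    apply locally_Cmod. now exists e.
  - intros H P HP. apply locally_Cmod in HP. destruct HP as [d [Hd HP]].
    unfold filtermap. generalize (H d Hd). apply filter_imp. intros x. apply HP.
Qed.

Lemma is_pseries_C (a : nat -> C) (z l : C) :
  is_pseries (K := C_AbsRing) (V := C_NormedModule) a z l <->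
  forall e, 0 < e -> exists N, forall n, (N <= n)%nat ->
    Cmod (csum (fun k => a k * z ^ k)%C n - l) < e.
Proof.
  assert (E : forall n, sum_n (fun k => scal (pow_n (K := C_AbsRing) z k) (a k : C_NormedModule)) n
     = csum (fun k => a k * z ^ k)%C (S n)).
  { intros n. rewrite csum_sum_n. apply csum_ext. intros k _.
    change (Cmult (pow_n (K := C_AbsRing) z k) (a k) = Cmult (a k) (z ^ k)%C).
    rewrite (Cmult_comm (a k)). reflexivity. }
  unfold is_pseries, is_series. rewrite (filterlim_C eventually). split; intros H e He.
  - destruct (H e He) as [N HN]. exists (S N). intros n Hn.
    destruct n as [|n]; [lia|]. rewrite <- E. apply HN. lia.
  - destruct (H e He) as [N HN]. exists N. intros n Hn. rewrite E. apply HN. lia.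
Qed.

Lemma is_derive_C (f : C -> C) (z l : C) :
  is_derive (K := C_AbsRing) (V := C_NormedModule) f z l <->
  forall e, 0 < e -> exists d, 0 < d /\ forall y, Cmod (y - z) < d ->
    Cmod (f y - f z - l * (y - z)) <= e * Cmod (y - z).
Proof.
  split.
  - intros [_ H] e He.
    specialize (H z (fun P HP => HP) (mkposreal e He)).
    destruct H as [d Hd]. exists d. split; [apply cond_pos|].
    intros y Hy. specialize (Hd y Hy). simpl in Hd.
    rewrite (Cmult_comm l). exact Hd.
  - intros H. split; [apply is_linear_scal_l|].
    intros x Hx. apply (is_filter_lim_locally_unique (V := AbsRing_NormedModule C_AbsRing)) in Hx. subst x.
    intros e. destruct (H e (cond_pos e)) as [d [Hd H1]].
    exists (mkposreal d Hd). intros y Hy. specialize (H1 y Hy).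
    rewrite (Cmult_comm l) in H1. exact H1.
Qed.

(** * Power series on a disc *)

(** Boundedness of the terms on every smaller circle. This is equivalent to convergence in
    the open disc of radius [rho], and it is preserved by the operations on coefficients used
    below without any discussion of summability. *)
Definition disc_coeffs (rho : R) (a : nat -> C) : Prop :=
  forall r, 0 <= r < rho -> exists B, forall k, Cmod (a k) * r ^ k <= B.

(** Comparison with a slightly larger radius turns bounded terms into geometric decay. *)
Lemma disc_coeffs_geom rho a r :
  disc_coeffs rho a -> 0 <= r < rho ->
  exists B q, 0 <= B /\ 0 <= q < 1 /\ forall k, Cmod (a k) * r ^ k <= B * q ^ k.
Proof.
  intros Ha Hr. set (s := (r + rho) / 2).
  assert (Hs : r < s < rho) by (unfold s; lra).
  destruct (Ha s) as [B HB]; [lra|].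
  exists B, (r / s).
  assert (H0 : 0 <= B).
  { eapply Rle_trans; [|apply (HB O)]. simpl. rewrite Rmult_1_r. apply Cmod_ge_0. }
  assert (Hq : 0 <= r / s < 1).
  { split; [apply Rdiv_le_0_compat; lra|].
    apply Rmult_lt_reg_r with s; [lra|]. unfold Rdiv.
    rewrite Rmult_assoc, Rinv_l; lra. }
  repeat split; try tauto.
  intros k. replace r with (s * (r / s)) at 1 by (field; lra).
  rewrite Rpow_mult_distr, <- Rmult_assoc.
  apply Rmult_le_compat_r; [apply pow_le; tauto|apply HB].
Qed.

Lemma disc_coeffs_scal_le rho a b K :
  disc_coeffs rho a -> (forall k, Cmod (b k) <= K * Cmod (a k)) -> disc_coeffs rho b.
Proof.
  intros Ha Hb r Hr. destruct (Ha r Hr) as [B HB].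
  exists (Rabs K * B). intros k.
  assert (0 <= r ^ k) by (apply pow_le; lra).
  apply Rle_trans with (Rabs K * Cmod (a k) * r ^ k).
  - apply Rmult_le_compat_r; [assumption|].
    eapply Rle_trans; [apply Hb|]. apply Rmult_le_compat_r; [apply Cmod_ge_0|apply Rle_abs].
  - rewrite Rmult_assoc. apply Rmult_le_compat_l; [apply Rabs_pos|apply HB].
Qed.

Lemma disc_coeffs_shift rho a : disc_coeffs rho a -> disc_coeffs rho (fun k => a (S k)).
Proof.
  intros Ha r Hr. set (s := (r + rho) / 2).
  assert (Hs : r < s < rho) by (unfold s; lra).
  destruct (Ha s) as [B HB]; [lra|].
  exists (B / s). intros k. apply Rmult_le_reg_r with s; [lra|].
  unfold Rdiv. rewrite (Rmult_assoc B), Rinv_l, Rmult_1_r by lra.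
  eapply Rle_trans; [|apply (HB (S k))].
  rewrite Rmult_assoc. apply Rmult_le_compat_l; [apply Cmod_ge_0|].
  simpl. rewrite Rmult_comm. apply Rmult_le_compat_l; [lra|].
  apply pow_incr; lra.
Qed.

Lemma INR_mul_pow_le q k : 0 <= q < 1 -> INR k * q ^ k <= / (1 - q).
Proof.
  intros Hq. eapply Rle_trans; [|apply (rsum_geom q k Hq)].
  rewrite <- rsum_const. apply rsum_le. intros i Hi.
  replace k with (i + (k - i))%nat by lia. rewrite pow_add.
  rewrite <- (Rmult_1_r (q ^ i)) at 2.
  apply Rmult_le_compat_l; [apply pow_le; lra|].
  rewrite <- (pow1 (k - i)). apply pow_incr; lra.
Qed.

Lemma disc_coeffs_mul_index rho a :
  disc_coeffs rho a -> disc_coeffs rho (fun k => INR k * a k)%C.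
Proof.
  intros Ha r Hr. destruct (disc_coeffs_geom rho a r Ha Hr) as [B [q [HB [Hq H]]]].
  exists (B * / (1 - q)). intros k.
  rewrite Cmod_mult, Cmod_R, Rabs_pos_eq, Rmult_assoc by apply pos_INR.
  apply Rle_trans with (INR k * (B * q ^ k)).
  - apply Rmult_le_compat_l; [apply pos_INR|apply H].
  - replace (INR k * (B * q ^ k)) with (B * (INR k * q ^ k)) by ring.
    apply Rmult_le_compat_l; [assumption|now apply INR_mul_pow_le].
Qed.

Definition deriv_coeffs (a : nat -> C) (k : nat) : C := (INR (S k) * a (S k))%C.

Lemma disc_coeffs_deriv rho a : disc_coeffs rho a -> disc_coeffs rho (deriv_coeffs a).
Proof.
  intros Ha. apply (disc_coeffs_shift rho (fun k => INR k * a k)%C).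
  now apply disc_coeffs_mul_index.
Qed.

Lemma rsum_tail_geom B q n m :
  0 <= B -> 0 <= q < 1 -> rsum (fun k => B * q ^ (n + k)) m <= B * / (1 - q) * q ^ n.
Proof.
  intros HB Hq.
  rewrite (rsum_ext _ (fun k => B * q ^ n * q ^ k)).
  2:{ intros k _. rewrite pow_add. ring. }
  rewrite rsum_scal. replace (B * / (1 - q) * q ^ n) with (B * q ^ n * / (1 - q)) by ring.
  apply Rmult_le_compat_l; [|now apply rsum_geom].
  apply Rmult_le_pos; [assumption|apply pow_le; lra].
Qed.

Lemma geom_ex_series (u : nat -> R) B q :
  0 <= q < 1 -> (forall k, Rabs (u k) <= B * q ^ k) -> ex_series u.
Proof.
  intros Hq H. apply (ex_series_le u (fun k => B * q ^ k)); [exact H|].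
  apply (ex_series_scal_l B (fun k => q ^ k)). apply ex_series_geom.
  rewrite Rabs_pos_eq; lra.
Qed.

Lemma series_rsum (u : nat -> R) e :
  ex_series u -> 0 < e ->
  exists N, forall n, (N <= n)%nat -> Rabs (rsum u n - Series u) < e.
Proof.
  intros Hu He. apply Series_correct in Hu.
  destruct (Hu (fun y => Rabs (y - Series u) < e)) as [N HN].
  - exists (mkposreal e He). intros y Hy. exact Hy.
  - exists (S N). intros n Hn. destruct n as [|n]; [lia|].
    rewrite <- rsum_sum_n. apply HN. lia.
Qed.

(** The explicit tail bound makes the approximation by partial sums uniform in all the
    parameters on which the terms depend, as long as [B] and [q] do not. *)
Lemma csum_geom_series (u : nat -> C) B q :
  0 <= B -> 0 <= q < 1 -> (forall k, Cmod (u k) <= B * q ^ k) ->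
  forall n, Cmod ((Series (fun k => Re (u k)), Series (fun k => Im (u k))) - csum u n)
    <= B * / (1 - q) * q ^ n.
Proof.
  intros HB Hq Hu n.
  set (l := (Series (fun k => Re (u k)), Series (fun k => Im (u k))) : C).
  apply le_epsilon. intros e He.
  assert (H2 : 0 < e / 2) by lra.
  destruct (series_rsum (fun k => Re (u k)) (e / 2)) as [N1 HN1]; [|assumption|].
  { apply (geom_ex_series _ B q Hq). intros k. eapply Rle_trans; [apply re_le_Cmod|apply Hu]. }
  destruct (series_rsum (fun k => Im (u k)) (e / 2)) as [N2 HN2]; [|assumption|].
  { apply (geom_ex_series _ B q Hq). intros k. eapply Rle_trans; [apply im_le_Cmod|apply Hu]. }
  set (m := (N1 + N2)%nat).
  replace (l - csum u n)%C
    with (- (csum u (n + m) - l) + csum (fun k => u (n + k)%nat) m)%C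
    by (rewrite csum_add; ring).
  eapply Rle_trans; [apply Cmod_triangle|]. rewrite Cmod_opp, Rplus_comm.
  apply Rplus_le_compat.
  - eapply Rle_trans; [apply Cmod_csum|].
    eapply Rle_trans; [|apply (rsum_tail_geom B q n m HB Hq)].
    apply rsum_le. intros k _. apply Hu.
  - eapply Rle_trans; [apply Cmod_Re_Im|].
    assert (Rabs (Re (csum u (n + m) - l)) < e / 2).
    { replace (Re (csum u (n + m) - l)) with (Re (csum u (n + m)) - Re l) by reflexivity.
      rewrite Re_csum. apply HN1. unfold m; lia. }
    assert (Rabs (Im (csum u (n + m) - l)) < e / 2).
    { replace (Im (csum u (n + m) - l)) with (Im (csum u (n + m)) - Im l) by reflexivity.
      rewrite Im_csum. apply HN2. unfold m; lia. }
    lra.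
Qed.

Lemma Cpseries_approx rho a r :
  disc_coeffs rho a -> 0 <= r < rho ->
  exists B q, 0 <= B /\ 0 <= q < 1 /\ forall z n, Cmod z <= r ->
    Cmod (Cpseries a z - csum (fun k => a k * z ^ k)%C n) <= B * q ^ n.
Proof.
  intros Ha Hr. destruct (disc_coeffs_geom rho a r Ha Hr) as [B [q [HB [Hq H]]]].
  exists (B * / (1 - q)), q. split; [|split; [assumption|]].
  - apply Rmult_le_pos; [assumption|]. left. apply Rinv_0_lt_compat. lra.
  - intros z n Hz. apply (csum_geom_series (fun k => a k * z ^ k)%C B q HB Hq).
    intros k. eapply Rle_trans; [|apply H]. rewrite Cmod_mult, Cmod_pow.
    apply Rmult_le_compat_l; [apply Cmod_ge_0|].
    apply pow_incr. split; [apply Cmod_ge_0|assumption].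
Qed.

Lemma geom_lt_eps B q e : 0 <= q < 1 -> 0 < e ->
  exists N, forall n, (N <= n)%nat -> B * q ^ n < e.
Proof.
  intros Hq He.
  assert (HB : 0 < Rabs B + 1) by (generalize (Rabs_pos B); lra).
  destruct (pow_lt_1_zero q) with (y := e / (Rabs B + 1)) as [N HN].
  - rewrite Rabs_pos_eq; lra.
  - apply Rdiv_lt_0_compat; lra.
  - exists N. intros n Hn. specialize (HN n Hn).
    assert (H0 : 0 <= q ^ n) by (apply pow_le; lra).
    rewrite Rabs_pos_eq in HN by assumption.
    apply Rmult_lt_compat_l with (r := Rabs B + 1) in HN; [|assumption].
    replace ((Rabs B + 1) * (e / (Rabs B + 1))) with e in HN by (field; lra).
    assert (B * q ^ n <= (Rabs B + 1) * q ^ n).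
    { apply Rmult_le_compat_r; [assumption|]. generalize (Rle_abs B); lra. }
    lra.
Qed.

Lemma Cpseries_correct rho a z :
  disc_coeffs rho a -> Cmod z < rho ->
  is_pseries (K := C_AbsRing) (V := C_NormedModule) a z (Cpseries a z).
Proof.
  intros Ha Hz. apply is_pseries_C. intros e He.
  destruct (Cpseries_approx rho a (Cmod z) Ha) as [B [q [HB [Hq H]]]].
  { split; [apply Cmod_ge_0|assumption]. }
  destruct (geom_lt_eps B q e Hq He) as [N HN].
  exists N. intros n Hn. specialize (H z n (Rle_refl _)). specialize (HN n Hn).
  replace (csum (fun k => a k * z ^ k)%C n - Cpseries a z)%C
    with (- (Cpseries a z - csum (fun k => a k * z ^ k)%C n))%C by ring.
  rewrite Cmod_opp. lra.
Qed.

Lemma is_pseries_C_unique a z l1 l2 :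
  is_pseries (K := C_AbsRing) (V := C_NormedModule) a z l1 ->
  is_pseries (K := C_AbsRing) (V := C_NormedModule) a z l2 -> l1 = l2.
Proof. apply filterlim_locally_unique. Qed.

(** A term is the difference of two consecutive partial sums, both close to the limit. *)
Lemma disc_coeffs_of_pseries rho a :
  (forall z, Cmod z < rho -> exists l,
     is_pseries (K := C_AbsRing) (V := C_NormedModule) a z l) ->
  disc_coeffs rho a.
Proof.
  intros H r Hr. destruct (H r) as [l Hl].
  { rewrite Cmod_R, Rabs_pos_eq; lra. }
  rewrite is_pseries_C in Hl. destruct (Hl 1 Rlt_0_1) as [N HN].
  exists (rsum (fun k => Cmod (a k) * r ^ k) N + 2). intros k.
  assert (Hp : forall i, 0 <= Cmod (a i) * r ^ i).
  { intros i. apply Rmult_le_pos; [apply Cmod_ge_0|apply pow_le; lra]. }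
  destruct (Nat.lt_ge_cases k N) as [Hk|Hk].
  - assert (Cmod (a k) * r ^ k <= rsum (fun k => Cmod (a k) * r ^ k) N)
      by (apply (rsum_term (fun k => Cmod (a k) * r ^ k)); auto). lra.
  - assert (H1 := HN k Hk). assert (H2 := HN (S k) (le_S _ _ Hk)). simpl in H2.
    assert (0 <= rsum (fun k => Cmod (a k) * r ^ k) N) by (apply rsum_nonneg; auto).
    assert (E : Cmod (a k) * r ^ k = Cmod (a k * RtoC r ^ k)).
    { rewrite Cmod_mult, Cmod_pow, Cmod_R, Rabs_pos_eq; lra. }
    rewrite E. set (S := csum (fun k => a k * RtoC r ^ k)%C k) in *.
    replace (a k * RtoC r ^ k)%C with ((S + a k * RtoC r ^ k - l) + - (S - l))%C by ring.
    eapply Rle_trans; [apply Cmod_triangle|]. rewrite Cmod_opp. lra.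
Qed.

(** Remainder of the first order expansion of a power. The factor [r ^ 2] stands on the left to
    avoid the exponent [k - 2]. *)
Lemma Cmod_pow_second_order (z h : C) r k :
  0 < r -> Cmod z <= r -> Cmod (z + h) <= r ->
  Cmod ((z + h) ^ k - z ^ k - INR k * h * z ^ pred k) * r ^ 2
    <= INR k * INR k * Cmod h ^ 2 * r ^ k.
Proof.
  intros Hr Hz Hzh. induction k as [|k IH].
  - simpl. replace (1 - 1 - 0 * h * 1)%C with (RtoC 0) by ring. rewrite Cmod_0. lra.
  - destruct k as [|k].
    + simpl. replace ((z + h) * 1 - z * 1 - 1 * h * 1)%C with (RtoC 0) by ring.
      rewrite Cmod_0. generalize (Rle_0_sqr (Cmod h)); unfold Rsqr; nra.
    + set (m := S k) in *.
      replace ((z + h) ^ S m - z ^ S m - INR (S m) * h * z ^ pred (S m))%C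
        with ((z + h) * ((z + h) ^ m - z ^ m - INR m * h * z ^ pred m)
              + INR m * h ^ 2 * z ^ pred m)%C.
      2:{ rewrite S_INR, RtoC_plus. unfold m. simpl. ring. }
      eapply Rle_trans.
      { apply Rmult_le_compat_r; [apply pow_le; lra|apply Cmod_triangle]. }
      rewrite !Cmod_mult, !Cmod_pow, Cmod_R, Rabs_pos_eq, Rmult_plus_distr_r by apply pos_INR.
      rewrite S_INR.
      apply Rle_trans with (r * (INR m * INR m * Cmod h ^ 2 * r ^ m)
         + INR m * Cmod h ^ 2 * r ^ pred m * r ^ 2).
      * apply Rplus_le_compat.
        -- rewrite Rmult_assoc. apply Rmult_le_compat; try assumption; try apply Cmod_ge_0.
           apply Rmult_le_pos; [apply Cmod_ge_0|apply pow_le; lra].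
        -- apply Rmult_le_compat_r; [apply pow_le; lra|].
           apply Rmult_le_compat_l.
           { apply Rmult_le_pos; [apply pos_INR|apply pow_le, Cmod_ge_0]. }
           apply pow_incr. split; [apply Cmod_ge_0|assumption].
      * replace (INR m * Cmod h ^ 2 * r ^ pred m * r ^ 2) with (INR m * Cmod h ^ 2 * r ^ S m)
          by (unfold m; simpl; ring).
        replace (r * (INR m * INR m * Cmod h ^ 2 * r ^ m))
          with (INR m * INR m * Cmod h ^ 2 * r ^ S m) by (simpl; ring).
        assert (0 <= Cmod h ^ 2 * r ^ S m).
        { apply Rmult_le_pos; apply pow_le; [apply Cmod_ge_0|lra]. }
        generalize (pos_INR m). nra.
Qed.

Lemma csum_second_order a (z h : C) n :
  (csum (fun k => a k * (z + h) ^ k) (S n) - csum (fun k => a k * z ^ k) (S n)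
    - h * csum (fun k => deriv_coeffs a k * z ^ k) n)%C
  = csum (fun k => a k * ((z + h) ^ k - z ^ k - INR k * h * z ^ pred k))%C (S n).
Proof.
  induction n as [|n IH].
  - simpl. ring.
  - change (csum (fun k => a k * ((z + h) ^ k - z ^ k - INR k * h * z ^ pred k))%C (S (S n)))
      with (csum (fun k => a k * ((z + h) ^ k - z ^ k - INR k * h * z ^ pred k))%C (S n)
        + a (S n) * ((z + h) ^ S n - z ^ S n - INR (S n) * h * z ^ n))%C.
    rewrite <- IH. cbn [csum]. unfold deriv_coeffs. ring.
Qed.

(** The remainders of the monomials are bounded by [k^2 |h|^2 r^(k-2)]; the sum of these against
    the coefficients converges because multiplication by the index preserves [disc_coeffs]. *)
Lemma Cpseries_is_derive rho a z :
  disc_coeffs rho a -> Cmod z < rho ->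
  is_derive (K := C_AbsRing) (V := C_NormedModule) (Cpseries a) z
    (Cpseries (deriv_coeffs a) z).
Proof.
  intros Ha Hz. set (r := (Cmod z + rho) / 2).
  assert (Hz0 := Cmod_ge_0 z).
  assert (Hr : Cmod z < r < rho) by (unfold r; lra).
  assert (Ha2 : disc_coeffs rho (fun k => INR k * (INR k * a k))%C)
    by (do 2 apply disc_coeffs_mul_index; exact Ha).
  destruct (disc_coeffs_geom rho _ r Ha2) as [B [q [HB [Hq H]]]]; [lra|].
  set (K := B * / (1 - q) / r ^ 2).
  assert (Hr2 : 0 < r ^ 2) by (apply pow_lt; lra).
  assert (HK : 0 <= K).
  { unfold K. apply Rdiv_le_0_compat; [|assumption].
    apply Rmult_le_pos; [assumption|]. left. apply Rinv_0_lt_compat. lra. }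
  assert (Hfin : forall h n, Cmod (z + h) <= r ->
    Cmod (csum (fun k => a k * ((z + h) ^ k - z ^ k - INR k * h * z ^ pred k))%C n)
      <= K * Cmod h ^ 2).
  { intros h n Hh. eapply Rle_trans; [apply Cmod_csum|].
    apply Rmult_le_reg_r with (r ^ 2); [assumption|].
    rewrite Rmult_comm, <- rsum_scal.
    replace (K * Cmod h ^ 2 * r ^ 2) with (Cmod h ^ 2 * (B * / (1 - q) * q ^ 0))
      by (unfold K; simpl; field; lra).
    eapply Rle_trans; [|apply Rmult_le_compat_l, (rsum_tail_geom B q 0 n HB Hq)].
    2: apply pow_le, Cmod_ge_0.
    rewrite <- rsum_scal. apply rsum_le. intros k _. simpl plus.
    specialize (H k). rewrite !Cmod_mult, !Cmod_R, !Rabs_pos_eq in H by apply pos_INR.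
    rewrite Cmod_mult, Rmult_comm, Rmult_assoc.
    eapply Rle_trans.
    { apply Rmult_le_compat_l; [apply Cmod_ge_0|].
      apply (Cmod_pow_second_order z h r k); lra. }
    apply Rle_trans with (Cmod h ^ 2 * (INR k * (INR k * Cmod (a k)) * r ^ k)).
    - right. ring.
    - apply Rmult_le_compat_l; [apply pow_le, Cmod_ge_0|assumption]. }
  assert (Hlim : forall h, Cmod h < r - Cmod z ->
    Cmod (Cpseries a (z + h) - Cpseries a z - Cpseries (deriv_coeffs a) z * h)%C
      <= K * Cmod h ^ 2).
  { intros h Hh.
    assert (Hzh : Cmod (z + h) <= r) by (generalize (Cmod_triangle z h); lra).
    apply le_epsilon. intros e He.
    set (e' := e / (3 + Cmod h)).
    assert (Hh0 := Cmod_ge_0 h).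
    assert (He' : 0 < e') by (apply Rdiv_lt_0_compat; lra).
    assert (P1 := Cpseries_correct rho a (z + h)%C Ha ltac:(lra)).
    assert (P2 := Cpseries_correct rho a z Ha Hz).
    assert (P3 := Cpseries_correct rho _ z (disc_coeffs_deriv rho a Ha) Hz).
    destruct (proj1 (is_pseries_C _ _ _) P1 e' He') as [N1 H1].
    destruct (proj1 (is_pseries_C _ _ _) P2 e' He') as [N2 H2].
    destruct (proj1 (is_pseries_C _ _ _) P3 e' He') as [N3 H3].
    set (n := (N1 + N2 + N3)%nat).
    specialize (H1 (S n) ltac:(unfold n; lia)). specialize (H2 (S n) ltac:(unfold n; lia)).
    specialize (H3 n ltac:(unfold n; lia)).
    specialize (Hfin h (S n) Hzh). rewrite <- csum_second_order in Hfin.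
    set (s1 := csum (fun k => a k * (z + h) ^ k)%C (S n)) in *.
    set (s2 := csum (fun k => a k * z ^ k)%C (S n)) in *.
    set (s3 := csum (fun k => deriv_coeffs a k * z ^ k)%C n) in *.
    replace (Cpseries a (z + h) - Cpseries a z - Cpseries (deriv_coeffs a) z * h)%C
      with ((s1 - s2 - h * s3) + (- (s1 - Cpseries a (z + h))
        + ((s2 - Cpseries a z) + h * (s3 - Cpseries (deriv_coeffs a) z))))%C by ring.
    eapply Rle_trans; [apply Cmod_triangle|].
    apply Rplus_le_compat; [assumption|].
    eapply Rle_trans; [apply Cmod_triangle|]. rewrite Cmod_opp.
    assert (Cmod ((s2 - Cpseries a z) + h * (s3 - Cpseries (deriv_coeffs a) z))%C
       <= e' + Cmod h * e').
    { eapply Rle_trans; [apply Cmod_triangle|]. rewrite Cmod_mult.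
      apply Rplus_le_compat; [lra|]. apply Rmult_le_compat_l; lra. }
    assert (e' * (3 + Cmod h) = e) by (unfold e'; field; lra). nra. }
  apply is_derive_C. intros e He.
  set (d := Rmin (r - Cmod z) (e / (K + 1))).
  assert (Hd : 0 < d).
  { unfold d. apply Rmin_pos; [lra|]. apply Rdiv_lt_0_compat; lra. }
  exists d. split; [assumption|]. intros y Hy.
  replace (Cpseries a y) with (Cpseries a (z + (y - z))) by (f_equal; ring).
  assert (D1 : d <= r - Cmod z) by apply Rmin_l.
  assert (D2 : d <= e / (K + 1)) by apply Rmin_r.
  eapply Rle_trans; [apply Hlim; lra|].
  set (h := Cmod (y - z)) in *.
  assert (Hh : 0 <= h) by apply Cmod_ge_0.
  assert (h * (K + 1) <= e).
  { replace e with (e / (K + 1) * (K + 1)) by (field; lra).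
    apply Rmult_le_compat_r; lra. }
  replace (K * h ^ 2) with (K * h * h) by ring.
  apply Rmult_le_compat_r; [assumption|]. nra.
Qed.

(** * Continuity, curves and integrals of complex-valued functions *)

Lemma continuous_C {U : UniformSpace} (f : U -> C) (x : U) :
  continuous f x <-> forall e, 0 < e -> locally x (fun y => Cmod (f y - f x) < e).
Proof. apply filterlim_C. apply locally_filter. Qed.

Lemma continuous_pair {U : UniformSpace} (f g : U -> R) (x : U) :
  continuous f x -> continuous g x -> continuous (fun y => (f y, g y) : C) x.
Proof.
  intros Hf Hg. apply (continuous_comp_2 f g (fun u v => (u, v) : C)); try assumption.
  apply continuous_ext with (fun p : R * R => p).
  - intros [u v]. reflexivity.
  - apply continuous_id.
Qed.

Lemma continuous_Re {U : UniformSpace} (f : U -> C) (x : U) :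
  continuous f x -> continuous (fun y => Re (f y)) x.
Proof.
  intros Hf. apply (continuous_comp f (fun p : C => fst p)); [assumption|].
  destruct (f x). apply continuous_fst.
Qed.

Lemma continuous_Im {U : UniformSpace} (f : U -> C) (x : U) :
  continuous f x -> continuous (fun y => Im (f y)) x.
Proof.
  intros Hf. apply (continuous_comp f (fun p : C => snd p)); [assumption|].
  destruct (f x). apply continuous_snd.
Qed.

Lemma continuous_Cplus {U : UniformSpace} (f g : U -> C) (x : U) :
  continuous f x -> continuous g x -> continuous (fun y => f y + g y)%C x.
Proof.
  intros Hf Hg. apply continuous_pair.
  - apply (continuous_plus (fun y => Re (f y)) (fun y => Re (g y))); now apply continuous_Re.
  - apply (continuous_plus (fun y => Im (f y)) (fun y => Im (g y))); now apply continuous_Im.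
Qed.

Lemma continuous_Cmult {U : UniformSpace} (f g : U -> C) (x : U) :
  continuous f x -> continuous g x -> continuous (fun y => f y * g y)%C x.
Proof.
  intros Hf Hg. apply continuous_pair.
  - apply (continuous_minus (fun y => Re (f y) * Re (g y)) (fun y => Im (f y) * Im (g y)));
      apply (continuous_mult (K := R_AbsRing)); (now apply continuous_Re) || now apply continuous_Im.
  - apply (continuous_plus (fun y => Re (f y) * Im (g y)) (fun y => Im (f y) * Re (g y)));
      apply (continuous_mult (K := R_AbsRing)); (now apply continuous_Re) || now apply continuous_Im.
Qed.

Lemma continuous_Cinv {U : UniformSpace} (f : U -> C) (x : U) :
  continuous f x -> f x <> 0 -> continuous (fun y => / f y)%C x.
Proof.
  intros Hf H0.
  assert (N0 : Re (f x) ^ 2 + Im (f x) ^ 2 <> 0).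
  { rewrite <- Cmod2_alt. apply pow_nonzero. apply Rgt_not_eq. now apply Cmod_gt_0. }
  assert (Hn : continuous (fun y => Re (f y) ^ 2 + Im (f y) ^ 2) x).
  { apply (continuous_plus (fun y => Re (f y) ^ 2) (fun y => Im (f y) ^ 2)).
    - apply (continuous_mult (K := R_AbsRing)); [now apply continuous_Re|].
      apply (continuous_mult (K := R_AbsRing)); [now apply continuous_Re|apply continuous_const].
    - apply (continuous_mult (K := R_AbsRing)); [now apply continuous_Im|].
      apply (continuous_mult (K := R_AbsRing)); [now apply continuous_Im|apply continuous_const]. }
  assert (Hi : continuous (fun y => / (Re (f y) ^ 2 + Im (f y) ^ 2)) x).
  { apply (continuous_comp (fun y => Re (f y) ^ 2 + Im (f y) ^ 2) Rinv); [assumption|].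
    now apply continuous_Rinv. }
  apply continuous_pair.
  - apply (continuous_mult (K := R_AbsRing)); [now apply continuous_Re|assumption].
  - apply (continuous_mult (K := R_AbsRing)); [|assumption].
    apply (continuous_opp (V := R_NormedModule)). now apply continuous_Im.
Qed.

Lemma continuous_Cpow {U : UniformSpace} (f : U -> C) n (x : U) :
  continuous f x -> continuous (fun y => f y ^ n)%C x.
Proof.
  intros Hf. induction n as [|n IH]; simpl; [apply continuous_const|].
  now apply continuous_Cmult.
Qed.

Lemma continuous_csum {U : UniformSpace} (f : nat -> U -> C) n (x : U) :
  (forall k, (k < n)%nat -> continuous (f k) x) -> continuous (fun y => csum (fun k => f k y) n) x.
Proof.
  intros Hf. induction n as [|n IH]; simpl; [apply continuous_const|].
  apply continuous_Cplus; auto with arith.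
Qed.

Lemma continuous_RtoC {U : UniformSpace} (f : U -> R) (x : U) :
  continuous f x -> continuous (fun y => RtoC (f y)) x.
Proof. intros Hf. apply continuous_pair; [assumption|apply continuous_const]. Qed.

Lemma continuous_Cmod {U : UniformSpace} (f : U -> C) (x : U) :
  continuous f x -> continuous (fun y => Cmod (f y)) x.
Proof.
  intros Hf. apply (continuous_comp f Cmod); [assumption|].
  apply filterlim_locally. intros e.
  apply locally_Cmod.
  exists (pos e). split; [apply cond_pos|]. intros y Hy.
  change (Rabs (Cmod y - Cmod (f x)) < e). eapply Rle_lt_trans; [|exact Hy].
  assert (H1 := Cmod_triangle (y - f x) (f x)).
  assert (H2 := Cmod_triangle (f x - y) y).
  replace (y - f x + f x)%C with y in H1 by ring.
  replace (f x - y + y)%C with (f x) in H2 by ring.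
  replace (f x - y)%C with (- (y - f x))%C in H2 by ring. rewrite Cmod_opp in H2.
  apply Rabs_le. lra.
Qed.

Lemma is_derive_continuous_C f z l :
  is_derive (K := C_AbsRing) (V := C_NormedModule) f z l -> continuous (f : C -> C) z.
Proof.
  intros H. apply continuous_C. intros e He.
  destruct (proj1 (is_derive_C f z l) H 1 Rlt_0_1) as [d [Hd H1]].
  apply locally_Cmod.
  assert (HK : 0 < Cmod l + 1) by (generalize (Cmod_ge_0 l); lra).
  exists (Rmin d (e / (Cmod l + 1))). split.
  - apply Rmin_pos; [assumption|]. now apply Rdiv_lt_0_compat.
  - intros y Hy. assert (Hy1 := Rlt_le_trans _ _ _ Hy (Rmin_l _ _)).
    assert (Hy2 := Rlt_le_trans _ _ _ Hy (Rmin_r _ _)).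
    specialize (H1 y Hy1).
    replace (f y - f z)%C with ((f y - f z - l * (y - z)) + l * (y - z))%C by ring.
    eapply Rle_lt_trans; [apply Cmod_triangle|]. rewrite Cmod_mult.
    apply Rle_lt_trans with (Cmod (y - z) * (Cmod l + 1)); [lra|].
    apply Rmult_lt_compat_r with (r := Cmod l + 1) in Hy2; [|assumption].
    replace (e / (Cmod l + 1) * (Cmod l + 1)) with e in Hy2 by (field; lra). lra.
Qed.

(** Derivatives of plane curves. The real and the imaginary part are differentiated
    simultaneously, so that the chain rule with a complex derivative keeps its usual form. *)
Definition curve_derive (c : R -> C) (t : R) (v : C) : Prop :=
  forall e, 0 < e -> exists d, 0 < d /\ forall y, Rabs (y - t) < d ->
    Cmod (c y - c t - v * RtoC (y - t)) <= e * Rabs (y - t).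

Lemma is_derive_R (f : R -> R) (x l : R) :
  is_derive f x l <->
  forall e, 0 < e -> exists d, 0 < d /\ forall y, Rabs (y - x) < d ->
    Rabs (f y - f x - l * (y - x)) <= e * Rabs (y - x).
Proof.
  split.
  - intros [_ H] e He.
    specialize (H x (fun P HP => HP) (mkposreal e He)).
    destruct H as [d Hd]. exists d. split; [apply cond_pos|].
    intros y Hy. specialize (Hd y Hy). rewrite (Rmult_comm l). exact Hd.
  - intros H. split; [apply is_linear_scal_l|].
    intros x0 Hx. apply (is_filter_lim_locally_unique (V := R_NormedModule)) in Hx. subst x0.
    intros e. destruct (H e (cond_pos e)) as [d [Hd H1]].
    exists (mkposreal d Hd). intros y Hy. specialize (H1 y Hy).
    rewrite (Rmult_comm l) in H1. exact H1.
Qed.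

Lemma curve_derive_Re c t v : curve_derive c t v -> is_derive (fun y => Re (c y)) t (Re v).
Proof.
  intros H. apply is_derive_R. intros e He. destruct (H e He) as [d [Hd H1]].
  exists d. split; [assumption|]. intros y Hy. eapply Rle_trans; [|apply (H1 y Hy)].
  eapply Rle_trans; [|apply re_le_Cmod]. right. f_equal. unfold Re, Im. simpl. ring.
Qed.

Lemma curve_derive_Im c t v : curve_derive c t v -> is_derive (fun y => Im (c y)) t (Im v).
Proof.
  intros H. apply is_derive_R. intros e He. destruct (H e He) as [d [Hd H1]].
  exists d. split; [assumption|]. intros y Hy. eapply Rle_trans; [|apply (H1 y Hy)].
  eapply Rle_trans; [|apply im_le_Cmod]. right. f_equal. unfold Re, Im. simpl. ring.
Qed.

Lemma curve_derive_pair (f g : R -> R) t a b :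
  is_derive f t a -> is_derive g t b -> curve_derive (fun y => (f y, g y)) t (a, b).
Proof.
  intros Hf Hg e He. assert (H2 : 0 < e / 2) by lra.
  destruct (proj1 (is_derive_R _ _ _) Hf _ H2) as [d1 [Hd1 H1]].
  destruct (proj1 (is_derive_R _ _ _) Hg _ H2) as [d2 [Hd2 H3]].
  exists (Rmin d1 d2). split; [now apply Rmin_pos|]. intros y Hy.
  specialize (H1 y (Rlt_le_trans _ _ _ Hy (Rmin_l _ _))).
  specialize (H3 y (Rlt_le_trans _ _ _ Hy (Rmin_r _ _))).
  eapply Rle_trans; [apply Cmod_Re_Im|]. simpl.
  replace (f y + - f t + - (a * (y - t) - b * 0)) with (f y - f t - a * (y - t)) by ring.
  replace (g y + - g t + - (a * 0 + b * (y - t))) with (g y - g t - b * (y - t)) by ring.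
  lra.
Qed.

Lemma curve_derive_affine (c : R -> C) t v p w :
  curve_derive c t v -> curve_derive (fun y => p + w * c y)%C t (w * v)%C.
Proof.
  intros H e He.
  assert (HK : 0 < Cmod w + 1) by (generalize (Cmod_ge_0 w); lra).
  destruct (H (e / (Cmod w + 1))) as [d [Hd H1]]; [now apply Rdiv_lt_0_compat|].
  exists d. split; [assumption|]. intros y Hy. specialize (H1 y Hy).
  replace (p + w * c y - (p + w * c t) - w * v * RtoC (y - t))%C
    with (w * (c y - c t - v * RtoC (y - t)))%C by ring.
  rewrite Cmod_mult.
  apply Rle_trans with (Cmod w * (e / (Cmod w + 1) * Rabs (y - t))).
  - apply Rmult_le_compat_l; [apply Cmod_ge_0|assumption].
  - replace (e * Rabs (y - t)) with ((Cmod w + 1) * (e / (Cmod w + 1) * Rabs (y - t)))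
      by (field; lra).
    apply Rmult_le_compat_r; [|lra].
    apply Rmult_le_pos; [|apply Rabs_pos]. apply Rdiv_le_0_compat; lra.
Qed.

Lemma curve_derive_ext c1 c2 t v1 v2 :
  (forall y, c1 y = c2 y) -> v1 = v2 -> curve_derive c1 t v1 -> curve_derive c2 t v2.
Proof.
  intros Hc Hv H e He. destruct (H e He) as [d [Hd H1]].
  exists d. split; [assumption|]. intros y Hy. rewrite <- !Hc, <- Hv. now apply H1.
Qed.

Lemma curve_derive_id t : curve_derive RtoC t 1.
Proof.
  intros e He. exists 1. split; [lra|]. intros y _.
  replace (RtoC y - RtoC t - 1 * RtoC (y - t))%C with (RtoC 0) by (rewrite RtoC_minus; ring).
  rewrite Cmod_0. apply Rmult_le_pos; [lra|apply Rabs_pos].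
Qed.

Lemma curve_derive_comp f c t v l :
  is_derive (K := C_AbsRing) (V := C_NormedModule) f (c t) l ->
  curve_derive c t v -> curve_derive (fun y => f (c y)) t (l * v)%C.
Proof.
  intros Hf Hc e He.
  assert (Hl := Cmod_ge_0 l). assert (Hv := Cmod_ge_0 v).
  set (e1 := e / (2 * (Cmod v + 1))). set (e2 := e / (2 * (Cmod l + 1))).
  assert (He1 : 0 < e1) by (apply Rdiv_lt_0_compat; lra).
  assert (He2 : 0 < e2) by (apply Rdiv_lt_0_compat; lra).
  destruct (proj1 (is_derive_C _ _ _) Hf e1 He1) as [d1 [Hd1 H1]].
  destruct (Hc (Rmin 1 e2)) as [d2 [Hd2 H2]]; [apply Rmin_pos; lra|].
  assert (Hd3 : 0 < d1 / (Cmod v + 1)) by (apply Rdiv_lt_0_compat; lra).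
  exists (Rmin d2 (d1 / (Cmod v + 1))). split; [now apply Rmin_pos|].
  intros y Hy. set (s := Rabs (y - t)) in *.
  assert (Hs : 0 <= s) by apply Rabs_pos.
  assert (Hy1 := Rlt_le_trans _ _ _ Hy (Rmin_l _ _)).
  assert (Hy2 := Rlt_le_trans _ _ _ Hy (Rmin_r _ _)).
  specialize (H2 y Hy1). fold s in H2.
  assert (H3 : Cmod (c y - c t - v * RtoC (y - t)) <= 1 * s).
  { eapply Rle_trans; [apply H2|]. apply Rmult_le_compat_r; [assumption|apply Rmin_l]. }
  assert (H4 : Cmod (c y - c t - v * RtoC (y - t)) <= e2 * s).
  { eapply Rle_trans; [apply H2|]. apply Rmult_le_compat_r; [assumption|apply Rmin_r]. }
  assert (H5 : Cmod (c y - c t) <= (Cmod v + 1) * s).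
  { replace (c y - c t)%C with ((c y - c t - v * RtoC (y - t)) + v * RtoC (y - t))%C by ring.
    eapply Rle_trans; [apply Cmod_triangle|]. rewrite Cmod_mult, Cmod_R. fold s. lra. }
  assert (H6 : Cmod (c y - c t) < d1).
  { eapply Rle_lt_trans; [apply H5|].
    apply Rmult_lt_compat_l with (r := Cmod v + 1) in Hy2; [|lra].
    replace ((Cmod v + 1) * (d1 / (Cmod v + 1))) with d1 in Hy2 by (field; lra). exact Hy2. }
  specialize (H1 _ H6).
  replace (f (c y) - f (c t) - l * v * RtoC (y - t))%C
    with ((f (c y) - f (c t) - l * (c y - c t)) + l * (c y - c t - v * RtoC (y - t)))%C by ring.
  eapply Rle_trans; [apply Cmod_triangle|]. rewrite Cmod_mult.
  assert (H7 : e1 * Cmod (c y - c t) <= e / 2 * s).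
  { replace (e / 2 * s) with (e1 * ((Cmod v + 1) * s)) by (unfold e1; field; lra).
    apply Rmult_le_compat_l; lra. }
  assert (H8 : Cmod l * Cmod (c y - c t - v * RtoC (y - t)) <= e / 2 * s).
  { apply Rle_trans with ((Cmod l + 1) * (e2 * s)).
    - apply Rmult_le_compat; try lra; apply Cmod_ge_0.
    - right. unfold e2. field. lra. }
  lra.
Qed.

(** * Complex-valued integrals *)

Definition CInt (f : R -> C) (a b : R) : C :=
  (RInt (fun t => Re (f t)) a b, RInt (fun t => Im (f t)) a b).

Lemma ex_RInt_cont (f : R -> R) a b : (forall t, continuous f t) -> ex_RInt f a b.
Proof. intros H. apply (ex_RInt_continuous (V := R_CompleteNormedModule)). auto. Qed.

Lemma CInt_ext f g a b : (forall t, f t = g t) -> CInt f a b = CInt g a b.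
Proof.
  intros H. unfold CInt. f_equal; apply RInt_ext; intros t _; now rewrite H.
Qed.

Lemma CInt_plus f g a b :
  (forall t, continuous f t) -> (forall t, continuous g t) ->
  CInt (fun t => f t + g t)%C a b = (CInt f a b + CInt g a b)%C.
Proof.
  intros Hf Hg. unfold CInt, Cplus; simpl. f_equal.
  - apply (RInt_plus (V := R_CompleteNormedModule) (fun t => Re (f t)) (fun t => Re (g t)));
      apply ex_RInt_cont; intros t; now apply continuous_Re.
  - apply (RInt_plus (V := R_CompleteNormedModule) (fun t => Im (f t)) (fun t => Im (g t)));
      apply ex_RInt_cont; intros t; now apply continuous_Im.
Qed.

Lemma CInt_scal c f a b :
  (forall t, continuous f t) -> CInt (fun t => c * f t)%C a b = (c * CInt f a b)%C.
Proof.
  intros Hf.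
  assert (HR : ex_RInt (fun t => Re (f t)) a b) by (apply ex_RInt_cont; intros t; now apply continuous_Re).
  assert (HI : ex_RInt (fun t => Im (f t)) a b) by (apply ex_RInt_cont; intros t; now apply continuous_Im).
  apply (RInt_correct (V := R_CompleteNormedModule)) in HR.
  apply (RInt_correct (V := R_CompleteNormedModule)) in HI.
  unfold CInt. apply injective_projections.
  - apply (is_RInt_unique (V := R_CompleteNormedModule)).
    apply (is_RInt_minus (V := R_NormedModule)); now apply (is_RInt_scal (V := R_NormedModule)).
  - apply (is_RInt_unique (V := R_CompleteNormedModule)).
    apply (is_RInt_plus (V := R_NormedModule)); now apply (is_RInt_scal (V := R_NormedModule)).
Qed.

Lemma CInt_csum (f : nat -> R -> C) n a b :
  (forall k t, continuous (f k) t) ->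
  CInt (fun t => csum (fun k => f k t) n) a b = csum (fun k => CInt (f k) a b) n.
Proof.
  intros Hf. induction n as [|n IH]; simpl.
  - unfold CInt, RtoC; simpl. f_equal; rewrite RInt_const; unfold scal; simpl;
      unfold mult; simpl; ring.
  - rewrite CInt_plus, IH; [reflexivity| |auto].
    intros t. now apply continuous_csum.
Qed.

Lemma RInt_rsum (u : nat -> R -> R) n a b :
  (forall j t, continuous (u j) t) ->
  is_RInt (fun t => rsum (fun j => u j t) n) a b (rsum (fun j => RInt (u j) a b) n).
Proof.
  intros Hu. induction n as [|n IH]; simpl.
  - assert (H := is_RInt_const (V := R_NormedModule) a b 0).
    change (scal (b - a) (0 : R_NormedModule)) with ((b - a) * 0) in H.
    now rewrite Rmult_0_r in H.
  - apply (is_RInt_plus (V := R_NormedModule)); [exact IH|].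
    apply (RInt_correct (V := R_CompleteNormedModule)). now apply ex_RInt_cont.
Qed.

Lemma Cmod_CInt_le f a b :
  a <= b -> (forall t, continuous f t) ->
  Cmod (CInt f a b) <= RInt (fun t => Cmod (f t)) a b.
Proof.
  intros Hab Hf. set (I := CInt f a b).
  destruct (Req_dec (Cmod I) 0) as [H0|H0].
  { rewrite H0. apply RInt_ge_0; [assumption| |intros; apply Cmod_ge_0].
    apply ex_RInt_cont. intros t. now apply continuous_Cmod. }
  (* rotating the integral onto the positive real axis *)
  set (u := (Cconj I / Cmod I)%C).
  assert (Hu : Cmod u = 1).
  { unfold u. rewrite Cmod_div, Cmod_conj, Cmod_R, Rabs_pos_eq.
    - field. assumption.
    - apply Cmod_ge_0.
    - intros E. apply H0. now apply RtoC_inj. }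
  assert (Hr : (u * I)%C = RtoC (Cmod I)).
  { unfold u. replace (Cconj I / Cmod I * I)%C with (I * Cconj I / Cmod I)%C.
    - rewrite <- Cmod2_conj. rewrite RtoC_pow. simpl. field. intros E; apply H0; now apply RtoC_inj.
    - field. intros E; apply H0; now apply RtoC_inj. }
  assert (E : Cmod I = RInt (fun t => Re (u * f t)) a b).
  { rewrite <- (re_RtoC (Cmod I)), <- Hr. unfold I. now rewrite <- CInt_scal. }
  rewrite E. apply RInt_le; [assumption| | |].
  - apply ex_RInt_cont. intros t. apply continuous_Re.
    apply continuous_Cmult; [apply continuous_const|apply Hf].
  - apply ex_RInt_cont. intros t. now apply continuous_Cmod.
  - intros t _. eapply Rle_trans; [apply Rle_abs|]. eapply Rle_trans; [apply re_le_Cmod|].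
    rewrite Cmod_mult, Hu. lra.
Qed.

(** * The Cauchy integral formula *)

Definition circle (r t : R) : C := (r * cos t, r * sin t).

Lemma Cmod_circle r t : 0 <= r -> Cmod (circle r t) = r.
Proof.
  intros Hr. unfold Cmod, circle; simpl.
  replace (r * cos t * (r * cos t * 1) + r * sin t * (r * sin t * 1))
    with (r * r * (Rsqr (sin t) + Rsqr (cos t))) by (unfold Rsqr; ring).
  rewrite sin2_cos2, Rmult_1_r. now apply sqrt_square.
Qed.

Lemma continuous_circle r t : continuous (circle r) t.
Proof.
  apply continuous_pair; apply (continuous_mult (K := R_AbsRing));
    try apply continuous_const; [apply continuous_cos|apply continuous_sin].
Qed.

Lemma circle_derive r t : curve_derive (circle r) t (Ci * circle r t)%C.
Proof.
  replace (Ci * circle r t)%C with ((r * - sin t, r * cos t) : C).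
  - apply curve_derive_pair.
    + apply (is_derive_scal cos t r). apply is_derive_cos.
    + apply (is_derive_scal sin t r). apply is_derive_sin.
  - unfold Ci, circle, Cmult; simpl. f_equal; ring.
Qed.

Lemma circle_period r : circle r (2 * PI) = circle r 0.
Proof. unfold circle. now rewrite cos_2PI, sin_2PI, cos_0, sin_0. Qed.

Lemma circle_pow r t n : (circle r t ^ n)%C = circle (r ^ n) (INR n * t).
Proof.
  induction n as [|n IH].
  - unfold circle. simpl. rewrite Rmult_0_l, cos_0, sin_0. unfold RtoC. f_equal; ring.
  - cbn [Cpow]. rewrite IH, S_INR. unfold circle, Cmult; simpl.
    replace ((INR n + 1) * t) with (t + INR n * t) by ring.
    rewrite cos_plus, sin_plus. f_equal; ring.
Qed.

Lemma circle_inv r t : 0 < r -> (/ circle r t)%C = circle (/ r) (- t).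
Proof.
  intros Hr. assert (H0 : circle r t <> 0).
  { apply Cmod_gt_0. rewrite Cmod_circle; lra. }
  rewrite <- (Cmult_1_r (/ circle r t)).
  replace (RtoC 1) with (circle r t * circle (/ r) (- t))%C.
  - field. assumption.
  - unfold circle, Cmult, RtoC; simpl. rewrite cos_neg, sin_neg. f_equal; [|field; lra].
    replace (r * cos t * (/ r * cos t) - r * sin t * (/ r * - sin t))
      with (Rsqr (sin t) + Rsqr (cos t)) by (unfold Rsqr; field; lra).
    apply sin2_cos2.
Qed.

Lemma RInt_cos_mult n : (0 < n)%nat -> is_RInt (fun t => cos (INR n * t)) 0 (2 * PI) 0.
Proof.
  intros Hn. assert (Hn' : 0 < INR n) by now apply lt_0_INR.
  replace 0 with (minus (sin (INR n * (2 * PI)) / INR n) (sin (INR n * 0) / INR n)) at 2.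
  - apply (is_RInt_derive (V := R_CompleteNormedModule) (fun t => sin (INR n * t) / INR n)).
    + intros t _. auto_derive; [trivial|]. field. lra.
    + intros t _. apply continuous_cos_comp.
      apply (continuous_mult (K := R_AbsRing)); [apply continuous_const|apply continuous_id].
  - rewrite Rmult_0_r, sin_0.
    replace (INR n * (2 * PI)) with (0 + 2 * INR n * PI) by ring.
    rewrite sin_period, sin_0. unfold minus, plus, opp; simpl. field. lra.
Qed.

Lemma RInt_sin_mult n : (0 < n)%nat -> is_RInt (fun t => sin (INR n * t)) 0 (2 * PI) 0.
Proof.
  intros Hn. assert (Hn' : 0 < INR n) by now apply lt_0_INR.
  replace 0 with (minus (- cos (INR n * (2 * PI)) / INR n) (- cos (INR n * 0) / INR n)) at 2.
  - apply (is_RInt_derive (V := R_CompleteNormedModule) (fun t => - cos (INR n * t) / INR n)).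
    + intros t _. auto_derive; [trivial|]. field. lra.
    + intros t _. apply continuous_sin_comp.
      apply (continuous_mult (K := R_AbsRing)); [apply continuous_const|apply continuous_id].
  - rewrite Rmult_0_r, cos_0.
    replace (INR n * (2 * PI)) with (0 + 2 * INR n * PI) by ring.
    rewrite cos_period, cos_0. unfold minus, plus, opp; simpl. field. lra.
Qed.

Lemma CInt_circle_pow_inv r n : 0 < r -> (0 < n)%nat ->
  CInt (fun t => / circle r t ^ n)%C 0 (2 * PI) = 0.
Proof.
  intros Hr Hn.
  rewrite (CInt_ext _ (fun t => circle (/ r ^ n) (- (INR n * t)))).
  2:{ intros t. rewrite circle_pow, circle_inv; [reflexivity|now apply pow_lt]. }
  unfold CInt, circle, RtoC; simpl. f_equal; apply (is_RInt_unique (V := R_CompleteNormedModule)).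
  - apply (is_RInt_ext (V := R_NormedModule) (fun t => scal (/ r ^ n) (cos (INR n * t)))).
    + intros t _. now rewrite cos_neg.
    + replace 0 with (/ r ^ n * 0) at 2 by ring.
      apply (is_RInt_scal (V := R_NormedModule)). now apply RInt_cos_mult.
  - apply (is_RInt_ext (V := R_NormedModule) (fun t => scal (- / r ^ n) (sin (INR n * t)))).
    + intros t _. rewrite sin_neg. unfold scal; simpl; unfold mult; simpl. ring.
    + replace 0 with (- / r ^ n * 0) at 2 by ring.
      apply (is_RInt_scal (V := R_NormedModule)). now apply RInt_sin_mult.
Qed.

(** Continuity of the derivative is part of the definition because differentiation under the
    integral sign consumes it; power series provide it. *)
Definition holomorphic (rho : R) (f f' : C -> C) : Prop :=
  forall z, Cmod z < rho ->
    is_derive (K := C_AbsRing) (V := C_NormedModule) f z (f' z) /\ continuous (f' : C -> C) z.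

Lemma circle_minus_neq r z t : Cmod z < r -> (circle r t - z <> 0)%C.
Proof.
  intros Hz H. assert (E : circle r t = z) by (rewrite <- (Cplus_0_r z), <- H; ring).
  assert (Hr : 0 <= r) by (generalize (Cmod_ge_0 z); lra).
  rewrite <- E, Cmod_circle in Hz; lra.
Qed.

Lemma Cmod_segment z r u t : 0 <= r -> Cmod z <= r ->
  Cmod (z + RtoC u * (circle r t - z)) <= (Rabs (1 - u) + Rabs u) * r.
Proof.
  intros Hr Hz. replace (z + RtoC u * (circle r t - z))%C
    with (RtoC (1 - u) * z + RtoC u * circle r t)%C by (rewrite RtoC_minus; ring).
  eapply Rle_trans; [apply Cmod_triangle|].
  rewrite !Cmod_mult, !Cmod_R, Cmod_circle by assumption.
  assert (Rabs (1 - u) * Cmod z <= Rabs (1 - u) * r)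
    by (apply Rmult_le_compat_l; [apply Rabs_pos|assumption]). lra.
Qed.

(** The integrand is [1 / Ci] times the [t]-derivative of a closed curve, namely of the quotient
    [(f (z + x (circle r t - z)) - f z) / x], whose limit at [x = 0] is
    [f' z (circle r t - z)]. *)
Lemma closed_curve_integral rho f f' r z x :
  holomorphic rho f f' -> 0 < r -> Cmod z < r -> (Rabs (1 - x) + Rabs x) * r < rho ->
  RInt (fun t => Re (f' (z + RtoC x * (circle r t - z)) * circle r t)%C) 0 (2 * PI) = 0.
Proof.
  intros Hf Hr Hz Hx.
  assert (Hdom : forall t, Cmod (z + RtoC x * (circle r t - z)) < rho).
  { intros t. eapply Rle_lt_trans; [apply Cmod_segment; lra|assumption]. }
  assert (Hcurve : forall t, curve_derive (fun t => z + RtoC x * (circle r t - z))%C t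
      (RtoC x * (Ci * circle r t))%C).
  { intros t. apply curve_derive_ext with (fun t => (z - RtoC x * z) + RtoC x * circle r t)%C
      (RtoC x * (Ci * circle r t))%C; [intros; ring|reflexivity|].
    apply curve_derive_affine. apply circle_derive. }
  assert (HG : exists G, G (2 * PI) = G 0 /\
    forall t, curve_derive G t (Ci * (f' (z + RtoC x * (circle r t - z)) * circle r t))%C).
  { destruct (Req_dec x 0) as [->|H0].
    - exists (fun t => 0 + f' z * circle r t)%C. split; [now rewrite circle_period|].
      intros t. apply curve_derive_ext with (fun t => 0 + f' z * circle r t)%C
        (f' z * (Ci * circle r t))%C; [reflexivity| |].
      + replace (z + 0 * (circle r t - z))%C with z by ring. ring.
      + apply curve_derive_affine. apply circle_derive.
    - exists (fun t => 0 + / RtoC x * f (z + RtoC x * (circle r t - z)))%C.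
      split; [now rewrite circle_period|].
      intros t. eapply curve_derive_ext; [reflexivity| |].
      2:{ apply curve_derive_affine. apply curve_derive_comp; [|apply Hcurve]. apply Hf, Hdom. }
      cbv beta. field. intros E; apply H0; now apply RtoC_inj. }
  destruct HG as [G [Hper HG]].
  apply (is_RInt_unique (V := R_CompleteNormedModule)).
  replace 0 with (minus (Im (G (2 * PI))) (Im (G 0))) at 2.
  2:{ rewrite Hper. apply (minus_eq_zero (G := R_AbelianGroup)). }
  apply (is_RInt_derive (V := R_CompleteNormedModule) (fun t => Im (G t))).
  - intros t _. replace (Re (f' (z + RtoC x * (circle r t - z)) * circle r t)%C)
      with (Im (Ci * (f' (z + RtoC x * (circle r t - z)) * circle r t))%C).
    + apply curve_derive_Im, HG.
    + set (u := (f' (z + RtoC x * (circle r t - z)) * circle r t)%C).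
      unfold Re, Im, Ci. simpl. ring.
  - intros t _. apply continuous_Re. apply continuous_Cmult; [|apply continuous_circle].
    apply (continuous_comp (fun t => z + RtoC x * (circle r t - z))%C f').
    + apply continuous_Cplus; [apply continuous_const|].
      apply continuous_Cmult; [apply continuous_const|].
      apply continuous_Cplus; [apply continuous_circle|apply continuous_const].
    + apply Hf, Hdom.
Qed.

Definition cauchy_kernel (r : R) (z : C) (t : R) : C := (circle r t / (circle r t - z))%C.

Lemma continuous_cauchy_kernel r z t : Cmod z < r -> continuous (cauchy_kernel r z) t.
Proof.
  intros Hz. apply continuous_Cmult; [apply continuous_circle|].
  apply continuous_Cinv; [|now apply circle_minus_neq].
  apply continuous_Cplus; [apply continuous_circle|apply continuous_const].
Qed.

Lemma continuous_holomorphic_circle rho f f' r t :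
  holomorphic rho f f' -> 0 < r < rho -> continuous (fun t => f (circle r t)) t.
Proof.
  intros Hf Hr. apply (continuous_comp (circle r) f); [apply continuous_circle|].
  apply is_derive_continuous_C with (f' (circle r t)). apply Hf.
  rewrite Cmod_circle; lra.
Qed.

(** Contract the circle to [z] by [x -> z + x (circle r t - z)], from the value [x = 1] to [x = 0].
    The factor [circle r t - z] produced by the derivative in [x] cancels the denominator of
    the kernel, and what is left has integral zero by [closed_curve_integral], so the
    integral does not depend on [x]. *)
Lemma cauchy_formula_Re rho f f' r z :
  holomorphic rho f f' -> 0 < r < rho -> Cmod z < r ->
  RInt (fun t => Re (f (circle r t) * cauchy_kernel r z t)%C) 0 (2 * PI)
  = RInt (fun t => Re (f z * cauchy_kernel r z t)%C) 0 (2 * PI).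
Proof.
  intros Hf Hr Hz.
  set (F := fun u t => Re (f (z + RtoC u * (circle r t - z)) * cauchy_kernel r z t)%C).
  set (dF := fun u t => Re (f' (z + RtoC u * (circle r t - z)) * circle r t)%C).
  set (Phi := fun u => RInt (F u) 0 (2 * PI)).
  set (dom := fun u => (Rabs (1 - u) + Rabs u) * r < rho).
  assert (Hdom : forall x, 0 <= x <= 1 -> exists e : posreal, forall u, Rabs (u - x) < e -> dom u).
  { intros x Hx. assert (He : 0 < (rho - r) / (4 * r)) by (apply Rdiv_lt_0_compat; lra).
    exists (mkposreal _ He). simpl. intros u Hu. unfold dom.
    assert (Rabs (1 - u) + Rabs u <= 1 + 2 * ((rho - r) / (4 * r))).
    { assert (Rabs (1 - u) <= (1 - x) + Rabs (u - x)).
      { replace (1 - u) with ((1 - x) + - (u - x)) by ring.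
        eapply Rle_trans; [apply Rabs_triang|]. rewrite Rabs_Ropp, (Rabs_pos_eq (1 - x)); lra. }
      assert (Rabs u <= x + Rabs (u - x)).
      { replace u with (x + (u - x)) at 1 by ring.
        eapply Rle_trans; [apply Rabs_triang|]. rewrite (Rabs_pos_eq x); lra. }
      lra. }
    apply Rle_lt_trans with ((1 + 2 * ((rho - r) / (4 * r))) * r).
    - apply Rmult_le_compat_r; lra.
    - replace ((1 + 2 * ((rho - r) / (4 * r))) * r) with (r + (rho - r) / 2) by (field; lra). lra. }
  assert (Hin : forall u t, dom u -> Cmod (z + RtoC u * (circle r t - z)) < rho).
  { intros u t Hu. eapply Rle_lt_trans; [apply Cmod_segment; lra|exact Hu]. }
  assert (HdF : forall u t, dom u -> is_derive (fun u => F u t) u (dF u t)).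
  { intros u t Hu. unfold F, dF.
    apply (curve_derive_Re (fun u => f (z + RtoC u * (circle r t - z)) * cauchy_kernel r z t)%C).
    apply curve_derive_ext with
      (fun u => 0 + cauchy_kernel r z t * f (z + (circle r t - z) * RtoC u))%C
      (cauchy_kernel r z t * (f' (z + (circle r t - z) * RtoC u) * ((circle r t - z) * 1)))%C.
    - intros y. rewrite (Cmult_comm (circle r t - z)). ring.
    - rewrite (Cmult_comm (circle r t - z) (RtoC u)). unfold cauchy_kernel. field.
      now apply circle_minus_neq.
    - apply curve_derive_affine. apply curve_derive_comp.
      + rewrite (Cmult_comm (circle r t - z)). apply Hf. now apply Hin.
      + apply curve_derive_affine. apply curve_derive_id. }
  assert (HcF : forall u t, dom u -> continuous (F u) t).
  { intros u t Hu. apply continuous_Re. apply continuous_Cmult.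
    - apply (continuous_comp (fun t => z + RtoC u * (circle r t - z))%C f).
      + apply continuous_Cplus; [apply continuous_const|].
        apply continuous_Cmult; [apply continuous_const|].
        apply continuous_Cplus; [apply continuous_circle|apply continuous_const].
      + eapply is_derive_continuous_C. apply Hf. now apply Hin.
    - now apply continuous_cauchy_kernel. }
  assert (HPhi : forall x, 0 <= x <= 1 -> is_derive Phi x 0).
  { intros x Hx. destruct (Hdom x Hx) as [e He].
    assert (Hx0 : dom x). { apply He. rewrite Rminus_diag, Rabs_R0. apply cond_pos. }
    replace 0 with (RInt (fun t => Derive (fun u => F u t) x) 0 (2 * PI)).
    2:{ rewrite (RInt_ext _ (dF x)).
        - unfold dF. apply closed_curve_integral with rho f; try assumption; lra.
        - intros t _. apply is_derive_unique. now apply HdF. }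
    apply is_derive_RInt_param.
    - exists e. intros u Hu t _. exists (dF u t). apply HdF. now apply He.
    - intros t _. apply continuity_2d_pt_ext_loc with dF.
      + exists e. intros u v Hu _. symmetry. apply is_derive_unique. apply HdF. now apply He.
      + apply continuity_2d_pt_filterlim.
        change (continuous (fun p : R * R => Re (f' (z + RtoC (fst p) * (circle r (snd p) - z))
          * circle r (snd p))%C) (x, t)).
        assert (Hc : continuous (fun p : R * R => circle r (snd p)) (x, t)).
        { apply (continuous_comp snd (circle r)); [apply continuous_snd|apply continuous_circle]. }
        apply continuous_Re. apply continuous_Cmult; [|assumption].
        apply (continuous_comp (fun p : R * R => z + RtoC (fst p) * (circle r (snd p) - z))%C f').
        * apply continuous_Cplus; [apply continuous_const|].
          apply continuous_Cmult.
          -- apply continuous_RtoC. apply continuous_fst.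
          -- apply continuous_Cplus; [assumption|apply continuous_const].
        * apply Hf. now apply Hin.
    - exists e. intros u Hu. apply ex_RInt_cont. intros t. apply HcF. now apply He. }
  assert (E : Phi 0 = Phi 1) by (apply eq_is_derive; [exact HPhi|lra]).
  symmetry. unfold Phi, F in E.
  rewrite (RInt_ext _ (fun t => Re (f z * cauchy_kernel r z t)%C)) in E.
  2:{ intros t _. replace (z + 0 * (circle r t - z))%C with z by ring. reflexivity. }
  rewrite E. apply RInt_ext. intros t _.
  replace (z + 1 * (circle r t - z))%C with (circle r t) by ring. reflexivity.
Qed.

Lemma holomorphic_scal rho f f' c :
  holomorphic rho f f' -> holomorphic rho (fun z => c * f z)%C (fun z => c * f' z)%C.
Proof.
  intros Hf z Hz. destruct (Hf z Hz) as [H1 H2]. split.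
  - apply is_derive_C. intros e He.
    assert (HK : 0 < Cmod c + 1) by (generalize (Cmod_ge_0 c); lra).
    destruct (proj1 (is_derive_C _ _ _) H1 (e / (Cmod c + 1))) as [d [Hd H]].
    { now apply Rdiv_lt_0_compat. }
    exists d. split; [assumption|]. intros y Hy. specialize (H y Hy).
    replace (c * f y - c * f z - c * f' z * (y - z))%C
      with (c * (f y - f z - f' z * (y - z)))%C by ring.
    rewrite Cmod_mult.
    apply Rle_trans with ((Cmod c + 1) * (e / (Cmod c + 1) * Cmod (y - z))).
    + apply Rmult_le_compat; try apply Cmod_ge_0; lra.
    + right. field. lra.
  - apply (continuous_Cmult (fun _ => c) f'); [apply continuous_const|assumption].
Qed.

(** The imaginary part is the real part for [- Ci * f]. *)
Lemma cauchy_formula rho f f' r z :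
  holomorphic rho f f' -> 0 < r < rho -> Cmod z < r ->
  CInt (fun t => f (circle r t) * cauchy_kernel r z t)%C 0 (2 * PI)
  = (f z * CInt (cauchy_kernel r z) 0 (2 * PI))%C.
Proof.
  intros Hf Hr Hz.
  rewrite <- CInt_scal by (intros; now apply continuous_cauchy_kernel).
  unfold CInt. f_equal.
  - now apply (cauchy_formula_Re rho f f').
  - assert (H := cauchy_formula_Re rho _ _ r z (holomorphic_scal rho f f' (- Ci)%C Hf) Hr Hz).
    assert (E : forall w : C, Im w = Re (- Ci * w)%C).
    { intros [a b]. simpl. ring. }
    rewrite (RInt_ext _ (fun t => Re (- Ci * f (circle r t) * cauchy_kernel r z t)%C)).
    2:{ intros t _. rewrite E. now rewrite Cmult_assoc. }
    rewrite H. apply RInt_ext. intros t _. now rewrite E, Cmult_assoc.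
Qed.

(** * Taylor expansion *)

Definition cauchy_coeff (f : C -> C) (r : R) (n : nat) : C :=
  (RtoC (/ (2 * PI)) * CInt (fun t => f (circle r t) / circle r t ^ n)%C 0 (2 * PI))%C.

Lemma circle_neq_0 r t : 0 < r -> circle r t <> 0.
Proof. intros Hr. apply Cmod_gt_0. rewrite Cmod_circle; lra. Qed.

Lemma continuous_circle_pow_inv r n t : 0 < r -> continuous (fun t => / circle r t ^ n)%C t.
Proof.
  intros Hr. apply continuous_Cinv; [apply continuous_Cpow, continuous_circle|].
  apply Cmod_gt_0. rewrite Cmod_pow. apply pow_lt. rewrite Cmod_circle; lra.
Qed.

Lemma cauchy_kernel_expansion r z t n : Cmod z < r ->
  cauchy_kernel r z t = (csum (fun k => z ^ k * / circle r t ^ k) n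
    + z ^ n * / circle r t ^ n * cauchy_kernel r z t)%C.
Proof.
  intros Hz. assert (Hr : 0 < r) by (generalize (Cmod_ge_0 z); lra).
  assert (H1 := circle_minus_neq r z t Hz). assert (H0 := circle_neq_0 r t Hr).
  induction n as [|n IH].
  - simpl. field.
  - rewrite IH at 1. cbn [csum]. unfold cauchy_kernel. cbn [Cpow].
    assert (circle r t ^ n <> 0)%C.
    { apply Cmod_gt_0. rewrite Cmod_pow. apply pow_lt. rewrite Cmod_circle; lra. }
    set (s := csum (fun k => z ^ k * / circle r t ^ k)%C n). field. auto.
Qed.

Lemma Cmod_cauchy_kernel r z t : Cmod z < r -> Cmod (cauchy_kernel r z t) <= r / (r - Cmod z).
Proof.
  intros Hz. assert (Hz0 := Cmod_ge_0 z). unfold cauchy_kernel.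
  rewrite Cmod_div by now apply circle_minus_neq. rewrite Cmod_circle by lra.
  apply Rmult_le_compat_l; [lra|]. apply Rinv_le_contravar; [lra|].
  assert (H := Cmod_triangle (circle r t - z) z).
  replace (circle r t - z + z)%C with (circle r t) in H by ring.
  rewrite Cmod_circle in H; lra.
Qed.

Lemma CInt_cauchy_kernel_expansion (g : R -> C) r z n :
  (forall t, continuous g t) -> Cmod z < r ->
  Cmod (CInt (fun t => g t * cauchy_kernel r z t)%C 0 (2 * PI)
    - csum (fun k => z ^ k * CInt (fun t => g t / circle r t ^ k)%C 0 (2 * PI))%C n)
  <= r / (r - Cmod z) * RInt (fun t => Cmod (g t)) 0 (2 * PI) * (Cmod z / r) ^ n.
Proof.
  intros Hg Hz. assert (Hz0 := Cmod_ge_0 z). assert (Hr : 0 < r) by lra.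
  assert (HPI := PI_RGT_0).
  assert (Hk : forall k t, continuous (fun t => g t / circle r t ^ k)%C t).
  { intros k t. apply continuous_Cmult; [apply Hg|now apply continuous_circle_pow_inv]. }
  assert (Hzk : forall k t, continuous (fun t => z ^ k * (g t / circle r t ^ k))%C t).
  { intros k t. apply (continuous_Cmult (fun _ => z ^ k)%C); [apply continuous_const|apply Hk]. }
  assert (HK : forall t, continuous (cauchy_kernel r z) t)
    by (intros; now apply continuous_cauchy_kernel).
  assert (Hrem : forall t, continuous (fun t => z ^ n * (g t / circle r t ^ n) * cauchy_kernel r z t)%C t).
  { intros t. apply continuous_Cmult; [apply Hzk|apply HK]. }
  rewrite (CInt_ext _ (fun t => csum (fun k => z ^ k * (g t / circle r t ^ k)) n
     + z ^ n * (g t / circle r t ^ n) * cauchy_kernel r z t)%C).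
  2:{ intros t. rewrite (cauchy_kernel_expansion r z t n Hz) at 1.
      rewrite Cmult_plus_distr_l, <- csum_scal. f_equal.
      - apply csum_ext. intros k _. unfold Cdiv. ring.
      - unfold Cdiv. ring. }
  rewrite CInt_plus; [|intros t; apply (continuous_csum (fun k t => z ^ k * (g t / circle r t ^ k))%C); auto|assumption].
  rewrite (CInt_csum (fun k t => z ^ k * (g t / circle r t ^ k))%C) by auto.
  rewrite (csum_ext _ (fun k => z ^ k * CInt (fun t => g t / circle r t ^ k)%C 0 (2 * PI))%C).
  2:{ intros k _. apply CInt_scal. apply Hk. }
  match goal with |- Cmod (?a + ?b - ?a) <= _ => replace (a + b - a)%C with b by ring end.
  eapply Rle_trans; [apply Cmod_CInt_le; [lra|assumption]|].
  replace (r / (r - Cmod z) * RInt (fun t => Cmod (g t)) 0 (2 * PI) * (Cmod z / r) ^ n)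
    with (r / (r - Cmod z) * (Cmod z / r) ^ n * RInt (fun t => Cmod (g t)) 0 (2 * PI)) by ring.
  assert (Hcg : ex_RInt (fun t => Cmod (g t)) 0 (2 * PI)).
  { apply ex_RInt_cont. intros t. now apply continuous_Cmod. }
  rewrite <- (RInt_scal (V := R_CompleteNormedModule)) by assumption.
  apply RInt_le; [lra| |now apply (ex_RInt_scal (V := R_NormedModule))|].
  - apply ex_RInt_cont. intros t. now apply continuous_Cmod.
  - intros t _. unfold Cdiv. rewrite !Cmod_mult, Cmod_inv, !Cmod_pow, Cmod_circle by
      (try lra; apply Cmod_gt_0; rewrite Cmod_pow; apply pow_lt; rewrite Cmod_circle; lra).
    unfold scal; simpl; unfold mult; simpl.
    unfold Rdiv at 2. rewrite Rpow_mult_distr, pow_inv.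
    assert (H := Cmod_cauchy_kernel r z t Hz).
    replace (Cmod z ^ n * (Cmod (g t) * / r ^ n) * Cmod (cauchy_kernel r z t))
      with (Cmod (cauchy_kernel r z t) * (Cmod z ^ n * / r ^ n * Cmod (g t))) by ring.
    rewrite (Rmult_assoc (r / (r - Cmod z))). apply Rmult_le_compat_r; [|assumption].
    apply Rmult_le_pos; [|apply Cmod_ge_0].
    apply Rmult_le_pos; [apply pow_le; lra|]. left. apply Rinv_0_lt_compat. apply pow_lt; lra.
Qed.

(** Only the term of index [0] of the geometric expansion of the kernel has a nonzero integral. *)
Lemma CInt_cauchy_kernel r z : Cmod z < r ->
  CInt (cauchy_kernel r z) 0 (2 * PI) = RtoC (2 * PI).
Proof.
  intros Hz. assert (Hz0 := Cmod_ge_0 z). assert (Hr : 0 < r) by lra.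
  assert (H := fun n => CInt_cauchy_kernel_expansion (fun _ => 1) r z (S n)
     (fun t => continuous_const _ _) Hz).
  set (B := r / (r - Cmod z) * RInt (fun t => Cmod 1) 0 (2 * PI)) in H.
  assert (E : forall n, csum (fun k => z ^ k * CInt (fun t => 1 / circle r t ^ k)%C 0 (2 * PI))%C (S n)
     = RtoC (2 * PI)).
  { induction n as [|n IH].
    - simpl. rewrite (CInt_ext _ (fun _ => RtoC 1)) by (intros; field).
      unfold CInt, RtoC; simpl. rewrite !RInt_const. unfold scal; simpl; unfold mult; simpl.
      unfold Cmult, Cplus; simpl. f_equal; ring.
    - change (csum (fun k => z ^ k * CInt (fun t => 1 / circle r t ^ k)%C 0 (2 * PI))%C (S (S n)))
       with (csum (fun k => z ^ k * CInt (fun t => 1 / circle r t ^ k)%C 0 (2 * PI))%C (S n)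
         + z ^ S n * CInt (fun t => 1 / circle r t ^ S n)%C 0 (2 * PI))%C.
      rewrite IH, (CInt_ext _ (fun t => / circle r t ^ S n)%C) by (intros; unfold Cdiv; ring).
      rewrite CInt_circle_pow_inv by (lra || lia). ring. }
  set (I := CInt (cauchy_kernel r z) 0 (2 * PI)).
  assert (H1 : forall n, Cmod (I - RtoC (2 * PI)) <= B * (Cmod z / r) ^ S n).
  { intros n. specialize (H n). rewrite E in H.
    rewrite (CInt_ext _ (cauchy_kernel r z)) in H by (intros; ring). exact H. }
  assert (H2 : Cmod (I - RtoC (2 * PI)) = 0).
  { apply Rle_antisym; [|apply Cmod_ge_0]. apply le_epsilon. intros e He.
    destruct (geom_lt_eps B (Cmod z / r) e) as [N HN]; [|assumption|].
    - split; [apply Rdiv_le_0_compat; lra|]. apply Rmult_lt_reg_r with r; [lra|].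
      unfold Rdiv. rewrite Rmult_assoc, Rinv_l; lra.
    - specialize (HN (S N) ltac:(lia)). specialize (H1 N). lra. }
  apply Cmod_eq_0 in H2. rewrite <- (Cplus_0_l (RtoC (2 * PI))), <- H2. ring.
Qed.

(** Integrate the geometric expansion of the kernel against [f] and divide by [2 PI]; the
    remainder is controlled by [CInt_cauchy_kernel_expansion]. *)
Theorem cauchy_expansion rho f f' r z :
  holomorphic rho f f' -> 0 < r < rho -> Cmod z < r ->
  is_pseries (K := C_AbsRing) (V := C_NormedModule) (cauchy_coeff f r) z (f z).
Proof.
  intros Hf Hr Hz. assert (HPI := PI_RGT_0). assert (Hz0 := Cmod_ge_0 z).
  assert (Hc : forall t, continuous (fun t => f (circle r t)) t).
  { intros t. apply (continuous_holomorphic_circle rho f f'); assumption. }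
  assert (H := fun n => CInt_cauchy_kernel_expansion _ r z n Hc Hz). cbv beta in H.
  rewrite (cauchy_formula rho f f' r z Hf Hr Hz), (CInt_cauchy_kernel r z Hz) in H.
  set (B := r / (r - Cmod z) * RInt (fun t => Cmod (f (circle r t))) 0 (2 * PI)) in H.
  assert (H2PI : RtoC (2 * PI) <> 0).
  { intros E. apply RtoC_inj in E. lra. }
  apply is_pseries_C. intros e He.
  destruct (geom_lt_eps (/ (2 * PI) * B) (Cmod z / r) e) as [N HN]; [|assumption|].
  { split; [apply Rdiv_le_0_compat; lra|]. apply Rmult_lt_reg_r with r; [lra|].
    unfold Rdiv. rewrite Rmult_assoc, Rinv_l; lra. }
  exists N. intros n Hn. eapply Rle_lt_trans; [|apply (HN n Hn)]. specialize (H n).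
  rewrite (csum_ext _ (fun k => RtoC (/ (2 * PI)) *
     (z ^ k * CInt (fun t => f (circle r t) / circle r t ^ k)%C 0 (2 * PI)))%C).
  2:{ intros k _. unfold cauchy_coeff. ring. }
  rewrite csum_scal.
  set (s := csum _ n) in *.
  replace (RtoC (/ (2 * PI)) * s - f z)%C with (- (RtoC (/ (2 * PI)) * (f z * RtoC (2 * PI) - s)))%C.
  - rewrite Cmod_opp, Cmod_mult, Cmod_R, Rabs_pos_eq, Rmult_assoc.
    + apply Rmult_le_compat_l; [|exact H]. left. apply Rinv_0_lt_compat. lra.
    + left. apply Rinv_0_lt_compat. lra.
  - rewrite RtoC_inv by lra. field. assumption.
Qed.

Lemma Cmod_cauchy_coeff_le f r n :
  0 < r -> (forall t, continuous (fun t => f (circle r t)) t) ->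
  Cmod (cauchy_coeff f r n) * r ^ n <= M1 f r.
Proof.
  intros Hr Hc. assert (HPI := PI_RGT_0).
  assert (Hp : 0 < / (2 * PI)) by (apply Rinv_0_lt_compat; lra).
  unfold cauchy_coeff, M1. rewrite Cmod_mult, Cmod_R, Rabs_pos_eq, Rmult_assoc by lra.
  apply Rmult_le_compat_l; [lra|]. rewrite Rmult_comm.
  assert (Hc2 : forall t, continuous (fun t => f (circle r t) / circle r t ^ n)%C t).
  { intros t. apply continuous_Cmult; [apply Hc|now apply continuous_circle_pow_inv]. }
  assert (Hrn : 0 < r ^ n) by now apply pow_lt.
  eapply Rle_trans; [apply Rmult_le_compat_l; [lra|apply Cmod_CInt_le; [lra|exact Hc2]]|].
  right. rewrite <- (RInt_scal (V := R_CompleteNormedModule)).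
  - apply RInt_ext. intros t _. unfold scal; simpl; unfold mult; simpl.
    rewrite Cmod_div, Cmod_pow, Cmod_circle.
    + unfold circle. field. lra.
    + lra.
    + apply Cmod_gt_0. rewrite Cmod_pow. apply pow_lt. rewrite Cmod_circle; lra.
  - apply ex_RInt_cont. intros t. now apply continuous_Cmod.
Qed.

Lemma is_derive_translate F f z0 z l d :
  0 < d -> (forall y, Cmod (y - z) < d -> f y = F (y - z0)%C) ->
  is_derive (K := C_AbsRing) (V := C_NormedModule) F (z - z0)%C l ->
  is_derive (K := C_AbsRing) (V := C_NormedModule) f z l.
Proof.
  intros Hd E H. apply is_derive_C. intros e He.
  destruct (proj1 (is_derive_C _ _ _) H e He) as [d1 [Hd1 H1]].
  exists (Rmin d d1). split; [now apply Rmin_pos|]. intros y Hy.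
  rewrite (E y), (E z).
  - specialize (H1 (y - z0)%C). replace (y - z0 - (z - z0))%C with (y - z)%C in H1 by ring.
    apply H1. eapply Rlt_le_trans; [exact Hy|apply Rmin_r].
  - replace (z - z)%C with (RtoC 0) by ring. now rewrite Cmod_0.
  - eapply Rlt_le_trans; [exact Hy|apply Rmin_l].
Qed.

Lemma Cpseries_at_0 a : Cpseries a 0 = a O.
Proof.
  assert (E : forall u : nat -> R, (forall k, u (S k) = 0) -> Series u = u O).
  { intros u Hu. apply is_series_unique. apply filterlim_ext with (fun _ => u O).
    - intros n. induction n as [|n IH]; [now rewrite sum_O|].
      rewrite sum_Sn, <- IH, Hu. symmetry. exact (Rplus_0_r _).
    - apply filterlim_const. }
  assert (H : forall k, (a (S k) * RtoC 0 ^ S k)%C = 0) by (intros; simpl; ring).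
  unfold Cpseries. rewrite !E; try (intros k; now rewrite H).
  simpl. destruct (a O) as [x y]. simpl. f_equal; ring.
Qed.

Lemma Cpseries_local_derive f a z0 rho :
  disc_coeffs rho a ->
  (forall z, Cmod (z - z0) < rho -> f z = Cpseries a (z - z0)%C) ->
  forall z, Cmod (z - z0) < rho ->
  is_derive (K := C_AbsRing) (V := C_NormedModule) f z (Cpseries (deriv_coeffs a) (z - z0)%C).
Proof.
  intros Ha E z Hz. apply is_derive_translate with (Cpseries a) z0 (rho - Cmod (z - z0)).
  - lra.
  - intros y Hy. apply E. replace (y - z0)%C with ((y - z) + (z - z0))%C by ring.
    eapply Rle_lt_trans; [apply Cmod_triangle|]. lra.
  - now apply Cpseries_is_derive with rho.
Qed.

(** Near each point [f] is the sum of a power series, hence so is its derivative, which is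
    therefore continuous. *)
Lemma HD_holomorphic f : HD f -> holomorphic 1 f (C_derive f).
Proof.
  intros Hf z Hz. destruct (Hf z Hz) as [a [rho Ha]].
  assert (Hc : disc_coeffs rho a).
  { apply disc_coeffs_of_pseries. intros h Hh. exists (f (z + h)%C).
    replace h with (z + h - z)%C at 1 by ring. apply Ha.
    replace (z + h - z)%C with h by ring. exact Hh. }
  assert (E : forall y, Cmod (y - z) < rho -> f y = Cpseries a (y - z)%C).
  { intros y Hy. apply is_pseries_C_unique with a (y - z)%C; [now apply Ha|].
    now apply Cpseries_correct with rho. }
  assert (D := Cpseries_local_derive f a z rho Hc E).
  assert (H0 : Cmod (z - z) < rho).
  { replace (z - z)%C with (RtoC 0) by ring. rewrite Cmod_0. apply cond_pos. }
  assert (ED : forall y, Cmod (y - z) < rho -> C_derive f y = Cpseries (deriv_coeffs a) (y - z)%C).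
  { intros y Hy. apply is_C_derive_unique. now apply D. }
  split.
  - rewrite ED by assumption. now apply D.
  - eapply is_derive_continuous_C.
    exact (Cpseries_local_derive (C_derive f) _ z rho (disc_coeffs_deriv rho a Hc) ED z H0).
Qed.

Lemma iter_deriv_coeffs a n k :
  (Nat.iter n deriv_coeffs a k * INR (fact k))%C = (INR (fact (n + k)) * a (n + k)%nat)%C.
Proof.
  revert k. induction n as [|n IH]; intros k.
  - simpl. ring.
  - change (Nat.iter (S n) deriv_coeffs a k)
      with (INR (S k) * Nat.iter n deriv_coeffs a (S k))%C.
    replace (S n + k)%nat with (n + S k)%nat by lia. rewrite <- IH.
    rewrite (fact_simpl k), mult_INR, RtoC_mult. ring.
Qed.

(** The derivatives that define [taylor_coeff] are taken one after the other at all points of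
    the disc, since [C_derive] at the origin looks at nearby values. *)
Lemma taylor_coeff_unique f a rho :
  0 < rho -> disc_coeffs rho a -> (forall z, Cmod z < rho -> f z = Cpseries a z) ->
  forall k, taylor_coeff f k = a k.
Proof.
  intros Hrho Ha E k.
  assert (H : forall n, disc_coeffs rho (Nat.iter n deriv_coeffs a) /\
    forall z, Cmod z < rho -> Nat.iter n C_derive f z = Cpseries (Nat.iter n deriv_coeffs a) z).
  { induction n as [|n [IH1 IH2]]; [now split|]. split.
    - now apply disc_coeffs_deriv.
    - intros z Hz. apply is_C_derive_unique.
      replace z with (z - 0)%C at 2 by ring.
      apply Cpseries_local_derive with rho; [assumption| |].
      + intros y. replace (y - 0)%C with y by ring. apply IH2.
      + now replace (z - 0)%C with z by ring. }
  unfold taylor_coeff. destruct (H k) as [_ H2]. rewrite H2 by (rewrite Cmod_0; lra).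
  rewrite Cpseries_at_0.
  assert (H3 := iter_deriv_coeffs a k 0). rewrite Nat.add_0_r in H3. simpl (INR (fact 0)) in H3.
  assert (HF : RtoC (INR (fact k)) <> 0).
  { intros Hc. apply RtoC_inj in Hc. now apply (INR_fact_neq_0 k). }
  replace (Nat.iter k deriv_coeffs a 0%nat) with (INR (fact k) * a k)%C by (rewrite <- H3; ring).
  field. assumption.
Qed.

Lemma HD_cauchy_coeff f r z : HD f -> 0 < r < 1 -> Cmod z < r ->
  f z = Cpseries (taylor_coeff f) z /\ (forall k, cauchy_coeff f r k = taylor_coeff f k).
Proof.
  intros Hf Hr Hz.
  assert (P := fun y => cauchy_expansion 1 f _ r y (HD_holomorphic f Hf) Hr).
  assert (Hc : disc_coeffs r (cauchy_coeff f r)).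
  { apply disc_coeffs_of_pseries. intros y Hy. exists (f y). now apply P. }
  assert (E : forall y, Cmod y < r -> f y = Cpseries (cauchy_coeff f r) y).
  { intros y Hy. apply is_pseries_C_unique with (cauchy_coeff f r) y; [now apply P|].
    now apply Cpseries_correct with r. }
  assert (ET : forall k, taylor_coeff f k = cauchy_coeff f r k)
    by (apply (taylor_coeff_unique f _ r); tauto).
  split; [|intros; now rewrite ET].
  rewrite E by assumption. unfold Cpseries.
  f_equal; apply Series_ext; intros k; now rewrite ET.
Qed.

Lemma HD_eq_Cpseries f z : HD f -> Cmod z < 1 -> f z = Cpseries (taylor_coeff f) z.
Proof.
  intros Hf Hz. assert (H0 := Cmod_ge_0 z).
  apply (HD_cauchy_coeff f ((Cmod z + 1) / 2)); [assumption|lra..].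
Qed.

Lemma HD_taylor_M1 f r n : HD f -> 0 < r < 1 -> Cmod (taylor_coeff f n) * r ^ n <= M1 f r.
Proof.
  intros Hf Hr. destruct (HD_cauchy_coeff f r 0 Hf Hr) as [_ E]; [rewrite Cmod_0; lra|].
  rewrite <- E. apply Cmod_cauchy_coeff_le; [lra|].
  intros t. apply (continuous_holomorphic_circle 1 f (C_derive f)); [now apply HD_holomorphic|assumption].
Qed.

Lemma HD_disc_coeffs f : HD f -> disc_coeffs 1 (taylor_coeff f).
Proof.
  intros Hf r Hr. destruct (Req_dec r 0) as [->|H0].
  - exists (M1 f (1 / 2) + Cmod (taylor_coeff f 0)). intros k.
    assert (H1 := HD_taylor_M1 f (1 / 2) 0 Hf ltac:(lra)).
    assert (H2 := Cmod_ge_0 (taylor_coeff f 0)).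
    destruct k as [|k]; simpl in *; lra.
  - exists (M1 f r). intros k. apply HD_taylor_M1; [assumption|lra].
Qed.

Lemma Cpseries_holomorphic rho a :
  disc_coeffs rho a -> holomorphic rho (Cpseries a) (Cpseries (deriv_coeffs a)).
Proof.
  intros Ha z Hz. split; [now apply Cpseries_is_derive with rho|].
  eapply is_derive_continuous_C. apply (Cpseries_is_derive rho); [|assumption].
  now apply disc_coeffs_deriv.
Qed.

(** Cauchy's expansion at the origin, applied to the translates [f (z0 + h)]. *)
Lemma holomorphic_HD f f' : holomorphic 1 f f' -> HD f.
Proof.
  intros Hf z0 Hz0. unfold Defs.disc in Hz0. set (rho := 1 - Cmod z0).
  set (g := fun h => f (z0 + h)%C).
  assert (Hin : forall h, Cmod h < rho -> Cmod (z0 + h) < 1).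
  { intros h Hh. eapply Rle_lt_trans; [apply Cmod_triangle|]. unfold rho in Hh. lra. }
  assert (Hg : holomorphic rho g (fun h => f' (z0 + h)%C)).
  { intros h Hh. destruct (Hf (z0 + h)%C (Hin h Hh)) as [H1 H2]. split.
    - apply is_derive_translate with f (- z0)%C 1; [lra| |].
      + intros y _. unfold g. f_equal. ring.
      + now replace (h - - z0)%C with (z0 + h)%C by ring.
    - apply (continuous_comp (fun h : C => z0 + h)%C f'); [|assumption].
      apply (continuous_Cplus (fun _ => z0) (fun h => h)); [apply continuous_const|apply continuous_id]. }
  assert (Hr : 0 < rho / 2) by (unfold rho; lra).
  exists (cauchy_coeff g (rho / 2)), (mkposreal _ Hr). simpl. intros z Hz.
  replace (f z) with (g (z - z0)%C) by (unfold g; f_equal; ring).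
  apply cauchy_expansion with rho (fun h => f' (z0 + h)%C); [assumption|lra|assumption].
Qed.

Lemma HD_Cpseries a : disc_coeffs 1 a -> HD (Cpseries a).
Proof. intros Ha. eapply holomorphic_HD. apply (Cpseries_holomorphic 1 a Ha). Qed.

Lemma taylor_coeff_Cpseries a k : disc_coeffs 1 a -> taylor_coeff (Cpseries a) k = a k.
Proof. intros Ha. apply (taylor_coeff_unique _ a 1); [lra|assumption|reflexivity]. Qed.

(** * Iterates of the weighted Taylor shift *)

Lemma w_bounds alpha k : 0 < w alpha (S k) <= Rpower 2 (Rabs alpha).
Proof.
  unfold w. split; [apply exp_pos|].
  assert (HS : 1 <= INR (S k)) by (rewrite S_INR; generalize (pos_INR k); lra).
  assert (Hi : 0 < / INR (S k) <= 1).
  { split; [apply Rinv_0_lt_compat; lra|]. rewrite <- Rinv_1. apply Rinv_le_contravar; lra. }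
  apply Rle_trans with (Rpower (1 + / INR (S k)) (Rabs alpha)).
  - apply Rle_Rpower; [lra|apply Rle_abs].
  - apply Rle_Rpower_l; [apply Rabs_pos|lra].
Qed.

Lemma taylor_shift_coeffs alpha f : HD f ->
  disc_coeffs 1 (fun k => taylor_coeff f (S k) * w alpha (S k))%C.
Proof.
  intros Hf. apply disc_coeffs_scal_le with (fun k => taylor_coeff f (S k)) (Rpower 2 (Rabs alpha)).
  - apply (disc_coeffs_shift 1 (taylor_coeff f)). now apply HD_disc_coeffs.
  - intros k. destruct (w_bounds alpha k) as [H1 H2].
    rewrite Cmod_mult, Cmod_R, Rabs_pos_eq, Rmult_comm by lra.
    apply Rmult_le_compat_r; [apply Cmod_ge_0|assumption].
Qed.

Lemma HD_taylor_shift alpha f : HD f -> HD (taylor_shift alpha f).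
Proof. intros Hf. apply HD_Cpseries. now apply taylor_shift_coeffs. Qed.

Lemma HD_iter_shift alpha f n : HD f -> HD (Nat.iter n (taylor_shift alpha) f).
Proof. intros Hf. induction n as [|n IH]; [assumption|]. now apply HD_taylor_shift. Qed.

(** The weights telescope: [w (k+1) ... w (k+n) = ((n+k+1)/(k+1))^alpha]. *)
Lemma taylor_coeff_iter_shift alpha f n k : HD f ->
  taylor_coeff (Nat.iter n (taylor_shift alpha) f) k
  = (taylor_coeff f (n + k) * RtoC (Rpower (INR (S (n + k)) / INR (S k)) alpha))%C.
Proof.
  intros Hf. revert k. induction n as [|n IH]; intros k.
  - rewrite Nat.add_0_l. unfold Rdiv. rewrite Rinv_r by (apply not_0_INR; lia).
    unfold Rpower. rewrite ln_1, Rmult_0_r, exp_0. symmetry. apply Cmult_1_r.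
  - change (Nat.iter (S n) (taylor_shift alpha) f)
      with (taylor_shift alpha (Nat.iter n (taylor_shift alpha) f)).
    unfold taylor_shift at 1.
    rewrite taylor_coeff_Cpseries by (apply taylor_shift_coeffs; now apply HD_iter_shift).
    rewrite IH. replace (n + S k)%nat with (S n + k)%nat by lia.
    rewrite <- Cmult_assoc, <- RtoC_mult. do 2 f_equal.
    unfold w. assert (Hk : 0 < INR (S k)) by (apply lt_0_INR; lia).
    assert (Hk2 : 0 < INR (S (S k))) by (apply lt_0_INR; lia).
    assert (Hn : 0 < INR (S (S n + k))) by (apply lt_0_INR; lia).
    rewrite Rpower_mult_distr.
    + f_equal. rewrite (S_INR (S k)). rewrite (S_INR (S k)) in Hk2. field. lra.
    + apply Rdiv_lt_0_compat; assumption.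
    + assert (0 < / INR (S k)) by now apply Rinv_0_lt_compat. lra.
Qed.

(** * Upper densities and the lower bounds on the means *)

Lemma sum_n_m_1_rsum (u : nat -> R) n : sum_n_m u 1 n = rsum (fun k => u (S k)) n.
Proof.
  induction n as [|n IH].
  - apply (sum_n_m_zero u 1 0). lia.
  - rewrite sum_n_Sm, IH by lia. reflexivity.
Qed.

Lemma LimSup_seq_frequently (u : nat -> R) (c : R) :
  Rbar_lt c (LimSup_seq u) -> forall N, exists n, (N <= n)%nat /\ c < u n.
Proof.
  intros H. assert (HL : is_LimSup_seq u (LimSup_seq u)) by apply (proj2_sig (ex_LimSup_seq u)).
  destruct (LimSup_seq u) as [l| |]; simpl in H, HL.
  - intros N. assert (He : 0 < l - c) by lra.
    destruct (HL (mkposreal _ He)) as [H1 _]. destruct (H1 N) as [n [Hn H2]].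
    exists n. simpl in H2. split; [assumption|lra].
  - intros N. apply HL.
  - contradiction.
Qed.

Lemma LimSup_seq_ge (u : nat -> R) (c : R) :
  (forall N, exists n, (N <= n)%nat /\ c <= u n) -> Rbar_le c (LimSup_seq u).
Proof.
  intros H. assert (HL : is_LimSup_seq u (LimSup_seq u)) by apply (proj2_sig (ex_LimSup_seq u)).
  destruct (LimSup_seq u) as [l| |]; simpl in HL |- *.
  - apply le_epsilon. intros e He. destruct (HL (mkposreal e He)) as [_ [N HN]].
    destruct (H N) as [n [Hn H1]]. specialize (HN n Hn). simpl in HN. lra.
  - trivial.
  - destruct (HL c) as [N HN]. destruct (H N) as [n [Hn H1]]. specialize (HN n Hn). lra.
Qed.

Lemma exp_le x y : x <= y -> exp x <= exp y.
Proof. intros [H| ->]; [left; now apply exp_increasing|lra]. Qed.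

Lemma beta_weight_ge_1 gamma k : 1 <= beta_weight gamma k.
Proof.
  unfold beta_weight. rewrite <- exp_0. apply exp_le.
  left. apply exp_pos.
Qed.

Lemma indicator_true (E : nat -> Prop) k : E k -> indicator E k = 1.
Proof. intros H. unfold indicator. destruct (excluded_middle_informative (E k)); tauto. Qed.

Lemma indicator_false (E : nat -> Prop) k : ~ E k -> indicator E k = 0.
Proof. intros H. unfold indicator. destruct (excluded_middle_informative (E k)); tauto. Qed.

Lemma indicator_bounds (E : nat -> Prop) k : 0 <= indicator E k <= 1.
Proof. unfold indicator. destruct (excluded_middle_informative (E k)); lra. Qed.

(** If all the visits happen before time [N], the weight of the visits is bounded while the total
    weight is at least the number of integers. *)
Lemma positive_density_unbounded gamma E :
  Rbar_lt 0 (upper_density gamma E) -> forall N, exists n, (N <= n)%nat /\ E n.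
Proof.
  intros H N. apply NNPP. intros Hno.
  assert (HE : forall n, E n -> (n < N)%nat).
  { intros n Hn. destruct (Nat.lt_ge_cases n N) as [|Hle]; [assumption|].
    exfalso. apply Hno. now exists n. }
  assert (Hc : exists c : R, 0 < c /\ Rbar_lt c (upper_density gamma E)).
  { destruct (upper_density gamma E) as [l| |]; simpl in H.
    - exists (l / 2). simpl. lra.
    - exists 1. simpl. lra.
    - contradiction. }
  destruct Hc as [c [Hc H1]]. clear H.
  set (v := fun k => indicator E (S k) * beta_weight gamma (S k)).
  assert (Hv : forall k, 0 <= v k).
  { intros k. apply Rmult_le_pos; [apply indicator_bounds|].
    generalize (beta_weight_ge_1 gamma (S k)); lra. }
  assert (Hnum : forall n, rsum v n <= rsum v N).
  { induction n as [|n IH]; simpl; [now apply rsum_nonneg|].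
    destruct (excluded_middle_informative (E (S n))) as [Hn|Hn].
    - apply HE in Hn. apply (rsum_incr v (S n) N); [lia|assumption].
    - unfold v at 2. rewrite indicator_false by assumption. lra. }
  destruct (nfloor_ex (rsum v N / c)) as [m [_ Hm]].
  { apply Rdiv_le_0_compat; [now apply rsum_nonneg|assumption]. }
  destruct (LimSup_seq_frequently _ _ H1 (S m)) as [n [Hn H2]].
  rewrite !sum_n_m_1_rsum in H2. fold v in H2.
  assert (Hden : INR n <= rsum (fun k => beta_weight gamma (S k)) n).
  { rewrite <- (Rmult_1_r (INR n)), <- rsum_const. apply rsum_le.
    intros k _. apply beta_weight_ge_1. }
  assert (HnR : INR m + 1 <= INR n) by (rewrite <- S_INR; apply le_INR; lia).
  assert (Hm0 := pos_INR m).
  set (D := rsum (fun k => beta_weight gamma (S k)) n) in *.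
  assert (HD : 0 < D) by lra.
  apply Rmult_lt_compat_r with (r := D) in H2; [|assumption].
  unfold Rdiv in H2. rewrite Rmult_assoc, Rinv_l, Rmult_1_r in H2 by lra.
  specialize (Hnum n).
  apply Rmult_lt_compat_r with (r := c) in Hm; [|assumption].
  unfold Rdiv in Hm. rewrite Rmult_assoc, Rinv_l, Rmult_1_r in Hm by lra.
  nra.
Qed.

Lemma compact_singleton z0 : compact_set (fun z => z = z0).
Proof.
  intros I O _ H. destruct (H z0 eq_refl) as [i Hi].
  exists (cons i nil). intros z ->. exists i. simpl. auto.
Qed.

Lemma holomorphic_const rho c : holomorphic rho (fun _ => c) (fun _ => RtoC 0).
Proof.
  intros z _. split; [|apply continuous_const].
  apply is_derive_C. intros e He. exists 1. split; [lra|]. intros y _.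
  replace (c - c - 0 * (y - z))%C with (RtoC 0) by ring. rewrite Cmod_0.
  apply Rmult_le_pos; [lra|apply Cmod_ge_0].
Qed.

Lemma taylor_coeff_0 f : taylor_coeff f 0 = f 0.
Proof. unfold taylor_coeff. simpl. field. Qed.

(** Test the orbit on the open set of the functions whose value at the origin exceeds [B]
    in modulus. *)
Lemma hypercyclic_coeffs_unbounded gamma alpha f :
  U_frequently_hypercyclic gamma (taylor_shift alpha) f ->
  forall B N, exists n, (N <= n)%nat /\ B < Cmod (taylor_coeff f n) * Rpower (INR (S n)) alpha.
Proof.
  intros [Hf HU] B N.
  set (U := fun g => HD g /\ B < Cmod (g 0)).
  assert (HUo : open_HD U).
  { split; [intros g Hg; apply Hg|]. intros g [Hg HB].
    assert (He : 0 < Cmod (g 0) - B) by lra.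
    exists (fun z : C => z = 0), (mkposreal _ He). split; [apply compact_singleton|]. split.
    - intros z ->. unfold Defs.disc. rewrite Cmod_0. lra.
    - intros h Hh H. specialize (H 0 eq_refl). simpl in H. split; [assumption|].
      assert (H1 := Cmod_triangle (g 0 - h 0) (h 0)).
      replace (g 0 - h 0 + h 0)%C with (g 0) in H1 by ring.
      replace (g 0 - h 0)%C with (- (h 0 - g 0))%C in H1 by ring. rewrite Cmod_opp in H1. lra. }
  assert (HUn : exists g, U g).
  { exists (fun _ => RtoC (Rabs B + 1)). split.
    - eapply holomorphic_HD. apply holomorphic_const.
    - rewrite Cmod_R. generalize (Rle_abs B), (Rabs_pos B), (Rle_abs (Rabs B + 1)). lra. }
  destruct (positive_density_unbounded gamma _ (HU U HUo HUn) N) as [n [Hn [_ H]]].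
  exists n. split; [assumption|].
  rewrite <- taylor_coeff_0, taylor_coeff_iter_shift, Nat.add_0_r in H by assumption.
  rewrite Cmod_mult, Cmod_R, Rabs_pos_eq in H by (left; apply exp_pos).
  unfold Rdiv in H. simpl (INR 1) in H. rewrite Rinv_1, Rmult_1_r in H. exact H.
Qed.

Lemma LimSup_at_left_ge (g : R -> R) (c : R) :
  (forall d, 0 < d -> exists r, 1 - d < r < 1 /\ c <= g r) ->
  Rbar_le c (LimSup (at_left 1) g).
Proof.
  intros H. unfold LimSup, Rbar_glb. apply (proj2_sig (Rbar_ex_glb _)).
  intros y [P [[d Hd] ->]]. destruct (H d (cond_pos d)) as [r [Hr Hc]].
  apply Rbar_le_trans with (g r); [exact Hc|].
  unfold Rbar_lub. apply (proj2_sig (Rbar_ex_lub _)).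
  exists r. split; [|reflexivity]. apply Hd; [|lra].
  change (Rabs (r - 1) < d). apply Rabs_def1; lra.
Qed.

Lemma pow_one_minus_inv_ge n : / exp 1 <= (1 - / INR (S n)) ^ n.
Proof.
  destruct n as [|n].
  - simpl. rewrite <- Rinv_1 at 2. apply Rinv_le_contravar; [lra|].
    generalize (exp_ineq1 1 ltac:(lra)). lra.
  - assert (Hn : 0 < INR (S n)) by (apply lt_0_INR; lia).
    rewrite (S_INR (S n)).
    replace (1 - / (INR (S n) + 1)) with (/ (1 + / INR (S n))) by (field; lra).
    rewrite pow_inv. apply Rinv_le_contravar.
    + apply pow_lt. assert (0 < / INR (S n)) by now apply Rinv_0_lt_compat. lra.
    + replace 1 with (/ INR (S n) * INR (S n)) at 2 by (field; lra).
      rewrite <- Rpower_pow by (assert (0 < / INR (S n)) by (now apply Rinv_0_lt_compat); lra).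
      unfold Rpower. apply exp_le. rewrite Rmult_comm. apply Rmult_le_compat_r; [lra|].
      assert (Hi : 0 < / INR (S n)) by now apply Rinv_0_lt_compat.
      rewrite <- (ln_exp (/ INR (S n))) at 2. apply ln_le; [lra|].
      left. apply exp_ineq1. lra.
Qed.

(** The radius [1 - 1/(n+1)] is the one for which [r^n] stays above [1/e] while
    [(1-r)^(-alpha)] equals [(n+1)^alpha]. *)
Lemma means_unbounded gamma alpha f :
  U_frequently_hypercyclic gamma (taylor_shift alpha) f ->
  LimSup (at_left 1) (fun r => Rpower (1 - r) (- alpha) * M1 f r) = p_infty.
Proof.
  intros Hf.
  assert (H : forall c : R, Rbar_le c (LimSup (at_left 1) (fun r => Rpower (1 - r) (- alpha) * M1 f r))).
  { intros c. apply LimSup_at_left_ge. intros d Hd.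
    destruct (nfloor_ex (/ d)) as [m [_ Hm]]; [left; now apply Rinv_0_lt_compat|].
    destruct (hypercyclic_coeffs_unbounded gamma alpha f Hf (Rabs c * exp 1) (S m)) as [n [Hn HB]].
    assert (HnR : INR m + 1 <= INR n) by (rewrite <- S_INR; apply le_INR; lia).
    assert (Hm0 := pos_INR m). assert (HSn : INR (S n) = INR n + 1) by apply S_INR.
    assert (Hi : 0 < / INR (S n) < 1).
    { split; [apply Rinv_0_lt_compat; lra|]. rewrite <- Rinv_1. apply Rinv_lt_contravar; lra. }
    assert (Hid : / INR (S n) < d).
    { rewrite <- (Rinv_inv d). apply Rinv_lt_contravar; [|lra].
      apply Rmult_lt_0_compat; [now apply Rinv_0_lt_compat|lra]. }
    exists (1 - / INR (S n)). split; [lra|].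
    replace (1 - (1 - / INR (S n))) with (/ INR (S n)) by ring.
    replace (Rpower (/ INR (S n)) (- alpha)) with (Rpower (INR (S n)) alpha).
    2:{ unfold Rpower. rewrite ln_Rinv by lra. f_equal. ring. }
    assert (H1 := HD_taylor_M1 f (1 - / INR (S n)) n (proj1 Hf) ltac:(lra)).
    assert (H2 := pow_one_minus_inv_ge n).
    set (P := Rpower (INR (S n)) alpha) in *. assert (HP : 0 < P) by apply exp_pos.
    set (A := Cmod (taylor_coeff f n)) in *. assert (HA : 0 <= A) by apply Cmod_ge_0.
    set (q := (1 - / INR (S n)) ^ n) in *.
    apply Rle_trans with (Rabs c); [apply Rle_abs|].
    apply Rle_trans with (P * (A * q)); [|apply Rmult_le_compat_l; lra].
    apply Rle_trans with (A * P * / exp 1).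
    - assert (He := exp_pos 1).
      apply Rmult_le_reg_r with (exp 1); [assumption|].
      rewrite (Rmult_assoc (A * P)), Rinv_l by lra. lra.
    - replace (P * (A * q)) with (A * P * q) by ring.
      apply Rmult_le_compat_l; [|assumption]. apply Rmult_le_pos; lra. }
  destruct (LimSup (at_left 1) _) as [l| |]; [|reflexivity|].
  - specialize (H (l + 1)). simpl in H. lra.
  - specialize (H 0). contradiction.
Qed.

Lemma means_not_vanishing gamma alpha f :
  U_frequently_hypercyclic gamma (taylor_shift alpha) f ->
  Rbar_lt 0 (LimSup (at_left 1) (fun r => M1 f r)).
Proof.
  intros Hf.
  destruct (hypercyclic_coeffs_unbounded gamma alpha f Hf 0 0) as [n [_ Hn]].
  assert (HP : 0 < Rpower (INR (S n)) alpha) by apply exp_pos.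
  set (A := Cmod (taylor_coeff f n)) in *.
  assert (HA : 0 < A).
  { destruct (Rle_lt_or_eq_dec 0 A (Cmod_ge_0 _)) as [|E]; [assumption|].
    rewrite <- E in Hn. lra. }
  apply Rbar_lt_le_trans with (A * (1 / 2) ^ n).
  { simpl. apply Rmult_lt_0_compat; [assumption|apply pow_lt; lra]. }
  apply LimSup_at_left_ge. intros d Hd.
  exists (Rmax (1 / 2) (1 - d / 2)).
  assert (H1 := Rmax_l (1 / 2) (1 - d / 2)). assert (H2 := Rmax_r (1 / 2) (1 - d / 2)).
  assert (H3 : Rmax (1 / 2) (1 - d / 2) < 1) by (apply Rmax_lub_lt; lra).
  set (r := Rmax (1 / 2) (1 - d / 2)) in *. split; [lra|].
  eapply Rle_trans; [|apply (HD_taylor_M1 f r n (proj1 Hf)); lra].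
  apply Rmult_le_compat_l; [apply Cmod_ge_0|]. apply pow_incr. lra.
Qed.

(** * An enumeration of the polynomials with rational coefficients *)

(** Undoing the pairing function again and again reads [n] as a sequence of which any finite
    prefix can be prescribed. *)
Definition digit (n k : nat) : nat :=
  fst (Cantor.of_nat (Nat.iter k (fun m => snd (Cantor.of_nat m)) n)).

Lemma digit_surj d : forall x : nat -> nat, exists n, forall k, (k < d)%nat -> digit n k = x k.
Proof.
  induction d as [|d IH]; intros x.
  - exists O. intros k Hk. lia.
  - destruct (IH (fun k => x (S k))) as [n Hn].
    exists (Cantor.to_nat (x O, n)). intros k Hk. unfold digit. destruct k as [|k].
    + change (fst (Cantor.of_nat (Cantor.to_nat (x O, n))) = x O). now rewrite Cantor.cancel_of_to.
    + rewrite Nat.iter_succ_r. cbv beta. rewrite Cantor.cancel_of_to. apply Hn. lia.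
Qed.

Definition rational_C (n : nat) : C :=
  ((INR (digit n 0) - INR (digit n 1)) / INR (S (digit n 4)),
   (INR (digit n 2) - INR (digit n 3)) / INR (S (digit n 4))).

Lemma digit_0 k : digit 0 k = O.
Proof.
  unfold digit. replace (Nat.iter k (fun m => snd (Cantor.of_nat m)) 0%nat) with O; [reflexivity|].
  induction k as [|k IH]; [reflexivity|]. simpl. now rewrite <- IH.
Qed.

Lemma rational_C_0 : rational_C 0 = 0.
Proof. unfold rational_C, RtoC. rewrite !digit_0. simpl. f_equal; field. Qed.

Lemma integer_approx (x : R) : exists a b, Rabs (INR a - INR b - x) <= 1.
Proof.
  destruct (Rle_dec 0 x) as [H|H].
  - destruct (nfloor_ex x H) as [n Hn]. exists n, O. simpl. apply Rabs_le. lra.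
  - destruct (nfloor_ex (- x)) as [n Hn]; [lra|]. exists O, n. simpl. apply Rabs_le. lra.
Qed.

Lemma rational_C_dense (z : C) e : 0 < e -> exists n, Cmod (rational_C n - z) < e.
Proof.
  intros He. destruct (nfloor_ex (2 / e)) as [m [_ Hm]].
  { apply Rdiv_le_0_compat; lra. }
  assert (Hm0 := pos_INR m).
  destruct (integer_approx (INR (S m) * Re z)) as [a [b Hab]].
  destruct (integer_approx (INR (S m) * Im z)) as [a' [b' Hab']].
  destruct (digit_surj 5 (fun k => match k with 0 => a | 1 => b | 2 => a' | 3 => b' | _ => m end)%nat)
    as [n Hn].
  exists n. eapply Rle_lt_trans; [apply Cmod_Re_Im|].
  assert (E : forall x i k, Rabs (INR i - INR k - INR (S m) * x) <= 1 ->
    Rabs ((INR i - INR k) / INR (S m) - x) < e / 2).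
  { intros x i k H. rewrite S_INR in *.
    replace ((INR i - INR k) / (INR m + 1) - x)
      with ((INR i - INR k - (INR m + 1) * x) * / (INR m + 1)) by (field; lra).
    rewrite Rabs_mult, (Rabs_pos_eq (/ (INR m + 1))) by (left; apply Rinv_0_lt_compat; lra).
    apply Rle_lt_trans with (1 * / (INR m + 1)).
    - apply Rmult_le_compat_r; [left; apply Rinv_0_lt_compat; lra|assumption].
    - rewrite Rmult_1_l. replace (e / 2) with (/ (2 / e)) by (field; lra).
      apply Rinv_lt_contravar; [|assumption].
      apply Rmult_lt_0_compat; [apply Rdiv_lt_0_compat; lra|lra]. }
  assert (H1 := E _ _ _ Hab). assert (H2 := E _ _ _ Hab').
  unfold rational_C. rewrite !Hn by lia.
  replace e with (e / 2 + e / 2) by field. apply Rplus_lt_compat; [exact H1|exact H2].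
Qed.

(** * Power sequences *)

Lemma disc_coeffs_pow p : disc_coeffs 1 (fun k => RtoC (INR (S k) ^ p)).
Proof.
  apply (disc_coeffs_shift 1 (fun k => RtoC (INR k ^ p))).
  induction p as [|p IH].
  - intros r Hr. exists 1. intros k. simpl. rewrite Cmod_1, Rmult_1_l, <- (pow1 k).
    apply pow_incr. lra.
  - apply disc_coeffs_scal_le with (fun k => INR k * RtoC (INR k ^ p))%C 1.
    + now apply disc_coeffs_mul_index.
    + intros k. right. rewrite <- RtoC_mult. simpl. lra.
Qed.

Lemma Rpower_le_pow k b p : b <= INR p -> Rpower (INR (S k)) b <= INR (S k) ^ p.
Proof.
  intros H. rewrite <- Rpower_pow by (apply lt_0_INR; lia).
  apply Rle_Rpower; [rewrite S_INR; generalize (pos_INR k); lra|assumption].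
Qed.

(** The two constants are inverse to each other, so the sign of the exponent does not matter. *)
Lemma Rpower_bounded_ratio x b : 1 / 2 <= x <= 2 -> Rpower x b <= Rpower 2 (Rabs b).
Proof.
  intros Hx. unfold Rpower. apply exp_le.
  assert (H2 : 0 < ln 2) by (rewrite <- ln_1; apply ln_increasing; lra).
  assert (Hl : Rabs (ln x) <= ln 2).
  { apply Rabs_le. split; [|apply ln_le; lra].
    rewrite <- ln_Rinv by lra. apply ln_le; lra. }
  eapply Rle_trans; [apply Rle_abs|]. rewrite Rabs_mult.
  apply Rmult_le_compat_l; [apply Rabs_pos|assumption].
Qed.

Lemma Rpower_pos x b : 0 < Rpower x b.
Proof. apply exp_pos. Qed.

(** * Trapezoidal kernels *)

(** The coefficients of [(1 + x + ... + x^(2M)) (1 + x + ... + x^M) / (M+1)]: they count the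
    [b <= M] for which [i - b] lies between [0] and [2M], which gives at once the values at
    the plateau and the product formula. *)
Definition trapezoid (M i : nat) : R :=
  rsum (fun b => if andb (b <=? i)%nat (i <=? b + 2 * M)%nat then 1 else 0) (S M) / INR (S M).

Lemma trapezoid_bounds M i : 0 <= trapezoid M i <= 1.
Proof.
  assert (HM : 0 < INR (S M)) by (apply lt_0_INR; lia). unfold trapezoid.
  set (u := fun b => if andb (b <=? i)%nat (i <=? b + 2 * M)%nat then 1 else 0).
  assert (Hu : forall b, 0 <= u b <= 1) by (intros b; unfold u; destruct andb; lra).
  split.
  - apply Rdiv_le_0_compat; [|assumption]. apply rsum_nonneg. intros; apply Hu.
  - apply Rmult_le_reg_r with (INR (S M)); [assumption|].
    unfold Rdiv. rewrite Rmult_assoc, Rinv_l, Rmult_1_r, Rmult_1_l by lra.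
    rewrite <- (Rmult_1_r (INR (S M))), <- rsum_const. apply rsum_le. intros; apply Hu.
Qed.

Lemma trapezoid_plateau M i : (M <= i <= 2 * M)%nat -> trapezoid M i = 1.
Proof.
  intros Hi. assert (HM : 0 < INR (S M)) by (apply lt_0_INR; lia). unfold trapezoid.
  rewrite (rsum_ext _ (fun _ => 1)).
  - rewrite rsum_const. field. lra.
  - intros b Hb. destruct (Nat.leb_spec b i); [|lia]. destruct (Nat.leb_spec i (b + 2 * M)); [reflexivity|lia].
Qed.

Lemma trapezoid_outside M i : (3 * M < i)%nat -> trapezoid M i = 0.
Proof.
  intros Hi. unfold trapezoid. rewrite (rsum_ext _ (fun _ => 0)).
  - rewrite rsum_const. unfold Rdiv. ring.
  - intros b Hb. destruct (Nat.leb_spec i (b + 2 * M)); [lia|]. now rewrite Bool.andb_false_r.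
Qed.

Lemma csum_window (u : nat -> C) b n m : (b + m <= n)%nat ->
  csum (fun i => if andb (b <=? i)%nat (i <? b + m)%nat then u i else 0) n
  = csum (fun i => u (b + i)%nat) m.
Proof.
  intros H. replace n with (b + (m + (n - b - m)))%nat by lia.
  rewrite csum_add, (csum_add _ m).
  rewrite (csum_ext _ (fun _ => RtoC 0) b).
  2:{ intros k Hk. destruct (Nat.leb_spec b k); [lia|reflexivity]. }
  rewrite (csum_ext _ (fun i => u (b + i)%nat) m).
  2:{ intros k Hk. destruct (Nat.leb_spec b (b + k)); [|lia].
      destruct (Nat.ltb_spec (b + k) (b + m)); [reflexivity|lia]. }
  rewrite (csum_ext _ (fun _ => RtoC 0) (n - b - m)).
  2:{ intros k Hk. destruct (Nat.ltb_spec (b + (m + k)) (b + m)); [lia|].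
      now rewrite Bool.andb_false_r. }
  rewrite !csum_0. ring.
Qed.

Lemma trapezoid_product M (x : C) :
  csum (fun i => RtoC (trapezoid M i) * x ^ i)%C (3 * M + 1)
  = (RtoC (/ INR (S M)) * (csum (fun i => x ^ i) (S (2 * M)) * csum (fun i => x ^ i) (S M)))%C.
Proof.
  rewrite (csum_ext _ (fun i => RtoC (/ INR (S M)) *
     csum (fun b => if andb (b <=? i)%nat (i <? b + S (2 * M))%nat then x ^ i else 0) (S M))%C).
  2:{ intros i _. unfold trapezoid, Rdiv. rewrite RtoC_mult, RtoC_rsum.
      rewrite (Cmult_comm _ (RtoC (/ _))), <- Cmult_assoc. f_equal.
      rewrite Cmult_comm, <- csum_scal. apply csum_ext. intros b _.
      replace (i <? b + S (2 * M))%nat with (i <=? b + 2 * M)%nat.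
      - destruct andb; ring.
      - destruct (Nat.leb_spec i (b + 2 * M)), (Nat.ltb_spec i (b + S (2 * M))); lia. }
  rewrite csum_scal, csum_swap. f_equal.
  rewrite (csum_ext _ (fun b => csum (fun i => x ^ i) (S (2 * M)) * x ^ b)%C).
  - apply csum_scal.
  - intros b Hb. rewrite (csum_window (fun i => x ^ i)%C) by lia.
    rewrite (Cmult_comm _ (x ^ b)), <- csum_scal. apply csum_ext. intros i _. apply Cpow_add_r.
Qed.

(** * Weighted densities of arithmetic progressions *)

Lemma Rpower_concave x g : 0 < x -> 0 < g < 1 -> Rpower x g <= 1 + g * (x - 1).
Proof.
  intros Hx Hg. unfold Rpower. set (y := ln x).
  assert (E : x = exp (g * y) * exp (y - g * y)).
  { rewrite <- exp_plus. replace (g * y + (y - g * y)) with y by ring. unfold y. now rewrite exp_ln. }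
  assert (E2 : 1 = exp (g * y) * exp (- (g * y))).
  { rewrite <- exp_plus, Rplus_opp_r, exp_0. reflexivity. }
  assert (H1 := exp_ineq1_le (y - g * y)). assert (H2 := exp_ineq1_le (- (g * y))).
  assert (H0 := exp_pos (g * y)).
  (* convexity of [exp], from the two tangent lines at the common point *)
  assert (H3 : 1 <= g * exp (y - g * y) + (1 - g) * exp (- (g * y))) by nra.
  rewrite E at 1. clear H1 H2.
  set (u := exp (g * y)) in *. set (v := exp (y - g * y)) in *. set (w := exp (- (g * y))) in *.
  assert (u * 1 <= u * (g * v + (1 - g) * w)) by (apply Rmult_le_compat_l; lra).
  nra.
Qed.

Lemma Rpower_le_self y g : 0 < y <= 1 -> 0 < g < 1 -> y <= Rpower y g.
Proof.
  intros Hy Hg. rewrite <- (exp_ln y) at 1 by lra. unfold Rpower. apply exp_le.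
  assert (ln y <= 0) by (rewrite <- ln_1; apply ln_le; lra). nra.
Qed.

Lemma rsum_geom_reversed (v : nat -> R) C q N n :
  0 <= C -> 0 <= q < 1 -> (forall k, (k < N)%nat -> v k <= C * q ^ (N - 1 - k)) ->
  (n <= N)%nat -> rsum v n <= C * / (1 - q) * q ^ (N - n).
Proof.
  intros HC Hq Hv. assert (H1 : 0 < / (1 - q)) by (apply Rinv_0_lt_compat; lra).
  induction n as [|n IH]; intros Hn; simpl.
  - apply Rmult_le_pos; [apply Rmult_le_pos; lra|apply pow_le; lra].
  - specialize (IH ltac:(lia)). specialize (Hv n ltac:(lia)).
    replace (N - n)%nat with (S (N - 1 - n)) in IH by lia.
    replace (N - S n)%nat with (N - 1 - n)%nat by lia.
    set (x := q ^ (N - 1 - n)) in *. simpl in IH. fold x in IH.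
    replace (C * / (1 - q) * x) with (C * / (1 - q) * (q * x) + C * x) by (field; lra). lra.
Qed.

(** By concavity [k^gamma <= N^gamma - gamma N^(gamma-1) (N-k)], so the sum is dominated by a
    geometric series of ratio [exp (- gamma N^(gamma-1))]. *)
Lemma beta_sum_le gamma N : 0 < gamma < 1 -> (1 <= N)%nat ->
  rsum (fun k => beta_weight gamma (S k)) N
  <= exp (Rpower (INR N) gamma) * (1 + Rpower (INR N) (1 - gamma) / gamma).
Proof.
  intros Hg HN. assert (HNR : 1 <= INR N) by (apply (le_INR 1); lia).
  set (G := Rpower (INR N) gamma). set (Q := Rpower (INR N) (1 - gamma)).
  assert (HQ : 0 < Q) by apply Rpower_pos.
  assert (EGQ : G * Q = INR N).
  { unfold G, Q. rewrite <- Rpower_plus. replace (gamma + (1 - gamma)) with 1 by ring.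
    apply Rpower_1. lra. }
  set (th := gamma / Q). assert (Hth : 0 < th) by (apply Rdiv_lt_0_compat; lra).
  assert (He : exp (- th) <= / (1 + th)).
  { rewrite exp_Ropp. apply Rinv_le_contravar; [lra|]. apply exp_ineq1_le. }
  assert (Hi : / (1 + th) < 1) by (rewrite <- Rinv_1 at 2; apply Rinv_lt_contravar; lra).
  assert (He0 := exp_pos (- th)).
  apply Rle_trans with (exp G * / (1 - exp (- th)) * exp (- th) ^ (N - N)).
  - apply (rsum_geom_reversed _ (exp G) (exp (- th)) N N); [left; apply exp_pos|lra| |lia].
    intros k Hk. rewrite <- Rpower_pow by apply exp_pos. unfold Rpower at 1.
    rewrite ln_exp, <- exp_plus. apply exp_le.
    assert (HkN : INR (N - 1 - k) = INR N - INR (S k)).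
    { rewrite <- minus_INR by lia. f_equal. lia. }
    rewrite HkN. assert (HSk : 0 < INR (S k)) by (apply lt_0_INR; lia).
    assert (Hc := Rpower_concave (INR (S k) / INR N) gamma ltac:(apply Rdiv_lt_0_compat; lra) Hg).
    replace (INR (S k)) with (INR (S k) / INR N * INR N) at 1 by (field; lra).
    rewrite <- Rpower_mult_distr by (try apply Rdiv_lt_0_compat; lra). fold G.
    apply Rmult_le_compat_r with (r := G) in Hc; [|left; apply Rpower_pos].
    eapply Rle_trans; [exact Hc|]. right.
    unfold th. rewrite <- EGQ. field. split; [lra|].
    intros E0. assert (0 < G) by apply Rpower_pos. lra.
  - rewrite Nat.sub_diag, pow_O, Rmult_1_r. apply Rmult_le_compat_l; [left; apply exp_pos|].
    replace (1 + Q / gamma) with (/ (th / (1 + th))) by (unfold th; field; lra).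
    apply Rinv_le_contravar; [apply Rdiv_lt_0_compat; lra|].
    replace (th / (1 + th)) with (1 - / (1 + th)) by (field; lra). lra.
Qed.

Lemma rsum_progression (v : nat -> R) b t d n :
  (forall k, 0 <= v k) -> (0 < d)%nat -> (forall i, (i <= n)%nat -> b <= v (t + d * i)%nat) ->
  INR (S n) * b <= rsum v (S (t + d * n)).
Proof.
  intros Hv Hd. induction n as [|n IH]; intros Hb.
  - specialize (Hb O ltac:(lia)). rewrite Nat.mul_0_r, Nat.add_0_r in *. simpl.
    assert (0 <= rsum v t) by (apply rsum_nonneg; auto). lra.
  - specialize (Hb (S n)) as Hn. specialize (IH ltac:(intros; apply Hb; lia)).
    rewrite S_INR. simpl rsum.
    assert (rsum v (S (t + d * n)) <= rsum v (t + d * S n)) by (apply rsum_incr; [lia|assumption]).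
    specialize (Hn ltac:(lia)). lra.
Qed.

(** If [L <= N^(1-gamma)] then [(N-L)^gamma >= N^gamma (1 - L/N) >= N^gamma - 1], so each of the
    [M+1] visits has weight at least [exp (N^gamma) / e]. By [beta_sum_le] the total weight is
    of the order of [N^(1-gamma) exp (N^gamma)], and [M+1] is at least [N^(1-gamma) / d]. *)
Lemma progression_density gamma N M d E :
  0 < gamma < 1 -> (0 < d)%nat -> (d * M < N)%nat ->
  INR (d * M) <= Rpower (INR N) (1 - gamma) <= INR d * INR (S M) ->
  (forall i, (i <= M)%nat -> E (N - d * i)%nat) ->
  / (exp 1 * INR d * (1 + / gamma)) <=
  sum_n_m (fun k => indicator E k * beta_weight gamma k) 1 N / sum_n_m (beta_weight gamma) 1 N.
Proof.
  intros Hg Hd HMN [HM1 HM2] HE. rewrite !sum_n_m_1_rsum.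
  assert (HNR : 1 <= INR N) by (apply (le_INR 1); lia).
  set (G := Rpower (INR N) gamma). set (Q := Rpower (INR N) (1 - gamma)) in *.
  assert (EGQ : G * Q = INR N).
  { unfold G, Q. rewrite <- Rpower_plus. replace (gamma + (1 - gamma)) with 1 by ring.
    apply Rpower_1. lra. }
  assert (HG : 0 < G) by apply Rpower_pos.
  assert (HQ : 1 <= Q).
  { rewrite <- (Rpower_O (INR N)) by lra. apply Rle_Rpower; lra. }
  assert (Hden := beta_sum_le gamma N Hg ltac:(lia)). fold G Q in Hden.
  set (D := rsum (fun k => beta_weight gamma (S k)) N) in *.
  assert (HD : 0 < D).
  { apply Rlt_le_trans with (INR N); [lra|].
    rewrite <- (Rmult_1_r (INR N)), <- rsum_const. apply rsum_le. intros; apply beta_weight_ge_1. }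
  set (v := fun k => indicator E (S k) * beta_weight gamma (S k)).
  assert (Hnum : INR (S M) * exp (G - 1) <= rsum v N).
  { apply Rle_trans with (rsum v (S ((N - 1 - d * M) + d * M))); [|right; f_equal; lia].
    apply rsum_progression; [|assumption|].
    - intros k. apply Rmult_le_pos; [apply indicator_bounds|].
      generalize (beta_weight_ge_1 gamma (S k)); lra.
    - intros i Hi. unfold v.
      replace (S (N - 1 - d * M + d * i)) with (N - d * (M - i))%nat
        by (rewrite Nat.mul_sub_distr_l; assert (d * i <= d * M)%nat by (apply Nat.mul_le_mono_l; lia); lia).
      rewrite indicator_true, Rmult_1_l by (apply HE; lia).
      apply exp_le. set (k := (N - d * (M - i))%nat).
      assert (Hle : (d * (M - i) <= d * M)%nat) by (apply Nat.mul_le_mono_l; lia).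
      assert (Hk : INR k = INR N - INR (d * (M - i))) by (apply minus_INR; lia).
      assert (Hk1 : 1 <= INR k) by (apply (le_INR 1); unfold k; lia).
      apply le_INR in Hle. assert (H0 := pos_INR (d * (M - i))).
      assert (Hy : INR k / INR N <= Rpower (INR k / INR N) gamma).
      { apply Rpower_le_self; [|assumption]. split; [apply Rdiv_lt_0_compat; lra|].
        apply Rmult_le_reg_r with (INR N); [lra|].
        unfold Rdiv. rewrite Rmult_assoc, Rinv_l; lra. }
      replace (INR k) with (INR k / INR N * INR N) at 1 by (field; lra).
      rewrite <- Rpower_mult_distr by (try apply Rdiv_lt_0_compat; lra). fold G.
      apply Rle_trans with (INR k / INR N * G); [|apply Rmult_le_compat_r; lra].
      rewrite Hk, <- EGQ. replace ((G * Q - INR (d * (M - i))) / (G * Q) * G)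
        with (G - INR (d * (M - i)) / Q) by (field; lra).
      assert (INR (d * (M - i)) / Q <= 1); [|lra].
      apply Rmult_le_reg_r with Q; [lra|]. unfold Rdiv. rewrite Rmult_assoc, Rinv_l; lra. }
  assert (He1 := exp_pos 1). assert (HdR : 1 <= INR d) by (apply (le_INR 1); lia).
  assert (Hgi : 0 < / gamma) by (apply Rinv_0_lt_compat; lra).
  apply Rmult_le_reg_r with D; [assumption|].
  unfold Rdiv. rewrite (Rmult_assoc (rsum v N)), Rinv_l, Rmult_1_r by lra.
  eapply Rle_trans; [|exact Hnum].
  assert (EG : exp (G - 1) = exp G * / exp 1).
  { unfold Rminus. now rewrite exp_plus, exp_Ropp. }
  rewrite EG. assert (HeG := exp_pos G).
  assert (HP : 0 < exp 1 * INR d * (1 + / gamma)) by (repeat apply Rmult_lt_0_compat; lra).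
  apply Rmult_le_reg_l with (exp 1 * INR d * (1 + / gamma)); [assumption|].
  rewrite <- Rmult_assoc, Rinv_r, Rmult_1_l by lra.
  replace (exp 1 * INR d * (1 + / gamma) * (INR (S M) * (exp G * / exp 1)))
    with (exp G * ((INR d * INR (S M)) * (1 + / gamma))) by (field; lra).
  eapply Rle_trans; [exact Hden|]. apply Rmult_le_compat_l; [lra|].
  apply Rle_trans with (Q * (1 + / gamma)).
  - unfold Rdiv. rewrite Rmult_plus_distr_l. lra.
  - apply Rmult_le_compat_r; lra.
Qed.

(** * Mean values of geometric sums *)

(** Parseval's identity, by induction on the length: adding the term of index [K] adds its
    squared modulus, which is at most [1], and twice the real part of its products with the
    previous ones, which are multiples of negative powers of the variable and integrate to zero. *)
Lemma geometric_sum_L2 r d K : 0 < r <= 1 -> (0 < d)%nat ->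
  RInt (fun t => Cmod (csum (fun a => (circle r t ^ d) ^ a)%C K) ^ 2) 0 (2 * PI) <= INR K * (2 * PI).
Proof.
  intros Hr Hd. assert (HPI := PI_RGT_0).
  assert (Hc : forall K t, continuous (fun t => csum (fun a => (circle r t ^ d) ^ a)%C K) t).
  { intros n t. apply (continuous_csum (fun a t => (circle r t ^ d) ^ a)%C).
    intros k _. apply continuous_Cpow, continuous_Cpow, continuous_circle. }
  assert (Hx : forall t, circle r t <> 0) by (intros; apply circle_neq_0; lra).
  induction K as [|K IH].
  - rewrite (RInt_ext _ (fun _ => 0)).
    + rewrite RInt_const. unfold scal; simpl; unfold mult; simpl. lra.
    + intros t _. simpl. rewrite Cmod_0. ring.
  - set (S0 := fun t => csum (fun a => (circle r t ^ d) ^ a)%C K) in *.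
    set (rho := r ^ (2 * (d * K))).
    (* the cross terms are multiples of negative powers of the variable *)
    set (W := fun t => csum (fun a => RtoC rho * / circle r t ^ (d * (K - a)))%C K).
    assert (HW : forall t, continuous W t).
    { intros t. apply (continuous_csum (fun a t => RtoC rho * / circle r t ^ (d * (K - a)))%C).
      intros k _. apply (continuous_Cmult (fun _ => RtoC rho)); [apply continuous_const|].
      apply continuous_circle_pow_inv. lra. }
    assert (HIW : CInt W 0 (2 * PI) = 0).
    { unfold W. rewrite (CInt_csum (fun a t => RtoC rho * / circle r t ^ (d * (K - a)))%C).
      - apply csum_all_0. intros k Hk.
        rewrite (CInt_scal (RtoC rho) (fun t => / circle r t ^ (d * (K - k)))%C)
          by (intros; apply continuous_circle_pow_inv; lra).
        rewrite CInt_circle_pow_inv; [ring|lra|]. apply Nat.mul_pos_pos; lia.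
      - intros k t. apply (continuous_Cmult (fun _ => RtoC rho)); [apply continuous_const|].
        apply continuous_circle_pow_inv. lra. }
    assert (Epow : forall t, Cmod ((circle r t ^ d) ^ K) ^ 2 = rho).
    { intros t. rewrite !Cmod_pow, Cmod_circle, <- !pow_mult by lra. unfold rho. f_equal. lia. }
    assert (E : forall t, Cmod (csum (fun a => (circle r t ^ d) ^ a)%C (S K)) ^ 2
       = Cmod (S0 t) ^ 2 + (2 * Re (W t) + rho)).
    { intros t. cbn [csum]. fold (S0 t). set (y := ((circle r t ^ d) ^ K)%C).
      assert (EW : W t = (S0 t * Cconj y)%C).
      { unfold W, S0. rewrite Cmult_comm, <- csum_scal. apply csum_ext. intros a Ha.
        rewrite <- (Epow t). fold y. rewrite Cmod2_conj.
        assert (Hy : y = ((circle r t ^ d) ^ a * circle r t ^ (d * (K - a)))%C).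
        { unfold y. rewrite (Cpow_mult_r _ d (K - a)), <- Cpow_add_r. f_equal. lia. }
        rewrite Hy at 1. field. apply Cpow_nz, Hx. }
      rewrite EW, <- (Epow t). fold y. rewrite !Cmod2_alt.
      destruct (S0 t) as [x1 x2], y as [y1 y2]. simpl. ring. }
    rewrite (RInt_ext _ (fun t => Cmod (S0 t) ^ 2 + (2 * Re (W t) + rho))) by (intros; apply E).
    assert (Hrho : rho <= 1).
    { unfold rho. rewrite <- (pow1 (2 * (d * K))). apply pow_incr. lra. }
    assert (HI1 : ex_RInt (fun t => Cmod (S0 t) ^ 2) 0 (2 * PI)).
    { apply ex_RInt_cont. intros t.
      apply (continuous_mult (K := R_AbsRing)); [apply continuous_Cmod, Hc|].
      apply (continuous_mult (K := R_AbsRing)); [apply continuous_Cmod, Hc|apply continuous_const]. }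
    assert (HI2 : is_RInt (fun t => 2 * Re (W t) + rho) 0 (2 * PI) (2 * 0 + (2 * PI - 0) * rho)).
    { apply (is_RInt_plus (V := R_NormedModule)).
      - apply (is_RInt_scal (V := R_NormedModule)).
        replace 0 with (Re (CInt W 0 (2 * PI))) at 2 by (now rewrite HIW).
        apply (RInt_correct (V := R_CompleteNormedModule)). apply ex_RInt_cont.
        intros t. apply continuous_Re, HW.
      - apply (is_RInt_const (V := R_NormedModule)). }
    rewrite (RInt_plus (V := R_CompleteNormedModule)); [|assumption|now exists (2 * 0 + (2 * PI - 0) * rho)].
    rewrite (is_RInt_unique _ _ _ _ HI2), S_INR. unfold plus; simpl.
    assert ((2 * PI - 0) * rho <= 2 * PI * 1) by (rewrite Rminus_0_r; apply Rmult_le_compat_l; lra).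
    change (RInt (fun t => Cmod (S0 t) ^ 2) 0 (2 * PI) <= INR K * (2 * PI)) in IH. simpl in IH. lra.
Qed.

(** * The lacunary series of blocks *)

Section Blocks.

Variables (alpha : R) (d M N : nat -> nat) (q : nat -> nat -> C).

Definition start (j : nat) : nat := (N j - 2 * M j * d j)%nat.

(** Block [j] is [N^(-alpha) z^(start j) V(z^d) Q(z)]. Since [Q] has degree less than [d], the
    exponents [start j + d i + k] of different pairs [(i, k)] are different, and the coefficient
    at [m] is read off from the division of [m - start j] by [d]. *)
Definition block (j m : nat) : C :=
  if (m <? start j)%nat then 0
  else (RtoC (Rpower (INR (N j)) (- alpha) * trapezoid (M j) ((m - start j) / d j))
        * q j ((m - start j) mod d j))%C.

(** The blocks of index greater than [m] start after [m], so the finite sum is the whole sum. *)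
Definition blocks (m : nat) : C := csum (fun j => block j m) (S m).

Definition block_mass (j : nat) : R := rsum (fun k => Cmod (q j k)) (d j).

Hypothesis d_pos : forall j, (0 < d j)%nat.
Hypothesis block_short : forall j, (8 * M j * d j <= N j)%nat.
Hypothesis d_small : forall j, (8 * d j <= N j)%nat.
Hypothesis N_lacunary : forall j, (4 * N j <= N (S j))%nat.
Hypothesis mass_le : forall j, block_mass j <= INR (N j).

Lemma N_lacunary_lt i j : (i < j)%nat -> (4 * N i <= N j)%nat.
Proof.
  induction 1 as [|j _ IH]; [apply N_lacunary|]. specialize (N_lacunary j). lia.
Qed.

Lemma N_ge_index j : (2 * j + 2 <= N j)%nat.
Proof.
  induction j as [|j IH].
  - specialize (d_small O). specialize (d_pos O). lia.
  - specialize (N_lacunary j). lia.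
Qed.

Lemma start_bounds j : (3 * N j <= 4 * start j)%nat /\ (start j + 2 * M j * d j = N j)%nat.
Proof. unfold start. specialize (block_short j). lia. Qed.

Lemma block_position (j i k : nat) :
  ((start j + d j * i + k - start j) / d j = i + k / d j)%nat.
Proof.
  replace (start j + d j * i + k - start j)%nat with (k + i * d j)%nat by lia.
  specialize (d_pos j). rewrite Nat.div_add by lia. lia.
Qed.

Lemma block_at j i k : (k < d j)%nat ->
  block j (start j + d j * i + k) = (RtoC (Rpower (INR (N j)) (- alpha) * trapezoid (M j) i) * q j k)%C.
Proof.
  intros Hk. unfold block. destruct (Nat.ltb_spec (start j + d j * i + k) (start j)); [lia|].
  rewrite block_position, Nat.div_small, Nat.add_0_r by assumption.
  replace (start j + d j * i + k - start j)%nat with (k + i * d j)%nat by lia.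
  now rewrite Nat.Div0.mod_add, Nat.mod_small.
Qed.

Lemma block_late j m : (start j + d j * (3 * M j + 1) <= m)%nat -> block j m = 0.
Proof.
  intros Hm. unfold block. destruct (Nat.ltb_spec m (start j)); [reflexivity|].
  rewrite trapezoid_outside; [ring_simplify; rewrite Rmult_0_r; ring|].
  apply Nat.lt_le_trans with (3 * M j + 1)%nat; [lia|].
  apply Nat.div_le_lower_bound; [specialize (d_pos j); lia|lia].
Qed.

(** The plateau ends at [N j], and the block extends by at most [N j / 4] on either side of it,
    while the plateau itself is at most [N j / 8] long. Hence the block lives between
    [N j / 2] and [2 N j]; as [N] grows by a factor at least [4], the blocks are disjoint. *)
Lemma block_support j m : (2 * m < N j \/ 2 * N j <= m)%nat -> block j m = 0.
Proof.
  intros [Hm|Hm].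
  - unfold block. destruct (start_bounds j).
    destruct (Nat.ltb_spec m (start j)); [reflexivity|lia].
  - apply block_late. destruct (start_bounds j). specialize (block_short j). specialize (d_small j). nia.
Qed.

Lemma blocks_at j m : (N j <= 2 * m < 4 * N j)%nat -> blocks m = block j m.
Proof.
  intros Hm. apply (csum_single (fun j => block j m)).
  - generalize (N_ge_index j). lia.
  - intros i Hi. apply block_support.
    destruct (Nat.lt_ge_cases i j) as [Hij|Hij].
    + generalize (N_lacunary_lt i j Hij). lia.
    + generalize (N_lacunary_lt j i ltac:(lia)). lia.
Qed.

Lemma blocks_gap m : (forall j, ~ (N j <= 2 * m < 4 * N j)%nat) -> blocks m = 0.
Proof.
  intros H. apply csum_all_0. intros j _. apply block_support. specialize (H j). lia.
Qed.

Lemma block_mass_nonneg j : 0 <= block_mass j.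
Proof. apply rsum_nonneg. intros; apply Cmod_ge_0. Qed.

Lemma block_le j m : Cmod (block j m) <= Rpower (INR (N j)) (- alpha) * block_mass j.
Proof.
  assert (HP := Rpower_pos (INR (N j)) (- alpha)).
  unfold block. destruct (m <? start j)%nat.
  - rewrite Cmod_0. apply Rmult_le_pos; [lra|apply block_mass_nonneg].
  - rewrite Cmod_mult, Cmod_R.
    set (i := ((m - start j) / d j)%nat). set (k := ((m - start j) mod d j)%nat).
    assert (Ht := trapezoid_bounds (M j) i).
    rewrite Rabs_pos_eq by (apply Rmult_le_pos; lra).
    assert (Hq : Cmod (q j k) <= block_mass j).
    { apply (rsum_term (fun k => Cmod (q j k))); [|intros; apply Cmod_ge_0].
      apply Nat.mod_upper_bound. specialize (d_pos j). lia. }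
    apply Rmult_le_compat; [apply Rmult_le_pos; lra|apply Cmod_ge_0|nra|assumption].
Qed.

(** Within a block [m + 1] and [N j] differ by a factor at most [2], which lets the size be
    expressed by [m] alone. *)
Lemma blocks_bound m : blocks m = 0 \/ exists j, (N j <= 2 * m < 4 * N j)%nat /\
  Cmod (blocks m) <= Rpower 2 (Rabs alpha) * block_mass j * Rpower (INR (S m)) (- alpha).
Proof.
  destruct (excluded_middle_informative (exists j, (N j <= 2 * m < 4 * N j)%nat)) as [[j Hj]|Hno].
  - right. exists j. split; [assumption|]. rewrite (blocks_at j m Hj).
    eapply Rle_trans; [apply block_le|].
    replace (Rpower 2 (Rabs alpha) * block_mass j * Rpower (INR (S m)) (- alpha))
      with (Rpower 2 (Rabs alpha) * Rpower (INR (S m)) (- alpha) * block_mass j) by ring.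
    apply Rmult_le_compat_r; [apply block_mass_nonneg|].
    assert (HS : 0 < INR (S m)) by (apply lt_0_INR; lia).
    assert (H1 : INR (N j) <= 2 * INR m) by (rewrite <- (mult_INR 2); apply le_INR; lia).
    assert (H2 : INR (S m) <= 2 * INR (N j)) by (rewrite <- (mult_INR 2); apply le_INR; lia).
    assert (H3 : 2 * INR m <= 2 * INR (S m)) by (rewrite S_INR; lra).
    replace (INR (N j)) with (INR (N j) / INR (S m) * INR (S m)) at 1 by (field; lra).
    rewrite <- Rpower_mult_distr; [|apply Rdiv_lt_0_compat; lra|assumption].
    apply Rmult_le_compat_r; [left; apply Rpower_pos|].
    rewrite <- (Rabs_Ropp alpha). apply Rpower_bounded_ratio. split.
    + apply Rmult_le_reg_r with (INR (S m)); [assumption|].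
      unfold Rdiv at 2. rewrite Rmult_assoc, Rinv_l by lra. lra.
    + apply Rmult_le_reg_r with (INR (S m)); [assumption|].
      unfold Rdiv. rewrite Rmult_assoc, Rinv_l by lra. lra.
  - left. apply blocks_gap. intros j Hj. apply Hno. now exists j.
Qed.

Variable p : nat.
Hypothesis p_large : Rabs alpha + 1 <= INR p.

Lemma Rpower_opp_le_pow k : INR (S k) * Rpower (INR (S k)) (- alpha) <= INR (S k) ^ p.
Proof.
  assert (HS : 1 <= INR (S k)) by (rewrite S_INR; generalize (pos_INR k); lra).
  rewrite <- (Rpower_1 (INR (S k))) at 1 by lra. rewrite <- Rpower_plus.
  apply Rpower_le_pow. generalize (Rle_abs (- alpha)). rewrite Rabs_Ropp. lra.
Qed.

Lemma blocks_disc_coeffs : disc_coeffs 1 blocks.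
Proof.
  apply disc_coeffs_scal_le with (fun k => RtoC (INR (S k) ^ p)) (2 * Rpower 2 (Rabs alpha)).
  - apply disc_coeffs_pow.
  - intros m. cbv beta. assert (HP := Rpower_pos 2 (Rabs alpha)).
    assert (Hpow := Rpower_opp_le_pow m).
    assert (H0 : 0 <= INR (S m) ^ p) by (apply pow_le, pos_INR).
    rewrite Cmod_R, (Rabs_pos_eq (INR (S m) ^ p)) by assumption.
    destruct (blocks_bound m) as [->|[j [Hj H]]].
    + rewrite Cmod_0. apply Rmult_le_pos; lra.
    + eapply Rle_trans; [exact H|]. specialize (mass_le j).
      assert (H1 : INR (N j) <= 2 * INR (S m)).
      { rewrite <- (mult_INR 2). apply le_INR. lia. }
      assert (HQ := Rpower_pos (INR (S m)) (- alpha)).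
      apply Rle_trans with (Rpower 2 (Rabs alpha) * (2 * INR (S m)) * Rpower (INR (S m)) (- alpha)).
      * apply Rmult_le_compat_r; [lra|]. apply Rmult_le_compat_l; lra.
      * nra.
Qed.

(** The factor [(n+k+1)^alpha] produced by the shift cancels the size of the coefficient it hits.
    The bound only involves the mass of block [j]: earlier blocks are no longer visible, and a
    later one lies at an index [k] comparable with its mass, which is absorbed by one more
    power of [k]. *)
Lemma shifted_blocks_bound j n k : (start j <= n <= N j)%nat ->
  Cmod (blocks (n + k) * RtoC (Rpower (INR (S (n + k)) / INR (S k)) alpha))
  <= 4 * Rpower 2 (Rabs alpha) * (block_mass j + 1) * INR (S k) ^ p.
Proof.
  intros Hn. set (m := (n + k)%nat).
  assert (HP := Rpower_pos 2 (Rabs alpha)). assert (Hj0 := block_mass_nonneg j).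
  assert (HSm : 0 < INR (S m)) by (apply lt_0_INR; lia).
  assert (HSk : 1 <= INR (S k)) by (rewrite S_INR; generalize (pos_INR k); lra).
  assert (Hpow := Rpower_opp_le_pow k).
  assert (HQ := Rpower_pos (INR (S k)) (- alpha)).
  assert (H0 : 0 < INR (S k) ^ p) by (apply pow_lt; lra).
  assert (HB : 0 <= (block_mass j + 1) * INR (S k) ^ p) by (apply Rmult_le_pos; lra).
  rewrite Cmod_mult, Cmod_R, (Rabs_pos_eq (Rpower _ _)) by (left; apply Rpower_pos).
  destruct (blocks_bound m) as [->|[i [Hi H]]].
  { rewrite Cmod_0, Rmult_0_l. rewrite Rmult_assoc. apply Rmult_le_pos; lra. }
  assert (Hi1 : block_mass i * Rpower (INR (S k)) (- alpha) <= 4 * (block_mass j + 1) * INR (S k) ^ p).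
  { destruct (Nat.lt_trichotomy i j) as [Hij|[->|Hij]].
    - generalize (N_lacunary_lt i j Hij), (start_bounds j), (N_ge_index j). lia.
    - assert (Rpower (INR (S k)) (- alpha) <= INR (S k) ^ p) by nra.
      apply Rle_trans with (block_mass j * INR (S k) ^ p); [apply Rmult_le_compat_l; lra|nra].
    - assert (Hl := N_lacunary_lt j i Hij).
      assert (H1 : INR (N i) <= 4 * INR (S k)).
      { replace 4 with (INR 4) by (simpl; ring). rewrite <- mult_INR. apply le_INR. lia. }
      specialize (mass_le i).
      apply Rle_trans with (4 * INR (S k) * Rpower (INR (S k)) (- alpha));
        [apply Rmult_le_compat_r; lra|nra]. }
  assert (E : Rpower (INR (S m)) (- alpha) * Rpower (INR (S m) / INR (S k)) alpha
    = Rpower (INR (S k)) (- alpha)).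
  { unfold Rdiv. rewrite <- Rpower_mult_distr by (try apply Rinv_0_lt_compat; lra).
    rewrite <- Rmult_assoc, <- Rpower_plus, Rplus_opp_l, Rpower_O, Rmult_1_l by assumption.
    unfold Rpower. rewrite ln_Rinv by lra. f_equal. ring. }
  eapply Rle_trans.
  { apply Rmult_le_compat_r; [left; apply Rpower_pos|exact H]. }
  rewrite Rmult_assoc, E.
  replace (Rpower 2 (Rabs alpha) * block_mass i * Rpower (INR (S k)) (- alpha))
    with (Rpower 2 (Rabs alpha) * (block_mass i * Rpower (INR (S k)) (- alpha))) by ring.
  replace (4 * Rpower 2 (Rabs alpha) * (block_mass j + 1) * INR (S k) ^ p)
    with (Rpower 2 (Rabs alpha) * (4 * (block_mass j + 1) * INR (S k) ^ p)) by ring.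
  apply Rmult_le_compat_l; lra.
Qed.

(** The normalisation by [N j] instead of [n + k + 1] leaves a single factor, close to [1]. *)
Lemma shifted_blocks_plateau j i k : (M j <= i <= 2 * M j)%nat -> (k < d j)%nat ->
  (blocks (start j + d j * i + k) * RtoC (Rpower (INR (S (start j + d j * i + k)) / INR (S k)) alpha))%C
  = (RtoC (Rpower (INR (S (start j + d j * i + k)) / INR (N j)) alpha)
     * (q j k * RtoC (Rpower (INR (S k)) (- alpha))))%C.
Proof.
  intros Hi Hk. destruct (start_bounds j). assert (HN := N_ge_index j).
  rewrite (blocks_at j), block_at, trapezoid_plateau, Rmult_1_r; try assumption.
  2:{ specialize (block_short j). specialize (d_small j). nia. }
  set (m := (start j + d j * i + k)%nat).
  assert (HSm : 0 < INR (S m)) by (apply lt_0_INR; lia).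
  assert (HSk : 0 < INR (S k)) by (apply lt_0_INR; lia).
  assert (HNj : 0 < INR (N j)) by (apply lt_0_INR; lia).
  assert (Ei : forall x, 0 < x -> Rpower (INR (S m) / x) alpha
    = Rpower (INR (S m)) alpha * Rpower x (- alpha)).
  { intros x Hx. unfold Rdiv. rewrite <- Rpower_mult_distr by (try apply Rinv_0_lt_compat; assumption).
    f_equal. unfold Rpower. rewrite ln_Rinv by assumption. f_equal. ring. }
  rewrite !Ei, !RtoC_mult by assumption. ring.
Qed.


(** The first error term comes from the factors close to [1] on the pattern itself, the second
    one from all the coefficients of index at least [d j], whose bound does not depend on
    [d j]. *)
Lemma shifted_blocks_approx j i z rho B x eta :
  (M j <= i <= 2 * M j)%nat -> Cmod z <= rho < 1 -> 0 <= B -> 0 <= x < 1 ->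
  (forall k, INR (S k) ^ p * rho ^ k <= B * x ^ k) ->
  (forall k, (k < d j)%nat ->
     Rabs (Rpower (INR (S (start j + d j * i + k)) / INR (N j)) alpha - 1) <= eta) ->
  Cmod (Nat.iter (start j + d j * i) (taylor_shift alpha) (Cpseries blocks) z
    - csum (fun k => q j k * RtoC (Rpower (INR (S k)) (- alpha)) * z ^ k)%C (d j))
  <= eta * rsum (fun k => Cmod (q j k * RtoC (Rpower (INR (S k)) (- alpha)))) (d j)
     + 4 * Rpower 2 (Rabs alpha) * (block_mass j + 1) * B * / (1 - x) * x ^ d j.
Proof.
  intros Hi Hz HB Hx Hp Heta. set (n := (start j + d j * i)%nat).
  assert (Hf : HD (Cpseries blocks)) by (apply HD_Cpseries, blocks_disc_coeffs).
  assert (HTf := HD_iter_shift alpha _ n Hf).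
  set (c := taylor_coeff (Nat.iter n (taylor_shift alpha) (Cpseries blocks))).
  assert (Hc : forall k, c k = (blocks (n + k) * RtoC (Rpower (INR (S (n + k)) / INR (S k)) alpha))%C).
  { intros k. unfold c. rewrite taylor_coeff_iter_shift by assumption.
    now rewrite taylor_coeff_Cpseries by apply blocks_disc_coeffs. }
  rewrite (HD_eq_Cpseries _ z HTf) by lra. fold c.
  assert (Hn : (start j <= n <= N j)%nat).
  { destruct (start_bounds j). unfold n. nia. }
  set (K := 4 * Rpower 2 (Rabs alpha) * (block_mass j + 1)).
  assert (HK : 0 <= K).
  { unfold K. assert (H1 := Rpower_pos 2 (Rabs alpha)). assert (H2 := block_mass_nonneg j).
    apply Rmult_le_pos; lra. }
  assert (Hz0 := Cmod_ge_0 z).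
  assert (Htail : Cmod (Cpseries c z - csum (fun k => c k * z ^ k)%C (d j))
     <= K * B * / (1 - x) * x ^ d j).
  { apply (csum_geom_series (fun k => c k * z ^ k)%C (K * B) x); [now apply Rmult_le_pos|assumption|].
    intros k. rewrite Cmod_mult, Cmod_pow, Hc.
    apply Rle_trans with (K * INR (S k) ^ p * rho ^ k).
    - apply Rmult_le_compat; [apply Cmod_ge_0|apply pow_le; lra| |apply pow_incr; lra].
      now apply shifted_blocks_bound.
    - rewrite !Rmult_assoc. apply Rmult_le_compat_l; [assumption|]. apply Hp. }
  set (P := fun k => (q j k * RtoC (Rpower (INR (S k)) (- alpha)))%C) in *.
  change (csum (fun k => q j k * RtoC (Rpower (INR (S k)) (- alpha)) * z ^ k)%C (d j))
    with (csum (fun k => P k * z ^ k)%C (d j)).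
  set (lam := fun k => Rpower (INR (S (n + k)) / INR (N j)) alpha).
  assert (Ecoef : csum (fun k => c k * z ^ k)%C (d j)
    = (csum (fun k => P k * z ^ k) (d j) + csum (fun k => RtoC (lam k - 1) * (P k * z ^ k)) (d j))%C).
  { rewrite <- csum_plus. apply csum_ext. intros k Hk. rewrite Hc. unfold n, lam.
    rewrite shifted_blocks_plateau by assumption. fold n. rewrite RtoC_minus. unfold P. ring. }
  replace (Cpseries c z - csum (fun k => P k * z ^ k) (d j))%C
    with (csum (fun k => RtoC (lam k - 1) * (P k * z ^ k)) (d j)
          + (Cpseries c z - csum (fun k => c k * z ^ k) (d j)))%C by (rewrite Ecoef; ring).
  eapply Rle_trans; [apply Cmod_triangle|]. apply Rplus_le_compat; [|exact Htail].
  eapply Rle_trans; [apply Cmod_csum|]. rewrite <- rsum_scal. apply rsum_le.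
  intros k Hk. rewrite !Cmod_mult, Cmod_R, Cmod_pow.
  apply Rmult_le_compat; [apply Rabs_pos| |now apply Heta|].
  - apply Rmult_le_pos; [apply Cmod_ge_0|apply pow_le; lra].
  - unfold P. rewrite Cmod_mult.
    rewrite <- (Rmult_1_r (Cmod (q j k) * _)) at 2.
    apply Rmult_le_compat_l; [apply Rmult_le_pos; apply Cmod_ge_0|].
    rewrite <- (pow1 k). apply pow_incr. lra.
Qed.

(** * The means of the blocks *)

Lemma block_sum j z :
  csum (fun m => block j m * z ^ m)%C (2 * N j) =
  (RtoC (Rpower (INR (N j)) (- alpha)) * z ^ start j
   * csum (fun i => RtoC (trapezoid (M j) i) * (z ^ d j) ^ i) (3 * M j + 1)
   * csum (fun k => q j k * z ^ k) (d j))%C.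
Proof.
  destruct (start_bounds j) as [_ Hs].
  assert (Hle : (start j + d j * (3 * M j + 1) <= 2 * N j)%nat).
  { specialize (block_short j). specialize (d_small j). nia. }
  replace (2 * N j)%nat
    with (start j + (d j * (3 * M j + 1) + (2 * N j - start j - d j * (3 * M j + 1))))%nat by lia.
  rewrite csum_add, (csum_add _ (d j * (3 * M j + 1))).
  rewrite (csum_all_0 _ (start j)).
  2:{ intros k Hk. unfold block. destruct (Nat.ltb_spec k (start j)); [ring|lia]. }
  rewrite (csum_all_0 _ (2 * N j - start j - d j * (3 * M j + 1))).
  2:{ intros k Hk. rewrite block_late by lia. ring. }
  rewrite csum_blocks, Cplus_0_l, Cplus_0_r, <- Cmult_assoc.
  rewrite (Cmult_comm (csum _ (3 * M j + 1))), <- csum_scal, <- csum_scal.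
  apply csum_ext. intros i _.
  transitivity (RtoC (Rpower (INR (N j)) (- alpha)) * z ^ start j
    * (RtoC (trapezoid (M j) i) * (z ^ d j) ^ i) * csum (fun k => q j k * z ^ k) (d j))%C; [|ring].
  rewrite <- csum_scal. apply csum_ext. intros k Hk.
  rewrite Nat.add_assoc, block_at, RtoC_mult, !Cpow_add_r, Cpow_mult_r by assumption. ring.
Qed.

(** The product of the two geometric sums is replaced by half the sum of their squares, whose
    means are known. *)
Lemma block_sum_le j r t : 0 < r <= 1 ->
  Cmod (csum (fun m => block j m * circle r t ^ m)%C (2 * N j)) <=
  Rpower (INR (N j)) (- alpha) * block_mass j * r ^ start j * / (2 * INR (S (M j)))
  * (Cmod (csum (fun a => (circle r t ^ d j) ^ a)%C (S (2 * M j))) ^ 2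
     + Cmod (csum (fun a => (circle r t ^ d j) ^ a)%C (S (M j))) ^ 2).
Proof.
  intros Hr. rewrite block_sum, trapezoid_product.
  set (X := csum _ (S (2 * M j))). set (Y := csum _ (S (M j))).
  assert (HP := Rpower_pos (INR (N j)) (- alpha)).
  assert (HM : 0 < INR (S (M j))) by (apply lt_0_INR; lia).
  rewrite !Cmod_mult, Cmod_pow, !Cmod_R, Cmod_circle by lra.
  assert (HMi : 0 < / INR (S (M j))) by now apply Rinv_0_lt_compat.
  rewrite (Rabs_pos_eq (Rpower _ _)), (Rabs_pos_eq (/ _)) by lra.
  assert (Hrs : 0 <= r ^ start j) by (apply pow_le; lra).
  assert (Hq : Cmod (csum (fun k => q j k * circle r t ^ k)%C (d j)) <= block_mass j).
  { eapply Rle_trans; [apply Cmod_csum|]. apply rsum_le. intros k _.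
    rewrite Cmod_mult, Cmod_pow, Cmod_circle by lra.
    rewrite <- (Rmult_1_r (Cmod (q j k))) at 2. apply Rmult_le_compat_l; [apply Cmod_ge_0|].
    rewrite <- (pow1 k). apply pow_incr. lra. }
  set (Q := Cmod (csum (fun k => q j k * circle r t ^ k)%C (d j))) in *.
  assert (HX := Cmod_ge_0 X). assert (HY := Cmod_ge_0 Y).
  assert (HXY : Cmod X * Cmod Y <= (Cmod X ^ 2 + Cmod Y ^ 2) / 2).
  { assert (H := pow2_ge_0 (Cmod X - Cmod Y)). lra. }
  rewrite Rinv_mult.
  apply Rle_trans with (Rpower (INR (N j)) (- alpha) * r ^ start j
     * (/ INR (S (M j)) * ((Cmod X ^ 2 + Cmod Y ^ 2) / 2)) * block_mass j); [|right; field; lra].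
  apply Rmult_le_compat; [|apply Cmod_ge_0| |assumption].
  - repeat apply Rmult_le_pos; lra.
  - apply Rmult_le_compat_l; [apply Rmult_le_pos; lra|]. apply Rmult_le_compat_l; lra.
Qed.

(** The constant [2] exceeds the bound [((2M+1) + (M+1)) / (2 (M+1))] for the mean of the
    modulus of the kernel. *)
Definition mean_bound (r : R) (j : nat) : R :=
  2 * Rpower (INR (N j)) (- alpha) * block_mass j * r ^ start j.

Lemma block_mean_le j r : 0 < r <= 1 ->
  RInt (fun t => Cmod (csum (fun m => block j m * circle r t ^ m)%C (2 * N j))) 0 (2 * PI)
  <= 2 * PI * mean_bound r j.
Proof.
  intros Hr. assert (HPI := PI_RGT_0).
  set (L := Rpower (INR (N j)) (- alpha) * block_mass j * r ^ start j * / (2 * INR (S (M j)))).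
  assert (HM : 0 < INR (S (M j))) by (apply lt_0_INR; lia).
  assert (HMi : 0 < / (2 * INR (S (M j)))) by (apply Rinv_0_lt_compat; lra).
  assert (HL : 0 <= L).
  { unfold L. repeat apply Rmult_le_pos; [left; apply Rpower_pos|apply block_mass_nonneg|apply pow_le; lra|lra]. }
  set (G := fun n t => Cmod (csum (fun a => (circle r t ^ d j) ^ a)%C n) ^ 2).
  assert (HG : forall n t, continuous (G n) t).
  { intros n t. assert (Hc : continuous (fun t => Cmod (csum (fun a => (circle r t ^ d j) ^ a)%C n)) t).
    { apply continuous_Cmod. apply (continuous_csum (fun a t => (circle r t ^ d j) ^ a)%C).
      intros k _. apply continuous_Cpow, continuous_Cpow, continuous_circle. }
    apply (continuous_mult (K := R_AbsRing)); [assumption|].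
    apply (continuous_mult (K := R_AbsRing)); [assumption|apply continuous_const]. }
  assert (HeG : forall n, ex_RInt (G n) 0 (2 * PI)) by (intros; apply ex_RInt_cont; auto).
  assert (HIG : forall n, RInt (G n) 0 (2 * PI) <= INR n * (2 * PI))
    by (intros; now apply geometric_sum_L2).
  assert (HI : is_RInt (fun t => L * (G (S (2 * M j)) t + G (S (M j)) t)) 0 (2 * PI)
     (L * (RInt (G (S (2 * M j))) 0 (2 * PI) + RInt (G (S (M j))) 0 (2 * PI)))).
  { apply (is_RInt_scal (V := R_NormedModule)). apply (is_RInt_plus (V := R_NormedModule));
      now apply (RInt_correct (V := R_CompleteNormedModule)). }
  eapply Rle_trans; [apply (RInt_le _ (fun t => L * (G (S (2 * M j)) t + G (S (M j)) t)))|].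
  - lra.
  - apply ex_RInt_cont. intros t. apply continuous_Cmod.
    apply (continuous_csum (fun m t => block j m * circle r t ^ m)%C). intros k _.
    apply (continuous_Cmult (fun _ => block j k)); [apply continuous_const|].
    apply continuous_Cpow, continuous_circle.
  - eexists; exact HI.
  - intros t _. now apply block_sum_le.
  - rewrite (is_RInt_unique _ _ _ _ HI).
    apply Rle_trans with (L * (INR (S (2 * M j)) * (2 * PI) + INR (S (M j)) * (2 * PI))).
    + apply Rmult_le_compat_l; [assumption|]. apply Rplus_le_compat; apply HIG.
    + apply Rle_trans with (L * (2 * (2 * INR (S (M j))) * (2 * PI))).
      * apply Rmult_le_compat_l; [assumption|].
        rewrite <- Rmult_plus_distr_r. apply Rmult_le_compat_r; [lra|].
        rewrite !S_INR, mult_INR. simpl (INR 2). generalize (pos_INR (M j)). lra.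
      * right. unfold L, mean_bound. field. lra.
Qed.

Lemma blocks_truncated m J : (m < 2 * N J)%nat -> blocks m = csum (fun j => block j m) (S J).
Proof.
  intros Hm.
  assert (H : forall a b, (a <= b)%nat -> (forall j, (a <= j)%nat -> block j m = 0) ->
    csum (fun j => block j m) b = csum (fun j => block j m) a).
  { intros a b Hab Hz. replace b with (a + (b - a))%nat by lia. rewrite csum_add.
    rewrite (csum_all_0 (fun k => block (a + k) m)); [ring|]. intros; apply Hz; lia. }
  unfold blocks. destruct (Nat.le_ge_cases m J) as [Hle|Hle].
  - symmetry. apply H; [lia|]. intros j Hj. apply block_support. generalize (N_ge_index j). lia.
  - apply H; [lia|]. intros j Hj. apply block_support.
    generalize (N_lacunary_lt J j ltac:(lia)). lia.
Qed.

(** The partial sums of the power series up to [2 N J] are sums of whole blocks and converge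
    uniformly on the circle. *)
Lemma blocks_M1_le r K : 0 < r < 1 -> (forall J, rsum (mean_bound r) J <= K) ->
  M1 (Cpseries blocks) r <= K.
Proof.
  intros Hr HK. assert (HPI := PI_RGT_0). apply le_epsilon. intros e He.
  destruct (Cpseries_approx 1 blocks r blocks_disc_coeffs) as [B [x [HB [Hx Happ]]]]; [lra|].
  destruct (geom_lt_eps B x e Hx He) as [J HJ].
  specialize (HJ (2 * N J)%nat ltac:(generalize (N_ge_index J); lia)).
  set (u := fun j t => Cmod (csum (fun m => block j m * circle r t ^ m)%C (2 * N j))).
  assert (Hu : forall j t, continuous (u j) t).
  { intros j t. apply continuous_Cmod.
    apply (continuous_csum (fun m t => block j m * circle r t ^ m)%C). intros k _.
    apply (continuous_Cmult (fun _ => block j k)); [apply continuous_const|].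
    apply continuous_Cpow, continuous_circle. }
  assert (Hpt : forall t, Cmod (Cpseries blocks (circle r t)) <= rsum (fun j => u j t) (S J) + e).
  { intros t. specialize (Happ (circle r t) (2 * N J)%nat).
    rewrite Cmod_circle in Happ by lra. specialize (Happ (Rle_refl r)).
    set (s := csum (fun k => blocks k * circle r t ^ k)%C (2 * N J)) in *.
    replace (Cpseries blocks (circle r t)) with (s + (Cpseries blocks (circle r t) - s))%C by ring.
    eapply Rle_trans; [apply Cmod_triangle|]. apply Rplus_le_compat; [|lra].
    replace s with (csum (fun j => csum (fun m => block j m * circle r t ^ m) (2 * N j)) (S J))%C.
    - apply Cmod_csum.
    - unfold s. symmetry. rewrite (csum_ext _ (fun m => csum (fun j => block j m * circle r t ^ m) (S J))%C).
      + rewrite csum_swap. apply csum_ext. intros j Hj.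
        destruct (Nat.eq_dec j J) as [->|Hne]; [reflexivity|].
        assert (Hl := N_lacunary_lt j J ltac:(lia)).
        replace (2 * N J)%nat with (2 * N j + (2 * N J - 2 * N j))%nat by lia.
        rewrite csum_add, (csum_all_0 _ (2 * N J - 2 * N j)); [ring|].
        intros k Hk. rewrite block_support by lia. ring.
      + intros m Hm. rewrite (blocks_truncated m J Hm), Cmult_comm, <- csum_scal.
        apply csum_ext. intros; ring. }
  assert (HI : is_RInt (fun t => rsum (fun j => u j t) (S J) + e) 0 (2 * PI)
     (rsum (fun j => RInt (u j) 0 (2 * PI)) (S J) + (2 * PI - 0) * e)).
  { apply (is_RInt_plus (V := R_NormedModule)); [now apply RInt_rsum|].
    apply (is_RInt_const (V := R_NormedModule)). }
  unfold M1. apply Rmult_le_reg_l with (2 * PI); [lra|].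
  rewrite <- Rmult_assoc, Rinv_r, Rmult_1_l by lra.
  eapply Rle_trans; [apply (RInt_le _ (fun t => rsum (fun j => u j t) (S J) + e))|].
  - lra.
  - apply ex_RInt_cont. intros t. apply continuous_Cmod.
    apply (continuous_holomorphic_circle 1 (Cpseries blocks) (Cpseries (deriv_coeffs blocks))).
    + apply Cpseries_holomorphic, blocks_disc_coeffs.
    + assumption.
  - eexists; exact HI.
  - intros t _. apply Hpt.
  - rewrite (is_RInt_unique _ _ _ _ HI).
    assert (rsum (fun j => RInt (u j) 0 (2 * PI)) (S J) <= 2 * PI * K); [|lra].
    apply Rle_trans with (2 * PI * rsum (mean_bound r) (S J)).
    + rewrite <- rsum_scal. apply rsum_le. intros j _. apply block_mean_le. lra.
    + apply Rmult_le_compat_l; [lra|]. apply HK.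
Qed.

End Blocks.

(** * Asymptotics of powers *)

Lemma Rpower_eventually_ge b K : 0 < b ->
  exists n0, forall n, (n0 <= n)%nat -> K <= Rpower (INR n) b.
Proof.
  intros Hb. set (K' := Rmax K 1).
  assert (HK : K <= K') by apply Rmax_l. assert (HK1 : 1 <= K') by apply Rmax_r.
  destruct (nfloor_ex (Rpower K' (/ b))) as [m [_ Hm]]; [left; apply Rpower_pos|].
  exists (S m). intros n Hn. apply Rle_trans with K'; [assumption|].
  rewrite <- (Rpower_1 K') at 1 by lra. rewrite <- (Rinv_l b) by lra.
  rewrite <- Rpower_mult. apply Rle_Rpower_l; [lra|]. split; [apply Rpower_pos|].
  apply le_INR in Hn. rewrite S_INR in Hn. lra.
Qed.

Lemma INR_eventually_ge K : exists n0, forall n, (n0 <= n)%nat -> K <= INR n.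
Proof.
  destruct (Rpower_eventually_ge 1 K Rlt_0_1) as [n0 H]. exists (S n0). intros n Hn.
  rewrite <- Rpower_1; [apply H; lia|]. apply lt_0_INR. lia.
Qed.

(** From [ln v <= v] at [v = u / (2b)]. *)
Lemma Rpower_le_exp b : 0 < b -> exists K, 0 < K /\ forall u, 0 < u -> Rpower u b <= K * exp (u / 2).
Proof.
  intros Hb. exists (exp (b * ln (2 * b))). split; [apply exp_pos|].
  intros u Hu. rewrite <- exp_plus. unfold Rpower. apply exp_le.
  assert (Hv : 0 < u / (2 * b)) by (apply Rdiv_lt_0_compat; lra).
  assert (E : ln u = ln (2 * b) + ln (u / (2 * b))).
  { rewrite <- ln_mult by lra. f_equal. field. lra. }
  assert (H : ln (u / (2 * b)) <= u / (2 * b)).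
  { rewrite <- (ln_exp (u / (2 * b))) at 2. apply ln_le; [assumption|].
    generalize (exp_ineq1_le (u / (2 * b))). lra. }
  rewrite E, Rmult_plus_distr_l. apply Rplus_le_compat_l.
  replace (u / 2) with (b * (u / (2 * b))) by (field; lra). apply Rmult_le_compat_l; lra.
Qed.

Lemma Rpower_continuous_1 b e : 0 < e ->
  exists h, 0 < h /\ forall x, Rabs (x - 1) < h -> Rabs (Rpower x b - 1) <= e.
Proof.
  intros He. assert (Hc : continuous (fun x => exp (b * ln x)) 1).
  { apply (ex_derive_continuous (K := R_AbsRing) (V := R_NormedModule) (fun x => exp (b * ln x))). auto_derive. lra. }
  assert (H1 : exp (b * ln 1) = 1) by (rewrite ln_1, Rmult_0_r; apply exp_0).
  destruct (Hc (fun y => Rabs (y - 1) < e)) as [h Hh].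
  - exists (mkposreal e He). intros y Hy. rewrite H1 in Hy. exact Hy.
  - exists h. split; [apply cond_pos|]. intros x Hx. left. apply Hh. exact Hx.
Qed.

Lemma pow_le_exp r n : 0 <= r -> r ^ n <= exp (- ((1 - r) * INR n)).
Proof.
  intros Hr. replace (- ((1 - r) * INR n)) with (INR n * (r - 1)) by ring.
  induction n as [|n IH].
  - simpl. rewrite Rmult_0_l, exp_0. lra.
  - rewrite S_INR, Rmult_plus_distr_r, exp_plus, Rmult_1_l. simpl. rewrite Rmult_comm.
    apply Rmult_le_compat; [apply pow_le; lra|lra|exact IH|].
    generalize (exp_ineq1_le (r - 1)). lra.
Qed.

Lemma eventually_and (P Q : nat -> Prop) :
  (exists n0, forall n, (n0 <= n)%nat -> P n) -> (exists n0, forall n, (n0 <= n)%nat -> Q n) ->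
  exists n0, forall n, (n0 <= n)%nat -> P n /\ Q n.
Proof.
  intros [a Ha] [b Hb]. exists (a + b)%nat. intros n Hn. split; [apply Ha|apply Hb]; lia.
Qed.

(** Any condition that holds for all large [n] can be imposed at each index on a sequence that
    grows as fast as one likes. *)
Lemma lacunary_choice (P : nat -> nat -> Prop) :
  (forall j, exists n0, forall n, (n0 <= n)%nat -> P j n) ->
  exists N : nat -> nat, (forall j, P j (N j)) /\ (forall j, (4 * N j <= N (S j))%nat).
Proof.
  intros H.
  set (n0 := fun j => proj1_sig (constructive_indefinite_description _ (H j))).
  assert (Hn0 : forall j n, (n0 j <= n)%nat -> P j n).
  { intros j. unfold n0. now destruct (constructive_indefinite_description _ (H j)). }
  set (N := fix N j := match j with O => n0 O | S i => (n0 (S i) + 4 * N i)%nat end).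
  exists N. split.
  - intros [|j]; apply Hn0; simpl; lia.
  - intros j. simpl. lia.
Qed.

(** * The hypercyclic function *)

(** The index [j] codes a triple. Two of its components are the code of a polynomial and a
    spacing; the third one runs freely, so that every such pair recurs infinitely often. *)
Definition pattern_code (j : nat) : nat := fst (Cantor.of_nat (fst (Cantor.of_nat j))).
Definition spacing (j : nat) : nat := S (snd (Cantor.of_nat (fst (Cantor.of_nat j)))).
Definition weighted_pattern (alpha : R) (j k : nat) : C :=
  (rational_C (digit (pattern_code j) k) * RtoC (Rpower (INR (S k)) alpha))%C.

Lemma codes_recur c d J : (0 < d)%nat -> exists j, (J <= j)%nat /\ pattern_code j = c /\ spacing j = d.
Proof.
  intros Hd. exists (Cantor.to_nat (Cantor.to_nat (c, pred d), J)). split.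
  - generalize (Cantor.to_nat_non_decreasing (Cantor.to_nat (c, pred d)) J). lia.
  - unfold pattern_code, spacing. rewrite Cantor.cancel_of_to. cbn [fst].
    rewrite Cantor.cancel_of_to. cbn [fst snd]. split; [reflexivity|lia].
Qed.

Definition half_length (gamma : R) (d N : nat) : nat :=
  Z.to_nat (Int_part (Rpower (INR N) (1 - gamma) / INR d)).

Lemma half_length_spec gamma d N : (0 < d)%nat ->
  INR (d * half_length gamma d N) <= Rpower (INR N) (1 - gamma)
    <= INR d * INR (S (half_length gamma d N)).
Proof.
  intros Hd. assert (HdR : 0 < INR d) by now apply lt_0_INR.
  set (Q := Rpower (INR N) (1 - gamma)). assert (HQ : 0 < Q) by apply Rpower_pos.
  unfold half_length. fold Q. set (x := Q / INR d).
  assert (Hx : 0 < x) by (apply Rdiv_lt_0_compat; assumption).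
  destruct (base_Int_part x) as [H1 H2].
  assert (Hz : (0 <= Int_part x)%Z).
  { apply Z.lt_succ_r. apply lt_IZR. rewrite succ_IZR. lra. }
  assert (E : INR (Z.to_nat (Int_part x)) = IZR (Int_part x)).
  { rewrite INR_IZR_INZ, Z2Nat.id; auto. }
  replace Q with (INR d * x) by (unfold x; field; lra).
  rewrite mult_INR, S_INR, E. split; apply Rmult_le_compat_l; lra.
Qed.

(** Cover [K] by the open discs of radius less than [1]: a finite subcover has a largest radius. *)
Lemma compact_in_disc K : compact_set K -> (forall z, K z -> Cmod z < 1) ->
  exists rho, 0 <= rho < 1 /\ forall z, K z -> Cmod z <= rho.
Proof.
  intros HK HD. destruct (HK R (fun s z => Cmod z < s < 1)) as [l Hl].
  - intros s z Hz. apply locally_Cmod. exists (s - Cmod z). split; [lra|].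
    intros y Hy. assert (H := Cmod_triangle (y - z) z).
    replace (y - z + z)%C with y in H by ring. lra.
  - intros z Hz. exists ((Cmod z + 1) / 2). specialize (HD z Hz). lra.
  - assert (Hmax : exists rho, 0 <= rho < 1 /\ forall s, List.In s l -> s < 1 -> s <= rho).
    { clear. induction l as [|a l [rho [Hr IH]]].
      - exists 0. split; [lra|]. intros s [].
      - destruct (Rlt_dec a 1) as [Ha|Ha].
        + exists (Rmax a rho). split.
          * split; [apply Rle_trans with rho; [lra|apply Rmax_r]|apply Rmax_lub_lt; lra].
          * intros s [->|Hs] Hs1; [apply Rmax_l|].
            eapply Rle_trans; [apply IH; assumption|apply Rmax_r].
        + exists rho. split; [assumption|]. intros s [->|Hs] Hs1; [lra|auto]. }
    destruct Hmax as [rho [Hr H]]. exists rho. split; [assumption|].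
    intros z Hz. destruct (Hl z Hz) as [s [Hs Hzs]]. specialize (H s Hs). lra.
Qed.

Section Hypercyclicity.

Variables (gamma alpha : R) (N : nat -> nat).
Hypothesis gamma_range : 0 < gamma < 1.

Definition repetitions (j : nat) : nat := half_length gamma (spacing j) (N j).
Definition lacunary_series : C -> C :=
  Cpseries (blocks alpha spacing repetitions N (weighted_pattern alpha)).

Notation mass := (block_mass spacing (weighted_pattern alpha)).

Hypothesis N_lacunary : forall j, (4 * N j <= N (S j))%nat.
Hypothesis N_power : forall j, 8 <= Rpower (INR (N j)) gamma.
Hypothesis N_spacing : forall j, (8 * spacing j <= N j)%nat.
Hypothesis N_mass : forall j, mass j <= INR (N j).

Lemma spacing_pos j : (0 < spacing j)%nat.
Proof. unfold spacing. lia. Qed.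

Lemma N_pos j : 1 <= INR (N j).
Proof. apply (le_INR 1). specialize (N_spacing j). generalize (spacing_pos j). lia. Qed.

Lemma repetitions_short j : (8 * repetitions j * spacing j <= N j)%nat.
Proof.
  apply INR_le. destruct (half_length_spec gamma (spacing j) (N j) (spacing_pos j)) as [H _].
  fold (repetitions j) in H. rewrite mult_INR in H. rewrite !mult_INR. simpl (INR 8).
  assert (HN := N_pos j).
  assert (E : Rpower (INR (N j)) gamma * Rpower (INR (N j)) (1 - gamma) = INR (N j)).
  { rewrite <- Rpower_plus. replace (gamma + (1 - gamma)) with 1 by ring. apply Rpower_1. lra. }
  specialize (N_power j). set (Q := Rpower (INR (N j)) (1 - gamma)) in *.
  assert (0 < Q) by apply Rpower_pos. nra.
Qed.

(** Integer exponents keep the bounds on coefficients within reach of [disc_coeffs_pow]. *)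
Lemma power_index_exists : exists p, Rabs alpha + 1 <= INR p.
Proof.
  destruct (INR_eventually_ge (Rabs alpha + 1)) as [n0 H]. exists n0. apply H. lia.
Qed.

Lemma lacunary_series_HD : HD lacunary_series.
Proof.
  destruct power_index_exists as [p Hp]. apply HD_Cpseries.
  apply (blocks_disc_coeffs alpha spacing repetitions N (weighted_pattern alpha)) with p;
    auto using spacing_pos, repetitions_short.
Qed.

Lemma N_ge_id j : (j <= N j)%nat.
Proof.
  generalize (N_ge_index spacing N spacing_pos N_spacing N_lacunary j). lia.
Qed.

(** Approximate a member of the open set by a polynomial with rational coefficients, then
    choose a spacing so large that the other copies of the polynomial do not disturb
    the one at the origin. The order matters: the polynomial is padded by zeros, so its mass,
    and with it the error bound, is fixed before the spacing is chosen. The four errors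
    (Taylor remainder, rounding, variation of the weights, other copies) are at most
    [eps / 4] each. *)
Lemma plateau_visits U g : open_HD U -> U g ->
  exists c d J, (0 < d)%nat /\ forall j, (J <= j)%nat -> pattern_code j = c -> spacing j = d ->
    forall i, (repetitions j <= i <= 2 * repetitions j)%nat ->
    U (Nat.iter (start spacing repetitions N j + spacing j * i) (taylor_shift alpha) lacunary_series).
Proof.
  intros [HU1 HU2] Hg. destruct (HU2 g Hg) as [K [eps [HK [HKD HKU]]]].
  destruct (compact_in_disc K HK HKD) as [rho [Hrho HKrho]].
  destruct power_index_exists as [p Hp].
  assert (He : 0 < eps / 4) by (generalize (cond_pos eps); lra).
  assert (HgD := HU1 g Hg).
  destruct (Cpseries_approx 1 _ rho (HD_disc_coeffs g HgD) Hrho) as [B1 [x1 [HB1 [Hx1 Happ1]]]].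
  destruct (geom_lt_eps B1 x1 (eps / 4) Hx1 He) as [d0 Hd0].
  specialize (Hd0 d0 (le_n _)).
  (* rational coefficients close to those of the Taylor polynomial, padded by zeros *)
  set (eta := eps / 4 / (INR d0 + 1)).
  assert (Hd0p := pos_INR d0).
  assert (Heta : 0 < eta) by (apply Rdiv_lt_0_compat; lra).
  set (near := fun k => constructive_indefinite_description _ (rational_C_dense (taylor_coeff g k) eta Heta)).
  set (x := fun k => if (k <? d0)%nat then proj1_sig (near k) else O).
  set (P := fun k => rational_C (x k)).
  assert (HP1 : forall k, (k < d0)%nat -> Cmod (P k - taylor_coeff g k) < eta).
  { intros k Hk. unfold P, x. destruct (Nat.ltb_spec k d0); [|lia]. apply (proj2_sig (near k)). }
  assert (HP2 : forall k, (d0 <= k)%nat -> P k = 0).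
  { intros k Hk. unfold P, x. destruct (Nat.ltb_spec k d0); [lia|]. apply rational_C_0. }
  set (A := rsum (fun k => Cmod (P k * RtoC (Rpower (INR (S k)) alpha))) d0).
  set (A' := rsum (fun k => Cmod (P k)) d0).
  assert (HA : 0 <= A) by (apply rsum_nonneg; intros; apply Cmod_ge_0).
  assert (HA' : 0 <= A') by (apply rsum_nonneg; intros; apply Cmod_ge_0).
  destruct (disc_coeffs_geom 1 _ rho (disc_coeffs_pow p) Hrho) as [B [q [HB [Hq Hpow]]]].
  destruct (geom_lt_eps (4 * Rpower 2 (Rabs alpha) * (A + 1) * B * / (1 - q)) q (eps / 4) Hq He)
    as [d1 Hd1].
  set (d := S (d0 + d1)). specialize (Hd1 d ltac:(unfold d; lia)).
  destruct (digit_surj d x) as [c Hc].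
  set (eta2 := eps / 4 / (A' + 1)).
  assert (Heta2 : 0 < eta2) by (apply Rdiv_lt_0_compat; lra).
  destruct (Rpower_continuous_1 alpha eta2 Heta2) as [h [Hh Hcont]].
  assert (Hratio : exists n0, forall n, (n0 <= n)%nat ->
     2 / h <= Rpower (INR n) gamma /\ 4 * INR d / h <= INR n).
  { apply eventually_and; [apply Rpower_eventually_ge; lra|apply INR_eventually_ge]. }
  destruct Hratio as [J HJ].
  exists c, d, J. split; [unfold d; lia|].
  intros j Hj Hcode Hsp i Hi.
  assert (HjN := N_ge_id j).
  destruct (HJ (N j) ltac:(lia)) as [HJ1 HJ2].
  assert (Hpat : forall k, (k < d)%nat -> rational_C (digit (pattern_code j) k) = P k).
  { intros k Hk. rewrite Hcode, Hc by assumption. reflexivity. }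
  assert (Hpad : forall (u : nat -> R), (forall k, (d0 <= k)%nat -> u k = 0) -> rsum u d = rsum u d0).
  { intros u Hu. unfold d. assert (Hs : forall m, rsum u (d0 + m) = rsum u d0).
    { induction m as [|m IH]; [now rewrite Nat.add_0_r|].
      rewrite Nat.add_succ_r. simpl. rewrite IH, Hu by lia. ring. }
    replace (S (d0 + d1)) with (d0 + S d1)%nat by lia. apply Hs. }
  assert (Hmass : mass j = A).
  { unfold block_mass. rewrite Hsp. unfold A.
    rewrite <- (Hpad (fun k => Cmod (P k * RtoC (Rpower (INR (S k)) alpha)))).
    - apply rsum_ext. intros k Hk. unfold weighted_pattern. now rewrite Hpat.
    - intros k Hk. rewrite HP2 by assumption. rewrite Cmult_0_l. apply Cmod_0. }
  assert (HWP : forall k, (k < d)%nat ->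
    (weighted_pattern alpha j k * RtoC (Rpower (INR (S k)) (- alpha)))%C = P k).
  { intros k Hk. unfold weighted_pattern.
    rewrite Hpat, <- Cmult_assoc, <- RtoC_mult, <- Rpower_plus by assumption.
    rewrite Rplus_opp_r, Rpower_O by (apply lt_0_INR; lia). apply Cmult_1_r. }
  apply HKU; [apply HD_iter_shift, lacunary_series_HD|].
  intros z Hz. specialize (HKrho z Hz).
  assert (Hmain := shifted_blocks_approx alpha spacing repetitions N (weighted_pattern alpha)
    spacing_pos repetitions_short N_spacing N_lacunary N_mass p Hp j i z rho B q eta2 Hi
    ltac:(lra) HB Hq).
  cbv zeta in Hmain. rewrite Hmass, Hsp in Hmain.
  rewrite (csum_ext _ (fun k => P k * z ^ k)%C) in Hmain by (intros k Hk; now rewrite HWP).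
  rewrite (rsum_ext _ (fun k => Cmod (P k))) in Hmain by (intros k Hk; now rewrite HWP).
  rewrite Hpad in Hmain by (intros k Hk; rewrite HP2 by assumption; apply Cmod_0).
  fold A' in Hmain. rewrite Hsp.
  set (n := (start spacing repetitions N j + d * i)%nat) in *.
  set (F := Nat.iter n (taylor_shift alpha) lacunary_series).
  assert (HF : Cmod (F z - csum (fun k => P k * z ^ k)%C d)%C <= eta2 * A' + eps / 4).
  { eapply Rle_trans; [apply Hmain|lra].
    - intros k. specialize (Hpow k). rewrite Cmod_R, Rabs_pos_eq in Hpow; [exact Hpow|].
      apply pow_le, pos_INR.
    - intros k Hk. apply Hcont.
      destruct (start_bounds spacing repetitions N repetitions_short j) as [_ Hst].
      destruct (half_length_spec gamma (spacing j) (N j) (spacing_pos j)) as [HL _].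
      fold (repetitions j) in HL. rewrite Hsp in Hst, HL.
      assert (HN := N_pos j).
      assert (EQ : Rpower (INR (N j)) gamma * Rpower (INR (N j)) (1 - gamma) = INR (N j)).
      { rewrite <- Rpower_plus. replace (gamma + (1 - gamma)) with 1 by ring. apply Rpower_1. lra. }
      set (Q := Rpower (INR (N j)) (1 - gamma)) in *. assert (HQ : 0 < Q) by apply Rpower_pos.
      assert (H1 : (N j <= S (n + k) + d * repetitions j)%nat) by (unfold n; nia).
      assert (H2 : (S (n + k) <= N j + d)%nat) by (unfold n; nia).
      apply le_INR in H1. apply le_INR in H2. rewrite plus_INR in H1, H2.
      assert (Hdp : 1 <= INR d) by (apply (le_INR 1); unfold d; lia).
      assert (H3 : 2 * Q <= h * INR (N j)).
      { apply Rmult_le_compat_r with (r := h * Q) in HJ1; [|apply Rmult_le_pos; lra].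
        replace (2 / h * (h * Q)) with (2 * Q) in HJ1 by (field; lra).
        rewrite <- EQ. lra. }
      assert (H4 : 4 * INR d <= h * INR (N j)).
      { apply Rmult_le_compat_r with (r := h) in HJ2; [|lra].
        replace (4 * INR d / h * h) with (4 * INR d) in HJ2 by (field; lra). lra. }
      replace (INR (S (n + k)) / INR (N j) - 1) with ((INR (S (n + k)) - INR (N j)) / INR (N j))
        by (field; lra).
      unfold Rdiv. rewrite Rabs_mult, (Rabs_pos_eq (/ _)) by (left; apply Rinv_0_lt_compat; lra).
      apply Rmult_lt_reg_r with (INR (N j)); [lra|].
      rewrite Rmult_assoc, Rinv_l, Rmult_1_r by lra.
      apply Rabs_def1; lra. }
  assert (HA2 : eta2 * A' <= eps / 4).
  { replace (eps / 4) with (eta2 * (A' + 1)) by (unfold eta2; field; lra).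
    apply Rmult_le_compat_l; lra. }
  assert (HPg : Cmod (csum (fun k => P k * z ^ k) d - csum (fun k => taylor_coeff g k * z ^ k) d0)%C
     <= INR d0 * eta).
  { replace (csum (fun k => P k * z ^ k)%C d) with (csum (fun k => P k * z ^ k)%C d0).
    - replace (csum (fun k => P k * z ^ k) d0 - csum (fun k => taylor_coeff g k * z ^ k) d0)%C
        with (csum (fun k => P k * z ^ k) d0 + (- (1)) * csum (fun k => taylor_coeff g k * z ^ k) d0)%C
        by ring.
      rewrite <- csum_scal, <- csum_plus. eapply Rle_trans; [apply Cmod_csum|].
      rewrite <- rsum_const. apply rsum_le. intros k Hk.
      replace (P k * z ^ k + - (1) * (taylor_coeff g k * z ^ k))%C
        with ((P k - taylor_coeff g k) * z ^ k)%C by ring.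
      rewrite Cmod_mult, Cmod_pow, <- (Rmult_1_r eta).
      apply Rmult_le_compat; [apply Cmod_ge_0|apply pow_le, Cmod_ge_0| |].
      + left. now apply HP1.
      + rewrite <- (pow1 k). apply pow_incr. split; [apply Cmod_ge_0|lra].
    - unfold d. replace (S (d0 + d1)) with (d0 + S d1)%nat by lia. rewrite csum_add.
      rewrite (csum_all_0 (fun k => P (d0 + k)%nat * z ^ (d0 + k))%C); [ring|].
      intros k _. rewrite HP2 by lia. ring. }
  assert (Hde : INR d0 * eta <= eps / 4).
  { replace (eps / 4) with ((INR d0 + 1) * eta) by (unfold eta; field; lra).
    apply Rmult_le_compat_r; lra. }
  specialize (Happ1 z d0 HKrho). rewrite <- (HD_eq_Cpseries g z HgD) in Happ1 by lra.
  replace (F z - g z)%C with ((F z - csum (fun k => P k * z ^ k) d)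
    + ((csum (fun k => P k * z ^ k) d - csum (fun k => taylor_coeff g k * z ^ k) d0)
       + - (g z - csum (fun k => taylor_coeff g k * z ^ k) d0)))%C by ring.
  eapply Rle_lt_trans; [apply Cmod_triangle|].
  assert (H5 := Cmod_triangle
    (csum (fun k => P k * z ^ k) d - csum (fun k => taylor_coeff g k * z ^ k) d0)%C
    (- (g z - csum (fun k => taylor_coeff g k * z ^ k) d0))%C).
  rewrite Cmod_opp in H5. lra.
Qed.

Lemma lacunary_series_hypercyclic :
  U_frequently_hypercyclic gamma (taylor_shift alpha) lacunary_series.
Proof.
  split; [apply lacunary_series_HD|]. intros U HU [g Hg].
  destruct (plateau_visits U g HU Hg) as [c [d [J [Hd Hvis]]]].
  assert (HdR : 0 < INR d) by now apply lt_0_INR.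
  assert (Hgi : 0 < / gamma) by (apply Rinv_0_lt_compat; lra).
  apply Rbar_lt_le_trans with (/ (exp 1 * INR d * (1 + / gamma))).
  { simpl. apply Rinv_0_lt_compat. assert (H := exp_pos 1).
    repeat apply Rmult_lt_0_compat; lra. }
  apply LimSup_seq_ge. intros n0.
  destruct (codes_recur c d (J + n0) Hd) as [j [Hj [Hcode Hsp]]].
  assert (HjN := N_ge_id j). exists (N j). split; [lia|].
  destruct (start_bounds spacing repetitions N repetitions_short j) as [_ Hst].
  assert (Hshort := repetitions_short j). assert (HN := N_spacing j). rewrite Hsp in *.
  apply progression_density with (repetitions j); [assumption|assumption|nia| |].
  - unfold repetitions. rewrite Hsp. now apply half_length_spec.
  - intros i Hi.
    replace (N j - d * i)%nat
      with (start spacing repetitions N j + spacing j * (2 * repetitions j - i))%nat.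
    + apply Hvis; lia.
    + rewrite Hsp, Nat.mul_sub_distr_l.
      assert (d * i <= d * (2 * repetitions j))%nat by (apply Nat.mul_le_mono_l; lia). lia.
Qed.

End Hypercyclicity.

(** * Growth of the means *)

(** Stated at [0+] for the variable [1 - r]. *)
Lemma iter_log_diverges l B :
  exists e, 0 < e /\ forall x, 0 < x < e -> B <= iter_log l (- ln x).
Proof.
  revert B. induction l as [|l IH]; intros B.
  - exists (exp (- B)). split; [apply exp_pos|]. intros x Hx. unfold iter_log. simpl.
    assert (ln x <= - B); [|lra]. rewrite <- (ln_exp (- B)). apply ln_le; lra.
  - destruct (IH (exp B)) as [e [He H]]. exists e. split; [assumption|].
    intros x Hx. change (iter_log (S l) (- ln x)) with (ln (iter_log l (- ln x))).
    rewrite <- (ln_exp B) at 1. apply ln_le; [apply exp_pos|now apply H].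
Qed.

Lemma half_powers_sum J : rsum (fun j => (1 / 2) ^ j) J <= 2.
Proof. eapply Rle_trans; [apply rsum_geom; lra|]. right. field. Qed.

Section Growth.

Variables (alpha : R) (d M N : nat -> nat) (q : nat -> nat -> C).

Hypothesis block_short : forall j, (8 * M j * d j <= N j)%nat.
Hypothesis N_pos : forall j, 1 <= INR (N j).

Lemma mean_bound_le_exp r j : 0 < r < 1 ->
  mean_bound alpha d M N q r j <=
  2 * block_mass d q j * (Rpower (INR (N j)) (- alpha) * exp (- ((1 - r) * INR (N j) / 2))).
Proof.
  intros Hr. unfold mean_bound.
  replace (2 * block_mass d q j * (Rpower (INR (N j)) (- alpha) * exp (- ((1 - r) * INR (N j) / 2))))
    with (2 * Rpower (INR (N j)) (- alpha) * block_mass d q j * exp (- ((1 - r) * INR (N j) / 2)))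
    by ring.
  apply Rmult_le_compat_l.
  - apply Rmult_le_pos; [|apply block_mass_nonneg].
    generalize (Rpower_pos (INR (N j)) (- alpha)). lra.
  - eapply Rle_trans; [apply pow_le_exp; lra|]. apply exp_le.
    destruct (start_bounds d M N block_short j) as [Hs _].
    apply le_INR in Hs. rewrite !mult_INR in Hs. simpl (INR 3) in Hs. simpl (INR 4) in Hs.
    specialize (N_pos j). nra.
Qed.

(** The mass of block [j] is compensated by [N^(-alpha)], up to a factor [2^(-j)]. *)
Lemma means_bounded_positive r J :
  0 < r < 1 ->
  (forall j, 2 * block_mass d q j * 2 ^ j <= Rpower (INR (N j)) alpha) ->
  rsum (mean_bound alpha d M N q r) J <= 2.
Proof.
  intros Hr H. eapply Rle_trans; [|apply (half_powers_sum J)]. apply rsum_le. intros j _.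
  eapply Rle_trans; [now apply mean_bound_le_exp|].
  specialize (H j). specialize (N_pos j).
  assert (HP := Rpower_pos (INR (N j)) alpha). rewrite Rpower_Ropp.
  assert (H2 : 0 < 2 ^ j) by (apply pow_lt; lra).
  assert (Hm := block_mass_nonneg d q j).
  assert (He : exp (- ((1 - r) * INR (N j) / 2)) <= 1).
  { apply Rle_trans with (exp 0); [apply exp_le|rewrite exp_0; lra].
    assert (0 <= (1 - r) * INR (N j)) by (apply Rmult_le_pos; lra). lra. }
  apply Rle_trans with (2 * block_mass d q j * (/ Rpower (INR (N j)) alpha * 1)).
  - apply Rmult_le_compat_l; [lra|]. apply Rmult_le_compat_l; [|assumption].
    left. now apply Rinv_0_lt_compat.
  - unfold Rdiv. rewrite Rmult_1_r, Rmult_1_l, pow_inv.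
    apply Rmult_le_reg_r with (Rpower (INR (N j)) alpha * 2 ^ j); [now apply Rmult_lt_0_compat|].
    replace (2 * block_mass d q j * / Rpower (INR (N j)) alpha * (Rpower (INR (N j)) alpha * 2 ^ j))
      with (2 * block_mass d q j * 2 ^ j) by (field; lra).
    replace (/ 2 ^ j * (Rpower (INR (N j)) alpha * 2 ^ j)) with (Rpower (INR (N j)) alpha)
      by (field; lra). assumption.
Qed.

(** With [u = (1-r) N], the cost of a block is at most its mass times
    [(1-r)^alpha u^(-alpha) exp (- u/2)], and [u^(-alpha) exp (- u/2)] is bounded. If moreover
    [(1-r)^2 N > 1] then [u >= sqrt N], and the exponential beats both [N^(-alpha)] and the mass.
    If block [J] is of the other kind, the sum of all the masses up to [J] is at most [G]. *)
Lemma means_bounded_negative r J K1 K2 G :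
  alpha < 0 -> 0 < r < 1 -> 0 <= K1 -> 0 <= G ->
  (forall u, 0 < u -> Rpower u (- alpha) <= K1 * exp (u / 2)) ->
  (forall u, 0 < u -> Rpower u (2 * (- alpha) + 1) <= K2 * exp (u / 2)) ->
  (forall j, 2 * block_mass d q j * K2 * 2 ^ j <= Rpower (INR (N j)) (1 / 2)) ->
  (forall j, (1 - r) ^ 2 * INR (N j) <= 1 -> rsum (fun i => 2 * block_mass d q i) (S j) <= G) ->
  rsum (mean_bound alpha d M N q r) J <= K1 * Rpower (1 - r) alpha * G + 2.
Proof.
  intros Ha Hr HK1 HG HE1 HE2 HN HGj. set (de := 1 - r). assert (Hde : 0 < de) by (unfold de; lra).
  assert (HPd := Rpower_pos de alpha).
  assert (Hm := block_mass_nonneg d q).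
  assert (Hexp : forall u, exp (- (u / 2)) * exp (u / 2) = 1).
  { intros u. rewrite <- exp_plus, Rplus_opp_l. apply exp_0. }
  assert (T1 : forall j, mean_bound alpha d M N q r j <= K1 * Rpower de alpha * (2 * block_mass d q j)).
  { intros j. eapply Rle_trans; [now apply mean_bound_le_exp|]. fold de.
    rewrite (Rmult_comm (K1 * _)). apply Rmult_le_compat_l; [specialize (Hm j); lra|].
    specialize (N_pos j). set (u := de * INR (N j)). assert (Hu : 0 < u) by (apply Rmult_lt_0_compat; lra).
    replace (INR (N j)) with (/ de * u) at 1 by (unfold u; field; lra).
    rewrite <- Rpower_mult_distr by (try apply Rinv_0_lt_compat; assumption).
    replace (Rpower (/ de) (- alpha)) with (Rpower de alpha)
      by (unfold Rpower; rewrite ln_Rinv by assumption; f_equal; ring).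
    specialize (HE1 u Hu). specialize (Hexp u). assert (H0 := exp_pos (- (u / 2))).
    apply Rmult_le_compat_r with (r := exp (- (u / 2))) in HE1; [|lra].
    rewrite Rmult_assoc, (Rmult_comm (exp (u / 2))), Hexp, Rmult_1_r in HE1.
    rewrite Rmult_assoc, (Rmult_comm K1). apply Rmult_le_compat_l; lra. }
  assert (T2 : forall j, 1 < de ^ 2 * INR (N j) -> mean_bound alpha d M N q r j <= (1 / 2) ^ j).
  { intros j Hj. eapply Rle_trans; [now apply mean_bound_le_exp|]. fold de.
    specialize (N_pos j). set (u := de * INR (N j)). assert (Hu : 0 < u) by (apply Rmult_lt_0_compat; lra).
    specialize (HE2 u Hu). specialize (Hexp u). assert (H0 := exp_pos (- (u / 2))).
    assert (HNa := Rpower_pos (INR (N j)) (- alpha)).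
    assert (HNh := Rpower_pos (INR (N j)) (1 / 2)).
    (* [u^2 = ((1-r)^2 N) N >= N] *)
    assert (Hln : ln (INR (N j)) <= 2 * ln u).
    { replace (2 * ln u) with (ln (u * u)) by (rewrite ln_mult by assumption; ring).
      apply ln_le; [lra|].
      replace (u * u) with (de ^ 2 * INR (N j) * INR (N j)) by (unfold u; ring). nra. }
    assert (Hpow : Rpower (INR (N j)) (- alpha) * Rpower (INR (N j)) (1 / 2)
       <= Rpower u (2 * (- alpha) + 1)).
    { rewrite <- Rpower_plus. unfold Rpower. apply exp_le. nra. }
    assert (Hkey : Rpower (INR (N j)) (- alpha) * exp (- (u / 2)) * Rpower (INR (N j)) (1 / 2) <= K2).
    { apply Rle_trans with (Rpower u (2 * (- alpha) + 1) * exp (- (u / 2))).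
      - rewrite Rmult_assoc, (Rmult_comm (exp _)), <- Rmult_assoc.
        apply Rmult_le_compat_r; lra.
      - apply Rmult_le_compat_r with (r := exp (- (u / 2))) in HE2; [|lra].
        rewrite Rmult_assoc, (Rmult_comm (exp (u / 2))), Hexp, Rmult_1_r in HE2. exact HE2. }
    specialize (HN j). specialize (Hm j).
    assert (H2 : 0 < 2 ^ j) by (apply pow_lt; lra).
    set (X := Rpower (INR (N j)) (- alpha) * exp (- (u / 2))) in *.
    set (Y := Rpower (INR (N j)) (1 / 2)) in *.
    unfold Rdiv at 1. rewrite Rmult_1_l, pow_inv.
    apply Rmult_le_reg_r with (Y * 2 ^ j); [now apply Rmult_lt_0_compat|].
    replace (/ 2 ^ j * (Y * 2 ^ j)) with Y by (field; lra).
    eapply Rle_trans; [|exact HN].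
    replace (2 * block_mass d q j * X * (Y * 2 ^ j))
      with (2 * block_mass d q j * 2 ^ j * (X * Y)) by ring.
    replace (2 * block_mass d q j * K2 * 2 ^ j) with (2 * block_mass d q j * 2 ^ j * K2) by ring.
    apply Rmult_le_compat_l; [|assumption]. apply Rmult_le_pos; lra. }
  assert (HX : 0 <= K1 * Rpower de alpha) by (apply Rmult_le_pos; lra).
  assert (HXG : 0 <= K1 * Rpower de alpha * G) by (now apply Rmult_le_pos).
  apply Rle_trans with (K1 * Rpower de alpha * G + rsum (fun j => (1 / 2) ^ j) J).
  2: apply Rplus_le_compat_l, half_powers_sum.
  induction J as [|J IH].
  - simpl. lra.
  - destruct (Rle_dec (de ^ 2 * INR (N J)) 1) as [Hle|Hgt].
    + apply Rle_trans with (K1 * Rpower de alpha * G).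
      * apply Rle_trans with (K1 * Rpower de alpha * rsum (fun i => 2 * block_mass d q i) (S J)).
        -- rewrite <- rsum_scal. apply rsum_le. intros j _. apply T1.
        -- apply Rmult_le_compat_l; [assumption|]. now apply HGj.
      * assert (0 <= rsum (fun j => (1 / 2) ^ j) (S J)); [|lra].
        apply rsum_nonneg. intros. apply pow_le. lra.
    + cbn [rsum]. specialize (T2 J ltac:(lra)). lra.
Qed.

End Growth.

(** All the requirements on [N j] hold for large integers once the masses of the blocks up to
    [j] are known, and these masses depend on the enumeration of polynomials only. *)
Lemma means_optimal gamma l alpha : 0 < gamma < 1 -> alpha <> 0 ->
  exists (f : C -> C) (c : R),
    U_frequently_hypercyclic gamma (taylor_shift alpha) f /\
    0 < c /\
    at_left 1 (fun r =>
      (alpha < 0 -> M1 f r <= c * Rpower (1 - r) alpha * iter_log l (- ln (1 - r))) /\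
      (0 < alpha -> M1 f r <= c)).
Proof.
  intros Hg Ha.
  assert (Ha' : 0 < Rabs alpha) by now apply Rabs_pos_lt.
  destruct (Rpower_le_exp (Rabs alpha) Ha') as [K1 [HK1 HE1]].
  destruct (Rpower_le_exp (2 * Rabs alpha + 1)) as [K2 [HK2 HE2]]; [lra|].
  set (mass := block_mass spacing (weighted_pattern alpha)).
  destruct (lacunary_choice (fun j n =>
      (8 <= Rpower (INR n) gamma) /\ ((8 * spacing j <= n)%nat) /\ (mass j <= INR n) /\
      (2 * mass j * 2 ^ j <= Rpower (INR n) (Rabs alpha)) /\
      (2 * mass j * K2 * 2 ^ j <= Rpower (INR n) (1 / 2)) /\
      (forall e, 0 < e -> e ^ 2 * INR n <= 1 ->
         rsum (fun i => 2 * mass i) (S j) <= iter_log l (- ln e)))) as [N [HN Hlac]].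
  { intros j. repeat apply eventually_and.
    - apply Rpower_eventually_ge. lra.
    - exists (8 * spacing j)%nat. auto.
    - apply INR_eventually_ge.
    - now apply Rpower_eventually_ge.
    - apply Rpower_eventually_ge. lra.
    - destruct (iter_log_diverges l (rsum (fun i => 2 * mass i) (S j))) as [e0 [He0 H]].
      destruct (INR_eventually_ge (2 / e0 ^ 2)) as [n0 Hn0]. exists n0. intros n Hn e He Hen.
      apply H. split; [assumption|]. apply Rnot_le_lt. intros Hle. specialize (Hn0 n Hn).
      assert (Hsq : 0 < e0 ^ 2) by (apply pow_lt; assumption).
      apply Rmult_le_compat_l with (r := e0 ^ 2) in Hn0; [|lra].
      replace (e0 ^ 2 * (2 / e0 ^ 2)) with 2 in Hn0 by (field; lra).
      assert (e0 ^ 2 <= e ^ 2) by (apply pow_incr; lra).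
      assert (e0 ^ 2 * INR n <= e ^ 2 * INR n) by (apply Rmult_le_compat_r; [apply pos_INR|assumption]).
      lra. }
  assert (HP := fun j => proj1 (HN j)).
  assert (HS := fun j => proj1 (proj2 (HN j))).
  assert (HM := fun j => proj1 (proj2 (proj2 (HN j)))).
  assert (HA := fun j => proj1 (proj2 (proj2 (proj2 (HN j))))).
  assert (HB := fun j => proj1 (proj2 (proj2 (proj2 (proj2 (HN j)))))).
  assert (HG := fun j => proj2 (proj2 (proj2 (proj2 (proj2 (HN j)))))). cbv beta in *.
  exists (lacunary_series gamma alpha N), (K1 + 2).
  split; [now apply lacunary_series_hypercyclic|]. split; [lra|].
  destruct (iter_log_diverges l 1) as [e0 [He0 Hlog]].
  assert (Hmin : 0 < Rmin e0 1) by (apply Rmin_pos; lra).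
  exists (mkposreal _ Hmin). intros r Hr Hr1.
  change (Rabs (r - 1) < Rmin e0 1) in Hr. apply Rabs_def2 in Hr.
  assert (Hr2 := Rmin_l e0 1). assert (Hr3 := Rmin_r e0 1).
  assert (Hr0 : 0 < r < 1) by lra.
  assert (Hshort := repetitions_short gamma N Hg HP HS).
  assert (HNp := N_pos N HS).
  destruct power_index_exists with alpha as [p Hp].
  assert (HM1 : forall K, (forall J, rsum (mean_bound alpha spacing (repetitions gamma N) N
      (weighted_pattern alpha) r) J <= K) -> M1 (lacunary_series gamma alpha N) r <= K).
  { intros K. apply blocks_M1_le with p; auto using spacing_pos. }
  split; intros Hsign.
  - rewrite Rabs_left in * by assumption.
    set (L := iter_log l (- ln (1 - r))).
    assert (HL : 1 <= L) by (apply Hlog; lra).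
    apply Rle_trans with (K1 * Rpower (1 - r) alpha * L + 2).
    + apply HM1. intros J. apply means_bounded_negative with K2; try assumption; try lra.
      intros j Hj. apply HG; [lra|assumption].
    + assert (H1 : 1 <= Rpower (1 - r) alpha).
      { unfold Rpower. apply Rle_trans with (exp 0); [rewrite exp_0; lra|apply exp_le].
        assert (ln (1 - r) <= 0) by (rewrite <- ln_1; apply ln_le; lra). nra. }
      rewrite !Rmult_plus_distr_r. nra.
  - rewrite Rabs_pos_eq in * by lra. apply Rle_trans with 2; [|lra].
    apply HM1. intros J. apply means_bounded_positive; assumption.
Qed.

Theorem theorem4p12 :
  forall gamma : R, 0 < gamma < 1 ->
  (forall (alpha : R) (f : C -> C),
     U_frequently_hypercyclic gamma (taylor_shift alpha) f ->
     (alpha <= 0 ->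
        LimSup (at_left 1) (fun r => Rpower (1 - r) (- alpha) * M1 f r) = p_infty) /\
     (0 < alpha ->
        Rbar_lt 0 (LimSup (at_left 1) (fun r => M1 f r)))) /\
  (forall (l : nat) (alpha : R), (1 <= l)%nat -> alpha <> 0 ->
     exists (f : C -> C) (c : R),
       U_frequently_hypercyclic gamma (taylor_shift alpha) f /\
       0 < c /\
       at_left 1 (fun r =>
         (alpha < 0 ->
            M1 f r <= c * Rpower (1 - r) alpha * iter_log l (- ln (1 - r))) /\
         (0 < alpha -> M1 f r <= c))).
Proof.
  intros gamma Hg. split.
  - intros alpha f Hf. split.
    + intros _. now apply means_unbounded with gamma.
    + intros _. now apply means_not_vanishing with gamma alpha.
  - intros l alpha _ Ha. now apply means_optimal.
Qed.
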